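(* Let $a<b$ be real numbers, $\Omega=(a,b)$, and let $\lambda\in\mathbb{C}$. The following are equivalent: (i) The singular integral equation $$\lambda u(x)-\frac1{i\pi}\,\mathrm{p.v.}\!\int_\Omega\frac{u(y)}{x-y}\,dy=f(x),\qquad x\in\Omega,$$ has a unique solution $u\in L^2(\Omega)$ for any $f\in L^2(\Omega)$. (ii) The discretization method $(\lambda I-T^N)U=F$ is stable in the $\ell^2$ norm, where $T^N$ is the matrix of $$\lambda u_m-\frac1{i\pi N}\sum_{n\in\omega^N,\,n\ne m}\frac{u_n}{x^N_m-x^N_n}=f(x^N_m)\qquad(m\in\omega^N).$$ (iii) $\lambda\notin\mathcal{C}$, where $\mathcal{C}=[-1,1]$. For such $\lambda$ and for all $N$ with $\omega^N\neq\emptyset$, the operator norms satisfy $$\|(\lambda I-T^N)^{-1}\|_{\mathcal{L}(\ell^2(\omega^N))}\le\|(\lambda I-A_\Omega)^{-1}\|_{\mathcal{L}(L^2(\Omega))}.$$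
   Context: $A_\Omega$ is the bounded operator on $L^2(\Omega)$ defined by $A_\Omega u(x)=\frac1{i\pi}\,\mathrm{p.v.}\int_\Omega\frac{u(y)}{x-y}\,dy$ (finite Hilbert transformation). For each positive integer $N$ an origin $a^N\in\mathbb{R}$ is fixed, $x^N_m=a^N+\frac mN$ for $m\in\mathbb{Z}$, and $\omega^N=\{m\in\mathbb{Z}\mid x^N_m\in\Omega\}$. The matrix $T^N$ has entries $\frac{1}{i\pi N}\frac{1}{x^N_m-x^N_n}=\frac1{i\pi(m-n)}$ for $m\neq n$ in $\omega^N$, and zero diagonal. The method is called stable in the $\ell^2$ norm if there is a constant $C$ such that for all $N$ with $\omega^N\ne\emptyset$ the matrix $\lambda I-T^N$ is invertible and $\|(\lambda I-T^N)^{-1}\|_{\mathcal{L}(\ell^2(\omega^N))}\le C$. *)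

(* Defs.v *)
From HB Require Import structures.
From mathcomp Require Import all_boot all_order all_algebra finmap.
From mathcomp Require Import complex.
From mathcomp Require Import all_classical all_reals all_analysis.

Set Implicit Arguments.
Unset Strict Implicit.
Unset Printing Implicit Defensive.

Import Order.TTheory GRing.Theory Num.Theory.
Import numFieldNormedType.Exports.

Local Open Scope classical_set_scope.
Local Open Scope complex_scope.
Local Open Scope ring_scope.

Definition cnorm (R : realType) (z : R[i]) : R := ComplexField.Normc.normc z.

Definition cinterval (R : realType) : set R[i] :=
  [set x%:C | x in `[(-1 : R), 1]].

(** Elements of L^2(]a, b[) are represented by functions on the whole line,
    whose values outside of ]a, b[ are irrelevant; identification of functions
    that are equal almost everywhere on ]a, b[ is explicit in the statements. *)

Definition Omega (R : realType) (a b : R) : set R := `]a, b[.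

Definition ae_on (R : realType) (a b : R) (P : R -> Prop) : Prop :=
  {ae (@lebesgue_measure R), forall x, Omega a b x -> P x}.

Definition L2norm (R : realType) (a b : R) (u : R -> R[i]) : \bar R :=
  Lnorm (@lebesgue_measure R) 2%:E
    (EFin \o ((fun x => cnorm (u x)) \_ (Omega a b))).

Definition L2 (R : realType) (a b : R) (u : R -> R[i]) : Prop :=
  [/\ measurable_fun (Omega a b) (fun x => complex.Re (u x)),
      measurable_fun (Omega a b) (fun x => complex.Im (u x)) &
      (L2norm a b u < +oo)%E].

Definition cintegral (R : realType) (D : set R) (u : R -> R[i]) : R[i] :=
  (\int[@lebesgue_measure R]_(y in D) complex.Re (u y)) +i*
  (\int[@lebesgue_measure R]_(y in D) complex.Im (u y)).

(** [is_pv a b u x l]: the principal value of the integral over ]a, b[ of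
    u(y) / (x - y) exists at x, and it equals l. *)

Definition truncated_integral (R : realType) (a b : R) (u : R -> R[i])
    (x e : R) : R[i] :=
  cintegral (Omega a b `&` [set y | e < `|x - y|])
    (fun y => u y / (x - y)%:C).

Definition is_pv (R : realType) (a b : R) (u : R -> R[i]) (x : R) (l : R[i]) :
    Prop :=
  (complex.Re (truncated_integral a b u x e) @[e --> 0^'+] --> complex.Re l) /\
  (complex.Im (truncated_integral a b u x e) @[e --> 0^'+] --> complex.Im l).

(** The finite Hilbert transformation, as the graph of an operator:
    [fht a b u v] means A u = v almost everywhere on ]a, b[. *)

Definition fht (R : realType) (a b : R) (u v : R -> R[i]) : Prop :=
  ae_on a b (fun x =>
    exists2 l, is_pv a b u x l & v x = ('i%C * (pi : R)%:C)^-1 * l).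

Definition sing_int_eq (R : realType) (a b : R) (lam : R[i])
    (u f : R -> R[i]) : Prop :=
  exists2 v, fht a b u v & ae_on a b (fun x => lam * u x - v x = f x).

Definition uniquely_solvable (R : realType) (a b : R) (lam : R[i]) : Prop :=
  forall f, L2 a b f ->
    exists u, [/\ L2 a b u, sing_int_eq a b lam u f &
      forall u', L2 a b u' -> sing_int_eq a b lam u' f ->
        ae_on a b (fun x => u' x = u x)].

(** The operator norm of (lam I - A)^-1 on L^2(]a, b[), whose graph consists of
    the pairs (f, u) such that (lam I - A) u = f. *)

Definition resolvent_norm (R : realType) (a b : R) (lam : R[i]) : \bar R :=
  ereal_sup [set L2norm a b u | u in
    [set u | L2 a b u /\ exists f,
      [/\ L2 a b f, (L2norm a b f <= 1)%E & sing_int_eq a b lam u f]]].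

Definition grid (R : realType) (org : nat -> R) (N : nat) (m : int) : R :=
  org N + m%:~R / N%:R.

Definition omega_set (R : realType) (a b : R) (org : nat -> R) (N : nat) :
    set int :=
  [set m | Omega a b (grid org N m)].

(** [fset_set] is only meaningful on finite sets: see [mem_omega] below. *)
Definition omega (R : realType) (a b : R) (org : nat -> R) (N : nat) :
    {fset int} :=
  fset_set (omega_set a b org N).

Lemma finite_omega_set (R : realType) (a b : R) (org : nat -> R) (N : nat) :
  (0 < N)%N -> finite_set (omega_set a b org N).
Proof.
move=> N0; have N0' : (0 : R) < N%:R by rewrite ltr0n.
pose K : int := Num.floor ((a - org N) * N%:R).
pose L : nat := absz (Num.ceil ((b - a) * N%:R) + 2).
apply: (@sub_finite_set _ _ [set K + k%:Z | k in `I_L]); last first.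
  exact/finite_image/finite_II.
move=> m; rewrite /omega_set /Omega /grid /= in_itv /= => /andP[am mb].
have lo : (a - org N) * N%:R < m%:~R.
  by rewrite -ltr_pdivlMr// ltrBlDl.
have hi : m%:~R < (b - org N) * N%:R.
  by rewrite -ltr_pdivrMr// ltrBrDl.
have Km : K <= m.
  by rewrite -(ler_int R) (le_trans (floor_le _))// ltW.
have mL : m - K < Num.ceil ((b - a) * N%:R) + 2.
  rewrite -(ltr_int R) intrB intrD.
  have h1 := ceil_ge ((b - a) * N%:R).
  have h2 : (a - org N) * N%:R < (K + 1)%:~R by exact: floorD1_gt.
  rewrite intrD in h2.
  rewrite ltrBlDr (lt_le_trans hi)//.
  have -> : (b - org N) * N%:R = (b - a) * N%:R + (a - org N) * N%:R.
    by rewrite -mulrDl addrA subrK.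
  rewrite -addrA lerD// (le_trans (ltW h2))//.
  by rewrite [leRHS]addrC lerD2l ler_int.
exists (absz (m - K)); last first.
  rewrite gez0_abs ?subr_ge0//.
  by rewrite addrCA subrr addr0.
rewrite /= /L -ltz_nat !gez0_abs ?subr_ge0// .
by rewrite (le_trans _ (ltW mL))// subr_ge0.
Qed.

Lemma mem_omega (R : realType) (a b : R) (org : nat -> R) (N : nat) (m : int) :
  (0 < N)%N -> (m \in omega a b org N) = (a < grid org N m < b).
Proof.
move=> N0; rewrite /omega in_fset_set; last exact: finite_omega_set.
by apply/idP/idP; rewrite inE /omega_set /Omega /= in_itv.
Qed.

(** Matrices indexed by a finite set of integers [w] are represented through
    the enumeration of [w]. *)

Definition idx (w : {fset int}) (i : 'I_#|{: w}|) : int := val (enum_val i).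

Definition TN (R : realType) (a b : R) (org : nat -> R) (N : nat) :
    'M[R[i]]_#|{: omega a b org N}| :=
  \matrix_(i, j)
    if i == j then 0
    else ('i%C * (pi : R)%:C * N%:R)^-1 *
         ((grid org N (idx i) - grid org N (idx j))%:C)^-1.

Definition l2norm (R : realType) (n : nat) (v : 'cV[R[i]]_n) : R :=
  Num.sqrt (\sum_(i < n) cnorm (v i 0) ^+ 2).

Definition mx_opnorm (R : realType) (n : nat) (M : 'M[R[i]]_n) : \bar R :=
  ereal_sup [set (l2norm (M *m v))%:E | v in
    [set v : 'cV[R[i]]_n | l2norm v <= 1]].

Definition stable (R : realType) (a b : R) (org : nat -> R) (lam : R[i]) :
    Prop :=
  exists C : R, forall N : nat, (0 < N)%N -> omega a b org N != fset0 ->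
    (lam%:M - TN a b org N) \in unitmx /\
    (mx_opnorm (invmx (lam%:M - TN a b org N)) <= C%:E)%E.

(* Main.v *)
Require Import Defs.
From HB Require Import structures.
From mathcomp Require Import all_boot all_order all_algebra finmap.
From mathcomp Require Import complex ring lra.
From mathcomp Require Import all_classical all_reals all_analysis measurable_realfun.

(* Write A = - i S with S real and skew, so that lam - A acts on pairs of real
   functions. The finite Hilbert transformation has norm at most 1, because the
   Hilbert transformation of the line, built as a limit of conjugate Poisson
   integrals, is isometric; hence lam - A is bounded below by the distance d
   from lam to [-1, 1]. The form of T^N is the integral of 1 - t / pi against the
   square of a Fourier polynomial over [0, 2 pi], so lam - T^N has the same lower
   bound and the inverse matrices have norm at most 1 / d.
   Conversely every point of [-1, 1] is an approximate eigenvalue. For A this is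
   seen near an end point of the interval, where mu^2 + S^2 has the truncated
   powers s^(- 1 / 2 + i xi) as approximate null vectors, because they diagonalize
   Carleman's kernel 1 / (s + t); hence the norm of the resolvent is exactly 1 / d,
   and at lam in [-1, 1] the symmetric operator lam - A, not being bounded below,
   cannot be onto. For T^N the vectors (e^(- i n psi))_n, whose Fourier
   polynomial concentrates at psi, have residuals bounded independently of N. *)

Set Implicit Arguments.
Unset Strict Implicit.
Unset Printing Implicit Defensive.

Import Order.TTheory GRing.Theory Num.Theory.
Import numFieldNormedType.Exports.

Local Open Scope classical_set_scope.
Local Open Scope ring_scope.
(** * Semi-inner-product spaces *)

(** The two norms of the final inequality are never compared with each other, only with 1 / d: the
    matrices stay below it and the resolvent reaches it. The hard half is that the norm of the
    resolvent is not smaller, and this is decided at an end point. For [x = a - t] and [y = a + s]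
    the kernel 1 / (x - y) becomes - 1 / (s + t); as the transformation of the line is isometric,
    the mass that A loses is the mass that crosses the end points. Carleman's operator has the
    eigenvalues [gam xi], and [m ^+ 2 = 1 - (gam xi / pi) ^+ 2] sweeps [0, 1[ because [gam] takes
    every value in ]0, pi]. The squared norms of the truncated powers grow like the logarithm of the
    cut-off, while their defect stays bounded. Functions equal almost everywhere are not identified:
    [D] selects the admissible vectors, [ip] need not be definite, and equality is replaced by
    [hnorm (u - v) = 0]. An operator chosen pointwise is thus linear only up to null vectors, and
    this is drawn from an adjoint relation. *)

Record prehilbert (R : realType) (V : lmodType R) (D : V -> Prop)
    (ip : V -> V -> R) : Prop := Prehilbert {
  ph_add : forall u v, D u -> D v -> D (u + v);
  ph_scale : forall a u, D u -> D (a *: u);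
  ph_sym : forall u v, ip u v = ip v u;
  ph_addl : forall u v w, D u -> D v -> D w -> ip (u + v) w = ip u w + ip v w;
  ph_scalel : forall a u w, D u -> D w -> ip (a *: u) w = a * ip u w;
  ph_ge0 : forall u, 0 <= ip u u }.

Section prehilbert_theory.
Context (R : realType) (V : lmodType R) (D : V -> Prop) (ip : V -> V -> R).
Hypothesis H : prehilbert D ip.

Definition hnorm (u : V) : R := Num.sqrt (ip u u).

Lemma ph_opp u : D u -> D (- u).
Proof. by rewrite -scaleN1r; exact: (ph_scale H). Qed.

Lemma ph_sub u v : D u -> D v -> D (u - v).
Proof. by move=> Du /ph_opp Dv; exact: (ph_add H). Qed.

Lemma ip_addr u v w : D u -> D v -> D w -> ip w (u + v) = ip w u + ip w v.
Proof. by move=> Du Dv Dw; rewrite (ph_sym H) (ph_addl H)// !(ph_sym H w). Qed.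

Lemma ip_scaler a u w : D u -> D w -> ip w (a *: u) = a * ip w u.
Proof. by move=> Du Dw; rewrite (ph_sym H) (ph_scalel H)// (ph_sym H w). Qed.

Lemma ip_oppl u w : D u -> D w -> ip (- u) w = - ip u w.
Proof. by move=> Du Dw; rewrite -scaleN1r (ph_scalel H)// mulN1r. Qed.

Lemma ip_oppr u w : D u -> D w -> ip w (- u) = - ip w u.
Proof. by move=> Du Dw; rewrite -scaleN1r ip_scaler// mulN1r. Qed.

Lemma ip_subl u v w : D u -> D v -> D w -> ip (u - v) w = ip u w - ip v w.
Proof. by move=> *; rewrite (ph_addl H)// ?ip_oppl//; exact: ph_opp. Qed.

Lemma ip_subr u v w : D u -> D v -> D w -> ip w (u - v) = ip w u - ip w v.
Proof. by move=> *; rewrite ip_addr// ?ip_oppr//; exact: ph_opp. Qed.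

Lemma hnorm_ge0 u : 0 <= hnorm u. Proof. exact: sqrtr_ge0. Qed.

Lemma sqr_hnorm u : hnorm u ^+ 2 = ip u u.
Proof. by rewrite sqr_sqrtr// (ph_ge0 H). Qed.

Lemma ip_add_sqr u v : D u -> D v ->
  ip (u + v) (u + v) = ip u u + 2 * ip u v + ip v v.
Proof.
move=> Du Dv; have Duv := ph_add H Du Dv.
rewrite (ph_addl H)// !ip_addr// (ph_sym H v u); ring.
Qed.

Lemma ip_sub_sqr u v : D u -> D v ->
  ip (u - v) (u - v) = ip u u - 2 * ip u v + ip v v.
Proof.
move=> Du Dv; rewrite ip_add_sqr//; last exact: ph_opp.
rewrite ip_oppr// ip_oppl// ?ip_oppr//; first by ring.
exact: ph_opp.
Qed.

Lemma cauchy_schwarz_sqr u v : D u -> D v -> ip u v ^+ 2 <= ip u u * ip v v.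
Proof.
move=> Du Dv.
have P a b : 0 <= a ^+ 2 * ip u u + 2 * a * b * ip u v + b ^+ 2 * ip v v.
  have Da := ph_scale H a Du; have Db := ph_scale H b Dv.
  have := ph_ge0 H (a *: u + b *: v).
  rewrite ip_add_sqr// !(ph_scalel H)// !ip_scaler//.
  by congr (_ <= _); ring.
have u0 := ph_ge0 H u; have v0 := ph_ge0 H v.
have [v00|vN] := eqVneq (ip v v) 0.
  have [|uN] := eqVneq (ip u v) 0.
    by move=> ->; rewrite v00 mulr0 expr0n.
  (* For [ip v v = 0] the form is linear in [b], and these coefficients give it the value
     [- ip u v ^+ 2]. *)
  have := P (ip u v) (- (ip u u + 1) / 2).
  rewrite v00 mulr0 addr0.
  have -> : ip u v ^+ 2 * ip u u + 2 * ip u v * (- (ip u u + 1) / 2) * ip u v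
    = - (ip u v ^+ 2) by field.
  by rewrite oppr_ge0 mulr0.
have vp : 0 < ip v v by rewrite lt_def vN.
have := P (ip v v) (- ip u v).
have -> : ip v v ^+ 2 * ip u u + 2 * ip v v * - ip u v * ip u v +
   (- ip u v) ^+ 2 * ip v v = ip v v * (ip u u * ip v v - ip u v ^+ 2) by ring.
by rewrite pmulr_rge0// subr_ge0.
Qed.

Lemma cauchy_schwarz u v : D u -> D v -> `|ip u v| <= hnorm u * hnorm v.
Proof.
move=> Du Dv; rewrite -sqrtrM ?(ph_ge0 H)// -sqrtr_sqr.
by rewrite ler_sqrt ?cauchy_schwarz_sqr// mulr_ge0// (ph_ge0 H).
Qed.

Lemma hnorm_triangle u v : D u -> D v -> hnorm (u + v) <= hnorm u + hnorm v.
Proof.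
move=> Du Dv; rewrite -(@ler_pXn2r _ 2)// ?nnegrE ?addr_ge0 ?hnorm_ge0//.
rewrite sqr_hnorm ip_add_sqr// sqrrD !sqr_hnorm.
have := le_trans (ler_norm _) (cauchy_schwarz Du Dv); lra.
Qed.

Lemma hnorm_scale a u : D u -> hnorm (a *: u) = `|a| * hnorm u.
Proof.
move=> Du; have Da := ph_scale H a Du.
by rewrite /hnorm (ph_scalel H)// ip_scaler// mulrA -expr2 sqrtrM ?sqr_ge0// sqrtr_sqr.
Qed.

Lemma hnorm_opp u : D u -> hnorm (- u) = hnorm u.
Proof. by move=> Du; rewrite -scaleN1r hnorm_scale// normrN1 mul1r. Qed.

Lemma hnorm_subC u v : D u -> D v -> hnorm (u - v) = hnorm (v - u).
Proof. by move=> Du Dv; rewrite -opprB hnorm_opp//; exact: ph_sub. Qed.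

Lemma hnorm_sub_triangle w u v : D u -> D v -> D w ->
  hnorm (u - v) <= hnorm (u - w) + hnorm (w - v).
Proof.
move=> Du Dv Dw; have -> : u - v = (u - w) + (w - v) by rewrite addrA subrK.
by apply: hnorm_triangle; exact: ph_sub.
Qed.

Lemma hnorm_near u v : D u -> D v -> `|hnorm u - hnorm v| <= hnorm (u - v).
Proof.
move=> Du Dv; have Duv := ph_sub Du Dv.
have := hnorm_triangle Duv Dv; have := hnorm_triangle (ph_opp Duv) Du.
rewrite hnorm_opp// !opprB !subrK => *.
by rewrite ler_norml; apply/andP; split; lra.
Qed.

Lemma null_ip u v : D u -> D v -> hnorm u = 0 -> ip u v = 0.
Proof.
move=> Du Dv u0; have := cauchy_schwarz Du Dv.
by rewrite u0 mul0r normr_le0 => /eqP.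
Qed.

Lemma null_eq_ip u v w : D u -> D v -> D w -> hnorm (u - v) = 0 ->
  ip u w = ip v w.
Proof.
move=> Du Dv Dw /(null_ip (ph_sub Du Dv) Dw); rewrite ip_subl//.
by move/eqP; rewrite subr_eq0 => /eqP.
Qed.

Lemma null_eq_hnorm u v : D u -> D v -> hnorm (u - v) = 0 -> hnorm u = hnorm v.
Proof.
move=> Du Dv uv0; have := hnorm_near Du Dv.
by rewrite uv0 normr_le0 subr_eq0 => /eqP.
Qed.

Lemma ip_eq0_null u : D u -> (forall w, D w -> ip u w = 0) -> hnorm u = 0.
Proof. by move=> Du uw; rewrite /hnorm uw// sqrtr0. Qed.

(** Completeness along sequences with geometric increments: the Richardson iteration, the gliding
    hump and the approximations of the Hilbert transformation all produce such sequences. *)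
Definition hcomplete := forall (u : nat -> V) (C q : R), 0 <= q < 1 ->
  (forall n, D (u n)) -> (forall n, hnorm (u n.+1 - u n) <= C * q ^+ n) ->
  exists2 v, D v & forall e, 0 < e ->
    exists N, forall n, (N <= n)%N -> hnorm (u n - v) <= e.

Lemma geometric_dist (u : nat -> V) (C q : R) : 0 <= q < 1 ->
  (forall n, D (u n)) -> (forall n, hnorm (u n.+1 - u n) <= C * q ^+ n) ->
  forall m n, hnorm (u (n + m)%N - u n) <= C / (1 - q) * q ^+ n.
Proof.
move=> /andP[q0 q1] Du uC m n.
have C0 : 0 <= C by have := uC 0%N; rewrite expr0 mulr1; apply: le_trans; exact: hnorm_ge0.
have q1' : 0 < 1 - q by rewrite subr_gt0.
suff h : hnorm (u (n + m)%N - u n) <= C / (1 - q) * (q ^+ n - q ^+ (n + m)).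
  apply: (le_trans h); rewrite ler_wpM2l ?divr_ge0 ?(ltW q1')//.
  by rewrite lerBlDr lerDl exprn_ge0.
elim: m => [|m IH]; first by rewrite addn0 !subrr mulr0 /hnorm -(scale0r (u n)) (ph_scalel H)// ?mul0r ?sqrtr0//; exact: (ph_scale H).
rewrite addnS; apply: (le_trans (hnorm_sub_triangle _ _ (Du (n + m)%N))) => //.
apply: (le_trans (lerD (uC _) IH)); rewrite exprS le_eqVlt; apply/orP; left; apply/eqP.
by field; rewrite gt_eqF.
Qed.

Lemma hcomplete_geometric (u : nat -> V) (C q : R) : hcomplete -> 0 <= q < 1 ->
  (forall n, D (u n)) -> (forall n, hnorm (u n.+1 - u n) <= C * q ^+ n) ->
  exists2 v, D v & forall n, hnorm (u n - v) <= C / (1 - q) * q ^+ n.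
Proof.
move=> cpl q01 Du uC; have [v Dv uv] := cpl u C q q01 Du uC.
exists v => // n; apply/ler_addgt0Pr => e e0; have [N uN] := uv _ e0.
apply: (le_trans (hnorm_sub_triangle (Du n) Dv (Du (n + N)%N))).
apply: lerD; last by apply: uN; rewrite leq_addl.
by rewrite hnorm_subC//; exact: geometric_dist.
Qed.

(** The adjoint relation forces linearity up to null vectors. *)
Section adjoint.
Variables T T' : V -> V.
Hypothesis DT : forall u, D u -> D (T u).
Hypothesis DT' : forall u, D u -> D (T' u).
Hypothesis TT' : forall u w, D u -> D w -> ip (T u) w = ip u (T' w).

Lemma adjoint_scale a u : D u -> hnorm (T (a *: u) - a *: T u) = 0.
Proof.
move=> Du; have Dau := ph_scale H a Du; have DTu := DT Du.
have DaTu := ph_scale H a DTu; have DTau := DT Dau.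
apply: ip_eq0_null => [|w Dw]; first exact: ph_sub.
have DT'w := DT' Dw.
by rewrite ip_subl// (ph_scalel H)// !TT'// (ph_scalel H)// subrr.
Qed.

Lemma adjoint_sub u v : D u -> D v -> hnorm (T (u - v) - (T u - T v)) = 0.
Proof.
move=> Du Dv; have Duv := ph_sub Du Dv; have DTuv := ph_sub (DT Du) (DT Dv).
apply: ip_eq0_null => [|w Dw]; first by apply: ph_sub => //; exact: DT.
have DT'w := DT' Dw; have [DTu DTv DTs] := And3 (DT Du) (DT Dv) (DT Duv).
by rewrite ip_subl// (ip_subl DTu)// !TT'// ip_subl// subrr.
Qed.

End adjoint.

(* Richardson iteration for the normal equation: [u - k T'(T u - f)] is a
   contraction when [k = 1 / M^2]. *)
Lemma adjoint_surjective (T T' : V -> V) (d M : R) : hcomplete ->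
  (forall u, D u -> D (T u)) -> (forall u, D u -> D (T' u)) ->
  (forall u w, D u -> D w -> ip (T u) w = ip u (T' w)) ->
  (forall u, D u -> hnorm (T' u) <= M * hnorm u) ->
  0 < d -> (forall u, D u -> d * hnorm u <= hnorm (T u)) ->
  (forall u, D u -> d * hnorm u <= hnorm (T' u)) -> 0 < M ->
  forall f, D f -> exists2 u, D u & hnorm (T u - f) = 0.
Proof.
move=> cpl DT DT' TT' T'M d0 Td T'd M0 f Df.
have T'T u w : D u -> D w -> ip (T' u) w = ip u (T w).
  by move=> Du Dw; rewrite (ph_sym H) -TT'// (ph_sym H).
pose k := (M ^+ 2)^-1.
have k0 : 0 < k by rewrite invr_gt0 exprn_gt0.
pose K u := u - k *: T' (T u - f).
have DK u : D u -> D (K u).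
  by move=> Du; apply: ph_sub => //; apply: (ph_scale H); apply: DT'; apply: ph_sub => //; exact: DT.
(* The square of the contraction factor: [|w - k T' T w|^2 <= |w|^2 - k |T w|^2], and [T] is bounded
   below by [d]. The maximum keeps the square root meaningful. *)
pose q2 := Num.max 0 (1 - k * d ^+ 2).
have q20 : 0 <= q2 by rewrite le_max lexx.
have q21 : q2 < 1 by rewrite gt_max ltr01/= ltrBlDr ltrDl mulr_gt0// exprn_gt0.
pose q := Num.sqrt q2.
have q01 : 0 <= q < 1 by rewrite sqrtr_ge0/= -sqrtr1 ltr_sqrt.
have KK u v : D u -> D v -> hnorm (K u - K v) <= q * hnorm (u - v).
  move=> Du Dv; pose w := u - v; have Dw : D w by exact: ph_sub.
  have DTw := DT _ Dw; have DT'Tw := DT' _ DTw; have DkT'Tw := ph_scale H k DT'Tw.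
  have Dz : D (w - k *: T' (T w)) by exact: ph_sub.
  have DTu := DT _ Du; have DTv := DT _ Dv.
  have DTuf := ph_sub DTu Df; have DTvf := ph_sub DTv Df.
  have DKu := DK _ Du; have DKv := DK _ Dv.
  (* [T] is linear only up to null vectors, and so is this formula for the increment of [K]. *)
  have e0 : hnorm (K u - K v - (w - k *: T' (T w))) = 0.
    apply: ip_eq0_null => [|z Dz']; first by apply: ph_sub => //; exact: ph_sub.
    have DTz := DT _ Dz'.
    have ? := ph_scale H k (DT' _ DTuf).
    have ? := ph_scale H k (DT' _ DTvf).
    have ? := DT' _ DTuf.
    have ? := DT' _ DTvf.
    have -> : ip (K u - K v - (w - k *: T' (T w))) z =
       (ip u z - k * ip (T' (T u - f)) z) - (ip v z - k * ip (T' (T v - f)) z)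
       - (ip u z - ip v z - k * ip (T' (T w)) z).
      rewrite ip_subl//; last exact: ph_sub.
      rewrite (ip_subl DKu)// (ip_subl Dw)// [ip (K u) z]ip_subl// [ip (K v) z]ip_subl//.
      by rewrite !(ph_scalel H)// ip_subl.
    rewrite !T'T// !(ip_subl _ Df)// .
    have DTw' := DT _ (ph_sub Du Dv).
    rewrite (null_eq_ip _ _ DTz (adjoint_sub DT DT' TT' Du Dv))//; last exact: ph_sub.
    rewrite ip_subl//; ring.
  rewrite (null_eq_hnorm _ _ e0)//; last exact: ph_sub.
  rewrite -(@ler_pXn2r _ 2)// ?nnegrE ?mulr_ge0 ?sqrtr_ge0//.
  rewrite sqr_hnorm ip_sub_sqr// !(ph_scalel H)// !ip_scaler// (ph_sym H w) T'T//.
  rewrite exprMn sqr_sqrtr// -!sqr_hnorm.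
  have h1 : hnorm (T' (T w)) ^+ 2 <= M ^+ 2 * hnorm (T w) ^+ 2.
    by rewrite -exprMn lerXn2r ?nnegrE ?mulr_ge0 ?sqrtr_ge0 ?(ltW M0)// T'M.
  have h2 : d ^+ 2 * hnorm w ^+ 2 <= hnorm (T w) ^+ 2.
    by rewrite -exprMn lerXn2r ?nnegrE ?mulr_ge0 ?sqrtr_ge0 ?(ltW d0)// Td.
  have h3 : k ^+ 2 * hnorm (T' (T w)) ^+ 2 <= k * hnorm (T w) ^+ 2.
    have -> : k * hnorm (T w) ^+ 2 = k ^+ 2 * (M ^+ 2 * hnorm (T w) ^+ 2).
      by rewrite /k; field; rewrite gt_eqF.
    by rewrite ler_wpM2l// sqr_ge0.
  apply: (@le_trans _ _ ((1 - k * d ^+ 2) * hnorm w ^+ 2)).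
    have : k * (d ^+ 2 * hnorm w ^+ 2) <= k * hnorm (T w) ^+ 2 by rewrite ler_pM2l.
    lra.
  by rewrite ler_wpM2r ?sqr_ge0// le_max lexx orbT.
pose u n := iter n K f.
have Du n : D (u n) by elim: n => //= n; exact: DK.
have uC n : hnorm (u n.+1 - u n) <= hnorm (u 1%N - u 0%N) * q ^+ n.
  elim: n => [|n IH]; first by rewrite expr0 mulr1.
  have /andP[q0 _] := q01.
  apply: (le_trans (KK _ _ (Du n.+1) (Du n))).
  by rewrite exprS mulrCA ler_wpM2l.
have [v Dv uv] := cpl u _ q q01 Du uC.
have vK : hnorm (v - K v) <= 0.
  apply/ler_addgt0Pr => e e0; rewrite add0r.
  have [N uN] := uv (e / 2) (divr_gt0 e0 (ltr0n _ 2)).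
  apply: (le_trans (hnorm_sub_triangle Dv (DK _ Dv) (Du N.+1))).
  have h1 := uN N.+1 (leqnSn N); have h2 := uN N (leqnn N).
  have h3 := KK _ _ (Du N) Dv.
  have h4 : q * hnorm (u N - v) <= hnorm (u N - v).
    by rewrite ler_piMl ?hnorm_ge0//; case/andP: q01 => _ /ltW.
  rewrite hnorm_subC//; have -> : u N.+1 = K (u N) by [].
  rewrite -/(u N.+1) in h1; have -> : K (u N) = u N.+1 by [].
  have h5 : hnorm (u N.+1 - K v) <= hnorm (u N - v) := le_trans h3 h4.
  lra.
exists v => //.
have DTvf : D (T v - f) by apply: ph_sub => //; exact: DT.
have DT'Tvf := DT' _ DTvf.
(* A fixed point of [K] makes [T' (T v - f)] null; the lower bound for [T'] then makes [T v - f]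
   null. *)
have := T'd _ DTvf.
have : hnorm (v - K v) = k * hnorm (T' (T v - f)).
  by rewrite /K opprB addrC subrK hnorm_scale// gtr0_norm.
move=> E; rewrite E pmulr_rle0// in vK => h.
apply/eqP; rewrite eq_le hnorm_ge0 andbT -(pmulr_rle0 _ d0).
exact: le_trans h vK.
Qed.

(* Gliding hump: were T not bounded below, there would be unit vectors [u n]
   with [|T (u n)| < 4^-n]; surjectivity makes [4^n <f, u n>] bounded for each
   [f], while a signed sum of the [3^-n u n] violates this. *)
Lemma symmetric_surjective_bounded_below (T : V -> V) : hcomplete ->
  (forall u, D u -> D (T u)) ->
  (forall u w, D u -> D w -> ip (T u) w = ip u (T w)) ->
  (exists u0, D u0) ->
  (forall f, D f -> exists2 u, D u & hnorm (T u - f) = 0) ->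
  exists2 d : R, 0 < d & forall u, D u -> d * hnorm u <= hnorm (T u).
Proof.
move=> cpl DT sym [u0 Du0] surj; apply: contrapT => nbd.
have D0 : D 0 by rewrite -(scale0r u0); exact: (ph_scale H).
have ex n : exists u, [/\ D u, hnorm u = 1 & hnorm (T u) <= 4 ^- n].
  apply: contrapT => nex; apply: nbd; exists (4 ^- n); first by rewrite invr_gt0 exprn_gt0.
  move=> u Du; have [u00|uN] := eqVneq (hnorm u) 0; first by rewrite u00 mulr0 hnorm_ge0.
  have un : 0 < hnorm u by rewrite lt_def uN hnorm_ge0.
  rewrite leNgt; apply/negP => lt; apply: nex.
  exists ((hnorm u)^-1 *: u); split; first exact: (ph_scale H).
    by rewrite hnorm_scale// ger0_norm ?invr_ge0 ?hnorm_ge0// mulVf.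
  have DTu := DT _ Du; have Dau := ph_scale H (hnorm u)^-1 Du.
  rewrite (null_eq_hnorm (DT _ Dau) (ph_scale H _ DTu) (adjoint_scale DT DT sym _ Du)).
  rewrite hnorm_scale// ger0_norm ?invr_ge0 ?hnorm_ge0//.
  by rewrite mulrC ler_pdivrMr// ltW.
have [u /all_and3[Du un Tu]] := choice ex.
(* The sign is that of [ip x (u n)], so that the new term adds to this scalar product instead of
   cancelling it. *)
pose step n (x : V) := if 0 <= ip x (u n) then x + 3 ^- n *: u n else x - 3 ^- n *: u n.
pose x := fix x n := if n is n'.+1 then step n' (x n') else 0.
have Dsn n : D (3 ^- n *: u n) by exact: (ph_scale H).
have Dx n : D (x n).
  elim: n => //= n Dxn; rewrite /step; case: ifP => _; first exact: (ph_add H).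
  exact: ph_sub.
have pos3 n : 0 < 3 ^- n :> R by rewrite invr_gt0 exprn_gt0.
have xu n : 3 ^- n <= `|ip (x n.+1) (u n)|.
  have uu : ip (u n) (u n) = 1 by rewrite -sqr_hnorm un expr1n.
  rewrite /= /step; case: ifPn => h.
    rewrite (ph_addl H)// (ph_scalel H)// uu mulr1 ger0_norm; first by rewrite lerDr.
    by rewrite addr_ge0// ltW.
  rewrite -ltNge in h.
  rewrite ip_subl// (ph_scalel H)// uu mulr1 ltr0_norm.
    by rewrite opprB lerBrDr gerDl ltW.
  by rewrite subr_lt0 (lt_trans h).
have dx n : hnorm (x n.+1 - x n) = 3 ^- n.
  have n3 : hnorm (3 ^- n *: u n) = 3 ^- n.
    by rewrite hnorm_scale// un mulr1 gtr0_norm.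
  rewrite /= /step; case: ifP => _.
    by rewrite addrAC subrr add0r n3.
  by rewrite addrAC subrr add0r hnorm_opp.
(* The shift by one makes the distance to the limit at most half of the term [3 ^- n] just added. *)
have [||n|f Df xf] := @hcomplete_geometric (fun n => x n.+1) 3^-1 3^-1 cpl.
- by apply/andP; split; lra.
- by move=> n; exact: Dx.
- by rewrite dx exprS invfM exprVn.
have [h Dh Thf] := surj f Df.
have fu n : `|ip f (u n)| <= hnorm h * 4 ^- n.
  have <- : ip (T h) (u n) = ip f (u n) by apply: null_eq_ip => //; exact: DT.
  rewrite sym//; apply: (le_trans (cauchy_schwarz Dh (DT _ (Du n)))).
  by rewrite ler_wpM2l// hnorm_ge0.
(* Half of [3 ^- n] survives in [ip f (u n)], which surjectivity bounds by a multiple of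
   [4 ^- n]. *)
have key n : (4 / 3) ^+ n / 2 <= hnorm h.
  have h1 : `|ip (x n.+1) (u n)| <= `|ip f (u n)| + 2^-1 * 3 ^- n.
    rewrite -(subrK f (x n.+1)) (ph_addl H)//; last exact: ph_sub.
    rewrite addrC; apply: (le_trans (ler_normD _ _)); rewrite lerD2l.
    apply: (le_trans (cauchy_schwarz (ph_sub (Dx _) Df) (Du n))).
    rewrite un mulr1; apply: (le_trans (xf n)).
    have -> : 3^-1 / (1 - 3^-1) = 2^-1 :> R.
      have -> : 1 - 3^-1 = 2 * 3^-1 :> R by lra.
      by field.
    by rewrite exprVn.
  have h2 := le_trans (xu n) (le_trans h1 (lerD (fu n) (lexx _))).
  have h3 : 2^-1 * 3 ^- n <= hnorm h * 4 ^- n by lra.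
  have -> : (4 / 3) ^+ n / 2 = (2^-1 * 3 ^- n) * 4 ^+ n :> R.
    by rewrite expr_div_n mulrC mulrA (mulrAC 2^-1).
  by rewrite -ler_pdivlMr ?exprn_gt0.
have big : exists n, hnorm h < (4 / 3) ^+ n / 2.
  have bern n : 1 + n%:R / 3 <= (4 / 3) ^+ n :> R.
    elim: n => [|n IH]; first by rewrite mul0r addr0 expr0.
    rewrite exprS -(natr1 n).
    have : 4 / 3 * (1 + n%:R / 3) <= 4 / 3 * (4 / 3) ^+ n :> R by rewrite ler_wpM2l; lra.
    have : 0 <= n%:R :> R by []; lra.
  exists (Num.trunc (6 * hnorm h)).+1.
  have := bern (Num.trunc (6 * hnorm h)).+1.
  have := truncnS_gt (6 * hnorm h); lra.
by have [n] := big; rewrite ltNge key.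
Qed.

End prehilbert_theory.

(** * Complexification, and bounds for lam - A from a skew operator *)

Section complexified_space.
Context (R : realType) (V : lmodType R) (D : V -> Prop) (ip : V -> V -> R).
Hypothesis H : prehilbert D ip.

Definition dom2 (u : V * V) : Prop := D u.1 /\ D u.2.
(** The real part of the hermitian product, a pair standing for [u.1 + i u.2]. *)
Definition ip2 (u w : V * V) : R := ip u.1 w.1 + ip u.2 w.2.

Lemma prehilbert2 : prehilbert dom2 ip2.
Proof.
split=> [u v [Du1 Du2] [Dv1 Dv2]|a u [Du1 Du2]|u v|u v w [? ?] [? ?] [? ?]|a u w [? ?] [? ?]|u].
- by split; exact: (ph_add H).
- by split; exact: (ph_scale H).
- by rewrite /ip2 (ph_sym H u.1) (ph_sym H u.2).
- by rewrite /ip2/= !(ph_addl H)// addrACA.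
- by rewrite /ip2/= !(ph_scalel H)// mulrDr.
- by rewrite addr_ge0// (ph_ge0 H).
Qed.

Local Notation hn := (hnorm ip).
Local Notation hn2 := (hnorm ip2).

Lemma hnorm2_sqr u : hn2 u ^+ 2 = hn u.1 ^+ 2 + hn u.2 ^+ 2.
Proof. by rewrite (sqr_hnorm prehilbert2) !(sqr_hnorm H). Qed.

Lemma hnorm_le_hnorm2 u : hn u.1 <= hn2 u /\ hn u.2 <= hn2 u.
Proof.
by split; rewrite -(@ler_pXn2r _ 2)// ?nnegrE ?hnorm_ge0// hnorm2_sqr ?lerDl ?lerDr sqr_ge0.
Qed.

Lemma hnorm2_le u : hn2 u <= hn u.1 + hn u.2.
Proof.
rewrite -(@ler_pXn2r _ 2)// ?nnegrE ?addr_ge0 ?hnorm_ge0//.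
rewrite hnorm2_sqr sqrrD -addrA (addrC (_ *+ 2)) addrA lerDl mulrn_wge0//.
by rewrite mulr_ge0// hnorm_ge0.
Qed.

Lemma hcomplete2 : hcomplete D ip -> hcomplete dom2 ip2.
Proof.
move=> cpl u C q q01 Du uC.
have [|n|p Dp up] := cpl (fun n => (u n).1) C q q01; first by move=> n; have [] := Du n.
  by apply: le_trans (uC n); have [] := hnorm_le_hnorm2 (u n.+1 - u n).
have [|n|r Dr ur] := cpl (fun n => (u n).2) C q q01; first by move=> n; have [] := Du n.
  by apply: le_trans (uC n); have [] := hnorm_le_hnorm2 (u n.+1 - u n).
exists (p, r) => // e e0; have e20 : 0 < e / 2 by rewrite divr_gt0.
have [N1 uN1] := up _ e20; have [N2 uN2] := ur _ e20.
exists (maxn N1 N2) => n; rewrite geq_max => /andP[n1 n2].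
apply: (le_trans (hnorm2_le _)); rewrite [leRHS](splitr e).
by apply: lerD; [exact: uN1|exact: uN2].
Qed.

(** [lamop s t] is [(s + i t) - A] with [A = - i S], in terms of the real and
    imaginary parts. *)
Section skew.
Variable S : V -> V.
Hypothesis DS : forall u, D u -> D (S u).
Hypothesis skew : forall u w, D u -> D w -> ip (S u) w = - ip u (S w).

Definition lamop (s t : R) (u : V * V) : V * V :=
  (s *: u.1 - t *: u.2 - S u.2, t *: u.1 + s *: u.2 + S u.1).

Lemma dom_lamop s t u : dom2 u -> dom2 (lamop s t u).
Proof.
move=> [Du1 Du2]; split; have ? := DS Du1; have ? := DS Du2.
  by apply: (ph_sub H) => //; apply: (ph_sub H); exact: (ph_scale H).
by apply: (ph_add H) => //; apply: (ph_add H); exact: (ph_scale H).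
Qed.

(** [A = - i S] is symmetric because [S] is skew, so only the scalar gets conjugated. *)
Lemma lamop_adjoint s t u w : dom2 u -> dom2 w ->
  ip2 (lamop s t u) w = ip2 u (lamop s (- t) w).
Proof.
move=> [Du1 Du2] [Dw1 Dw2].
have [? ? ? ?] := And4 (DS Du1) (DS Du2) (DS Dw1) (DS Dw2).
have DZ := ph_scale H; have DD := ph_add H.
have DB := ph_sub H.
rewrite /ip2/= (ip_subl H (DB _ _ (DZ s _ Du1) (DZ t _ Du2)))//.
rewrite (ip_subl H (DZ s _ Du1) (DZ t _ Du2))//.
rewrite (ph_addl H (DD _ _ (DZ t _ Du1) (DZ s _ Du2)))//.
rewrite (ph_addl H (DZ t _ Du1) (DZ s _ Du2))//.
rewrite (ip_subr H (DB _ _ (DZ s _ Dw1) (DZ (- t) _ Dw2)))//.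
rewrite (ip_subr H (DZ s _ Dw1) (DZ (- t) _ Dw2))//.
rewrite (ip_addr H (DD _ _ (DZ (- t) _ Dw1) (DZ s _ Dw2)))//.
rewrite (ip_addr H (DZ (- t) _ Dw1) (DZ s _ Dw2))//.
rewrite !(ph_scalel H)// !(ip_scaler H)// !skew//; ring.
Qed.

Lemma skew_ip0 u : D u -> ip (S u) u = 0.
Proof. by move=> Du; have := skew Du Du; rewrite (ph_sym H u); lra. Qed.

(** The Rayleigh quotient [x] of A at [u] lies in [-1, 1] by the first hypothesis, and the component
    of [(lam - A) u] in the complex line of [u] is [(lam - x) u], of length at least [d |u|]. The
    hypothesis bears on the form because this is what the symbol controls for [T^N]. *)
Lemma lamop_lower_bound (s t d : R) :
  (forall p q, D p -> D q -> 2 * `|ip (S p) q| <= ip p p + ip q q) ->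
  0 <= d -> (forall x, -1 <= x <= 1 -> d ^+ 2 <= (s - x) ^+ 2 + t ^+ 2) ->
  forall u, dom2 u -> d * hn2 u <= hn2 (lamop s t u).
Proof.
move=> num d0 dP u Du; have [Du1 Du2] := Du; have DL := dom_lamop s t Du.
have H2 := prehilbert2.
have [u0|uN] := eqVneq (ip2 u u) 0.
  by rewrite {1}/hnorm u0 sqrtr0 mulr0 hnorm_ge0.
have n0 : 0 < ip2 u u by rewrite lt_def uN (ph_ge0 H2).
set n := ip2 u u in n0.
(* [J] is [i u]: the real products with [u] and [J] are the two parts of the hermitian one. *)
pose J : V * V := (- u.2, u.1).
have DJ : dom2 J by split=> //; exact: (ph_opp H).
have JJ : ip2 J J = n.
  by rewrite /n /ip2/= (ip_oppl H)// ?(ip_oppr H)// ?opprK 1?addrC//; exact: (ph_opp H).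
have uJ : ip2 u J = 0.
  by rewrite /ip2/= (ip_oppr H)// (ph_sym H u.2) addrC subrr.
have DZ := ph_scale H; have DD := ph_add H; have DB := ph_sub H.
have [DS1 DS2] := (DS Du1, DS Du2).
pose x := - (2 * ip (S u.1) u.2) / n.
have x1 : -1 <= x <= 1.
  have h := num _ _ Du1 Du2.
  rewrite -ler_norml /x normrM normrN normfV (gtr0_norm n0) ler_pdivrMr// mul1r.
  by rewrite normrM ger0_norm.
have a : ip2 (lamop s t u) u = (s - x) * n.
  rewrite /x mulrBl divfK// /n /ip2/=.
  rewrite (ip_subl H (DB _ _ (DZ s _ Du1) (DZ t _ Du2)))//.
  rewrite (ip_subl H (DZ s _ Du1) (DZ t _ Du2))//.
  rewrite (ph_addl H (DD _ _ (DZ t _ Du1) (DZ s _ Du2)))//.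
  rewrite (ph_addl H (DZ t _ Du1) (DZ s _ Du2))//.
  rewrite !(ph_scalel H)// (skew Du2)// (ph_sym H u.2 (S _)) (ph_sym H u.2 u.1); ring.
have b : ip2 (lamop s t u) J = t * n.
  rewrite /n /ip2/= (ip_oppr H)//; last first.
    by have [] := DL.
  rewrite (ip_subl H (DB _ _ (DZ s _ Du1) (DZ t _ Du2)))//.
  rewrite (ip_subl H (DZ s _ Du1) (DZ t _ Du2))//.
  rewrite (ph_addl H (DD _ _ (DZ t _ Du1) (DZ s _ Du2)))//.
  rewrite (ph_addl H (DZ t _ Du1) (DZ s _ Du2))//.
  rewrite !(ph_scalel H)// !skew_ip0// (ph_sym H u.2 u.1); ring.
pose w := (s - x) *: u + t *: J.
have Dau := ph_scale H2 (s - x) Du; have DtJ := ph_scale H2 t DJ.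
have Dw : dom2 w by exact: (ph_add H2).
set e := (s - x) ^+ 2 + t ^+ 2.
have de : d ^+ 2 <= e by exact: dP.
have Lw : ip2 (lamop s t u) w = e * n.
  by rewrite (ip_addr H2)// !(ip_scaler H2)// a b /e; ring.
have ww : ip2 w w = e * n.
  rewrite (ip_add_sqr H2)// !(ph_scalel H2)// !(ip_scaler H2)// uJ JJ -/n /e; ring.
have := cauchy_schwarz_sqr H2 DL Dw.
rewrite Lw ww => cs.
rewrite -(@ler_pXn2r _ 2)// ?nnegrE ?mulr_ge0 ?hnorm_ge0//.
rewrite exprMn !(sqr_hnorm H2) -/n.
have e0 : 0 <= e by rewrite addr_ge0 ?sqr_ge0.
have [e00|eN] := eqVneq e 0.
  have -> : d ^+ 2 = 0 by apply/eqP; rewrite eq_le sqr_ge0 andbT -e00.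
  by rewrite mul0r (ph_ge0 H2).
have en : 0 < e * n by rewrite mulr_gt0// lt_def eN.
rewrite expr2 ler_pM2r// in cs.
by apply: le_trans cs; rewrite ler_pM2r.
Qed.

Hypothesis bounded : forall u, D u -> hn (S u) <= hn u.

Lemma skew_numerical_range p q : D p -> D q ->
  2 * `|ip (S p) q| <= ip p p + ip q q.
Proof.
move=> Dp Dq; have h := cauchy_schwarz H (DS Dp) Dq.
have : hn (S p) * hn q <= hn p * hn q by rewrite ler_wpM2r ?hnorm_ge0 ?bounded.
have := sqr_ge0 (hn p - hn q); rewrite sqrrB !(sqr_hnorm H); lra.
Qed.

Lemma lamop_upper_bound s t u : dom2 u ->
  hn2 (lamop s t u) <= (`|s| + `|t| + 1) * hn2 u.
Proof.
move=> Du; have [Du1 Du2] := Du; have H2 := prehilbert2.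
have DJ : dom2 (- u.2, u.1) by split=> //; exact: (ph_opp H).
have DSu : dom2 (- S u.2, S u.1) by split; [apply: (ph_opp H)|]; exact: DS.
have Dsu := ph_scale H2 s Du; have DtJ := ph_scale H2 t DJ.
have -> : lamop s t u = (s *: u + t *: ((- u.2, u.1) : V * V)) + (- S u.2, S u.1).
  by rewrite /lamop; congr (_, _) => /=; [rewrite scalerN|rewrite (addrC (t *: u.1))].
apply: (le_trans (hnorm_triangle H2 (ph_add H2 Dsu DtJ) DSu)).
have JE : hn2 (- u.2, u.1) = hn2 u.
  apply/eqP; rewrite -(@eqrXn2 _ 2)// ?hnorm_ge0//.
  by rewrite !hnorm2_sqr/= (hnorm_opp H)// addrC.
have SE : hn2 (- S u.2, S u.1) <= hn2 u.
  rewrite -(@ler_pXn2r _ 2)// ?nnegrE ?hnorm_ge0// !hnorm2_sqr/=.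
  rewrite (hnorm_opp H); last exact: DS.
  rewrite addrC lerD//.
    by rewrite lerXn2r ?nnegrE ?hnorm_ge0 ?bounded.
  by rewrite lerXn2r ?nnegrE ?hnorm_ge0 ?bounded.
have := hnorm_triangle H2 Dsu DtJ; rewrite !(hnorm_scale H2)// JE; lra.
Qed.

Lemma lamop_surjective s t d : hcomplete D ip -> 0 < d ->
  (forall x, -1 <= x <= 1 -> d ^+ 2 <= (s - x) ^+ 2 + t ^+ 2) ->
  forall f, dom2 f -> exists2 u, dom2 u & hn2 (lamop s t u - f) = 0.
Proof.
move=> cpl d0 dP.
apply: (@adjoint_surjective _ _ _ _ prehilbert2 (lamop s t) (lamop s (- t)) d
  (`|s| + `|t| + 1)).
- exact: hcomplete2.
- by move=> u; exact: dom_lamop.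
- by move=> u; exact: dom_lamop.
- exact: lamop_adjoint.
- by move=> u Du; rewrite -(normrN t); exact: lamop_upper_bound.
- exact: d0.
- by apply: lamop_lower_bound => //; [exact: skew_numerical_range|exact: ltW].
- apply: lamop_lower_bound; [exact: skew_numerical_range|exact: ltW|].
  by move=> x x1; rewrite sqrrN; exact: dP.
- by rewrite ltr_wpDl// addr_ge0.
Qed.

(* On real vectors [mu - A] and [mu + A] have the same norm, and their product
   is [mu^2 + S^2]. *)
Lemma lamop_square_lower_bound (m d : R) : 0 <= d ->
  (forall u, dom2 u -> d * hn2 u <= hn2 (lamop m 0 u)) ->
  forall p, D p -> d ^+ 2 * hn p <= hn (m ^+ 2 *: p + S (S p)).
Proof.
move=> d0 md p Dp; have H2 := prehilbert2.
have D0 : D 0 by rewrite -(scale0r p); exact: (ph_scale H).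
have n0 : hn 0 = 0.
  by rewrite /hnorm -{1}(scale0r p) (ph_scalel H)// mul0r sqrtr0.
have DSp := DS Dp; have DSSp := DS DSp.
have DZ := ph_scale H.
have SN u : D u -> hn (S (- u) + S u) = 0.
  move=> Du; have := adjoint_scale H DS (fun v Dv => ph_opp H (DS Dv)).
  have sk u' w' : D u' -> D w' -> ip (S u') w' = ip u' (- S w').
    by move=> *; rewrite skew// (ip_oppr H)//; exact: DS.
  move=> /(_ sk (-1) u Du); by rewrite !scaleN1r opprK.
have S0 : hn (S 0) = 0.
  apply: ip_eq0_null (DS D0) _.
  move=> w Dw; rewrite skew//; have DSw := DS Dw.
  by rewrite -(scale0r p) (ph_scalel H)// mul0r oppr0.
have Dp0 : dom2 (p, 0) by [].
have h1 : d * hn p <= hn2 (m *: p, S p).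
  have -> : hn2 (m *: p, S p) = hn2 (lamop m 0 (p, 0)).
    rewrite /lamop/= !scale0r !scaler0 subr0 addr0 add0r.
    have Dm : D (m *: p - S 0) by apply: (ph_sub H); [exact: DZ|exact: DS].
    apply/eqP; rewrite -(@eqrXn2 _ 2)// ?hnorm_ge0// !hnorm2_sqr/=; apply/eqP.
    congr (_ ^+ 2 + _); apply: (null_eq_hnorm H) => //; first exact: DZ.
    by rewrite opprB addrC subrK S0.
  have := md _ Dp0.
  have -> : hn2 (p, 0) = hn p.
    apply/eqP; rewrite -(@eqrXn2 _ 2)// ?hnorm_ge0// hnorm2_sqr/= n0 expr0n addr0//.
  by [].
(* This is [(m + A) p], whereas [lamop m 0 (p, 0)] is [(m - A) p], of the same norm; up to null
   vectors, [m - A] maps the former to [m ^+ 2 *: p + S (S p)]. *)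
pose u : V * V := (m *: p, - S p).
have Du : dom2 u by split; [exact: DZ|exact: (ph_opp H)].
have h2 := md _ Du.
have -> : d ^+ 2 * hn p = d * (d * hn p) by rewrite mulrA.
apply: (@le_trans _ _ (d * hn2 u)).
  rewrite ler_wpM2l//; apply: (le_trans h1).
  rewrite le_eqVlt; apply/orP; left.
  by rewrite -(@eqrXn2 _ 2)// ?hnorm_ge0// !hnorm2_sqr/= (hnorm_opp H).
apply: (le_trans h2); rewrite -(@ler_pXn2r _ 2)// ?nnegrE ?hnorm_ge0//.
rewrite hnorm2_sqr/= !scale0r subr0 add0r.
have Dw : D (m ^+ 2 *: p + S (S p)) by apply: (ph_add H) => //; exact: DZ.
have e1 : hn (m *: (m *: p) - S (- S p)) = hn (m ^+ 2 *: p + S (S p)).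
  have DNS := DS (ph_opp H DSp).
  apply: (null_eq_hnorm H) => //; first by apply: (ph_sub H) => //; exact: (DZ m _ (DZ m _ Dp)).
  rewrite scalerA -expr2 -(SN _ DSp) opprD addrACA subrr add0r -opprD.
  by rewrite (hnorm_opp H)//; exact: (ph_add H).
have e2 : hn (m *: - S p + S (m *: p)) = 0.
  have sk u' w' : D u' -> D w' -> ip (S u') w' = ip u' (- S w').
    by move=> *; rewrite skew// (ip_oppr H)//; exact: DS.
  rewrite scalerN addrC.
  exact: (adjoint_scale H DS (fun v Dv => ph_opp H (DS Dv)) sk).
by rewrite e1 e2 expr0n addr0.
Qed.

End skew.

End complexified_space.

(** * The Hilbert transformation on the line *)

Section square_integrable.
Context {R : realType}.
Local Notation mu := (@lebesgue_measure R).
Implicit Types f g h : R -> R.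

#[local] Instance ae_lebesgue_filter : Filter (almost_everywhere mu).
Proof. exact: ae_filter_ringOfSetsType. Qed.

Lemma ae_imp (P Q : R -> Prop) : (forall x, P x -> Q x) ->
  {ae mu, forall x, P x} -> {ae mu, forall x, Q x}.
Proof. exact: filterS. Qed.

Lemma ae_imp2 (P Q S : R -> Prop) : (forall x, P x -> Q x -> S x) ->
  {ae mu, forall x, P x} -> {ae mu, forall x, Q x} -> {ae mu, forall x, S x}.
Proof. exact: filterS2. Qed.

Lemma sqr_norm (x : R) : `|x| ^+ 2 = x ^+ 2.
Proof. by rewrite real_normK// num_real. Qed.

Definition intgT f := mu.-integrable setT (EFin \o f).

Definition L2R f := measurable_fun setT f /\ intgT (fun x => f x ^+ 2).

Definition ipL f g : R := \int[mu]_x (f x * g x).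

Lemma intgT_measurable f : intgT f -> measurable_fun setT f.
Proof. by move=> /integrableP[/measurable_EFinP]. Qed.

Lemma intgT_le f g : measurable_fun setT f -> (forall x, `|f x| <= g x) ->
  intgT g -> intgT f.
Proof.
move=> mf fg ig; apply: le_integrable ig => //; first exact/measurable_EFinP.
by move=> x _ /=; rewrite lee_fin (le_trans (fg x))// ler_norm.
Qed.

Lemma intgTD f g : intgT f -> intgT g -> intgT (fun x => f x + g x).
Proof. by move=> intf intg; exact: (integrableD _ intf intg). Qed.

Lemma intgTZ a f : intgT f -> intgT (fun x => a * f x).
Proof. by move=> intf; exact: (integrableZl _ a intf). Qed.

Lemma intgTN f : intgT f -> intgT (fun x => - f x).
Proof.
by move=> /(intgTZ (-1)); under eq_fun do rewrite mulN1r.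
Qed.

Lemma intgTB f g : intgT f -> intgT g -> intgT (fun x => f x - g x).
Proof. by move=> intf /intgTN; exact: intgTD. Qed.

Lemma intgT_norm f : intgT f -> intgT (fun x => `|f x|).
Proof. exact: integrable_norm. Qed.

Lemma L2R_mul_integrable f g : L2R f -> L2R g -> intgT (fun x => f x * g x).
Proof.
move=> [mf f2] [mg g2]; apply: intgT_le (intgTD f2 g2).
  exact: measurable_funM.
move=> x; rewrite -[f x ^+ 2]sqr_norm -[g x ^+ 2]sqr_norm normrM.
have := sqr_ge0 (`|f x| - `|g x|); have := sqr_ge0 (`|f x| + `|g x|).
nra.
Qed.

Lemma L2R_add f g : L2R f -> L2R g -> L2R (f + g).
Proof.
move=> Lf Lg; have fg := L2R_mul_integrable Lf Lg.
have [[mf f2] [mg g2]] := (Lf, Lg); split; first exact: measurable_funD.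
have := intgTD (intgTD f2 g2) (intgTZ 2 fg).
by apply: eq_integrable => // x _; rewrite /=; congr EFin; rewrite -[(f + g) x]/(f x + g x); ring.
Qed.

Lemma L2R_scale a f : L2R f -> L2R (a *: f).
Proof.
move=> [mf f2]; split; first exact: measurable_funM.
have := intgTZ (a ^+ 2) f2.
by apply: eq_integrable => // x _; rewrite /=; congr EFin; rewrite -[(a *: f) x]/(a * f x) exprMn.
Qed.

Lemma prehilbertL : prehilbert L2R ipL.
Proof.
split.
- exact: L2R_add.
- exact: L2R_scale.
- by move=> u v; rewrite /ipL; under eq_Rintegral do rewrite mulrC.
- move=> u v w Lu Lv Lw; rewrite /ipL -RintegralD//.
  + by apply: eq_Rintegral => x _; rewrite mulrDl.
  + exact: L2R_mul_integrable.
  + exact: L2R_mul_integrable.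
- move=> a u w Lu Lw; rewrite /ipL -RintegralZl//.
  + by apply: eq_Rintegral => x _; rewrite mulrA.
  + exact: L2R_mul_integrable.
- by move=> u; apply: Rintegral_ge0 => x _; rewrite -expr2 sqr_ge0.
Qed.

Lemma ipL_EFin f g : L2R f -> L2R g ->
  (\int[mu]_x (f x * g x)%:E = (ipL f g)%:E)%E.
Proof.
by move=> Lf Lg; rewrite /ipL /Rintegral fineK//; apply: integrable_fin_num => //; exact: L2R_mul_integrable.
Qed.

Lemma sqr_EFin f : L2R f -> (\int[mu]_x (f x ^+ 2)%:E = (ipL f f)%:E)%E.
Proof. by move=> Lf; rewrite -ipL_EFin//. Qed.

Lemma cvg_shift (w : R^nat) (l : R) n :
  w m @[m --> \oo] --> l -> w (n + m)%N @[m --> \oo] --> l.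
Proof. by apply: cvg_comp; exact: cvg_addnl. Qed.

Lemma L2R_of_le f B : measurable_fun setT f ->
  (\int[mu]_x (f x ^+ 2)%:E <= B%:E)%E -> L2R f /\ ipL f f <= B.
Proof.
move=> mf fB; have Lf : L2R f.
  split=> //; apply/integrableP; split.
    by apply/measurable_EFinP; exact: measurable_funX.
  under eq_integral do rewrite /= ger0_norm ?sqr_ge0//.
  exact: le_lt_trans fB (ltry _).
by split=> //; rewrite -lee_fin -sqr_EFin.
Qed.

Lemma L2R_le f g : measurable_fun setT f -> (forall x, `|f x| <= `|g x|) ->
  L2R g -> L2R f.
Proof.
move=> mf fg [mg g2]; split=> //; apply: intgT_le g2; first exact: measurable_funX.
by move=> x; rewrite ger0_norm ?sqr_ge0// -[leLHS]sqr_norm -[leRHS]sqr_norm lerXn2r// nnegrE.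
Qed.

Lemma limn_einf_le (u : (\bar R)^nat) (B : \bar R) :
  (forall n, u n <= B)%E -> (limn_einf u <= B)%E.
Proof.
move=> uB; rewrite limn_einf_lim; apply: lime_le; first exact: is_cvg_einfs.
apply: nearW => n; apply: le_trans (uB n); apply: ereal_inf_lbound.
by exists n => /=.
Qed.

Lemma measurable_limn_einf (f : (R -> \bar R)^nat) :
  (forall n, measurable_fun setT (f n)) ->
  measurable_fun setT (fun x => limn_einf (f ^~ x)).
Proof.
move=> mf; rewrite /limn_einf; apply: measurableT_comp => //.
by apply: measurable_fun_limn_esup => n; apply: measurableT_comp.
Qed.

(** Fatou's lemma for squares; it serves for completeness and for the strong convergence of Poisson
    integrals. *)
Lemma fatou_L2R (u : (R -> R)^nat) f B : (forall n, L2R (u n)) ->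
  measurable_fun setT f -> {ae mu, forall x, u n x @[n --> \oo] --> f x} ->
  (forall n, ipL (u n) (u n) <= B) -> L2R f /\ ipL f f <= B.
Proof.
move=> Lu mf uf uB; apply: L2R_of_le => //.
pose s n x := (u n x ^+ 2)%:E.
have ms n : measurable_fun setT (s n).
  by apply/measurable_EFinP; apply: measurable_funX; have [] := Lu n.
apply: (@le_trans _ _ (\int[mu]_x limn_einf (s ^~ x))%E).
  apply: ae_ge0_le_integral => //.
  - by move=> x _; rewrite lee_fin sqr_ge0.
  - by apply/measurable_EFinP; exact: measurable_funX.
  - move=> x _; rewrite limn_einf_lim; apply: lime_ge; first exact: is_cvg_einfs.
    apply: nearW => n; apply: le_ereal_inf_tmp => _ [m /= _ <-].
    by rewrite lee_fin sqr_ge0.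
  - exact: measurable_limn_einf.
  apply: ae_imp uf => x ux _.
  suff : s n x @[n --> \oo] --> (f x ^+ 2)%:E by move/cvg_limn_einf_sup => -[->].
  by apply: cvg_EFin; [exact: nearW|apply: cvgM].
apply: (le_trans (fatou _ _ _ _)) => //.
  by move=> n x _; rewrite lee_fin sqr_ge0.
by apply: limn_einf_le => n; rewrite sqr_EFin// lee_fin.
Qed.

(* Riesz-Fischer along geometric sequences. The weights [r ^- n] give a.e.
   geometric convergence without summing norms. *)
Lemma hcompleteL : hcomplete L2R ipL.
Proof.
move=> u C q /andP[q0 q1] Lu uC.
have H := prehilbertL.
pose r := (1 + q) / 2.
have [r0 r1 qr] : [/\ 0 < r, r < 1 & q <= r] by rewrite /r; split; lra.
have C0 : 0 <= C.
  by have := uC 0%N; rewrite expr0 mulr1; apply: le_trans; exact: hnorm_ge0.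
pose d n := u n.+1 - u n.
have Ld n : L2R (d n) by exact: (ph_sub H).
(* One factor [r ^+ n] is spent on the weight in [s], the other keeps the integrals summable. *)
have dC n : ipL (d n) (d n) <= C ^+ 2 * r ^+ n * r ^+ n.
  rewrite -(sqr_hnorm H) -mulrA -expr2 -exprMn.
  rewrite lerXn2r ?nnegrE ?hnorm_ge0 ?mulr_ge0 ?exprn_ge0 ?(ltW r0)//.
  by apply: (le_trans (uC n)); rewrite ler_wpM2l// lerXn2r// nnegrE// ltW.
pose s n x : \bar R := (r ^- n * d n x ^+ 2)%:E.
have s0 n x : (0 <= s n x)%E.
  by rewrite lee_fin mulr_ge0 ?sqr_ge0// invr_ge0 exprn_ge0// ltW.
have ms n : measurable_fun setT (s n).
  apply/measurable_EFinP; apply: measurable_funM => //.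
  by apply: measurable_funX; have [] := Ld n.
have ints n : (\int[mu]_x s n x <= (C ^+ 2 * r ^+ n)%:E)%E.
  rewrite /s; under eq_integral do rewrite EFinM.
  rewrite ge0_integralZl//; last 3 first.
  - by apply/measurable_EFinP; apply: measurable_funX; have [] := Ld n.
  - by move=> x _; rewrite lee_fin sqr_ge0.
  - by rewrite lee_fin invr_ge0 exprn_ge0// ltW.
  rewrite sqr_EFin// -EFinM lee_fin mulrC ler_pdivrMr ?exprn_gt0//.
have sfin : (\int[mu]_x (\sum_(n <oo) s n x) < +oo)%E.
  rewrite integral_nneseries//.
  apply: (@le_lt_trans _ _ (\sum_(n <oo) (C ^+ 2 * r ^+ n)%:E)%E).
    apply: lee_nneseries => // n _ _; exact: integral_ge0.
  have cg : series (geometric (C ^+ 2) r) n @[n --> \oo] --> C ^+ 2 * (1 - r)^-1.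
    by apply: cvg_geometric_series; rewrite gtr0_norm.
  have -> : (\sum_(n <oo) (C ^+ 2 * r ^+ n)%:E)%E = (C ^+ 2 * (1 - r)^-1)%:E.
    apply/cvg_lim => //; apply: cvg_EFin.
      by apply: nearW => n; rewrite sumEFin.
    rewrite [X in X @ _](_ : _ = series (geometric (C ^+ 2) r)) //.
    by apply/funext => n; rewrite /series/= sumEFin.
  exact: ltry.
have aeS : {ae mu, forall x, ((\sum_(n <oo) s n x)%E \is a fin_num)}.
  have : mu.-integrable setT (fun x => \sum_(n <oo) s n x)%E.
    apply/integrableP; split.
      by apply: (ge0_emeasurable_sum (P := xpredT)) => [k x _ _|k _]; [exact: s0|exact: ms].
    by under eq_integral do rewrite gee0_abs ?nneseries_ge0//.
  by move/(integrable_ae measurableT); apply: ae_imp => x; exact.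
have aecvg : {ae mu, forall x, cvgn (u ^~ x)}.
  apply: ae_imp aeS => x Sx.
  pose K := fine (\sum_(n <oo) s n x)%E.
  have K0 : 0 <= K by rewrite fine_ge0// nneseries_ge0.
  pose t := Num.sqrt r.
  have t1 : `|t| < 1 by rewrite ger0_norm ?sqrtr_ge0// -sqrtr1 ltr_sqrt.
  (* A single term of the weighted series is at most its sum [K], so the increments at [x] are
     dominated by a geometric sequence. *)
  have dK n : `|d n x| <= Num.sqrt K * t ^+ n.
    have h : r ^- n * d n x ^+ 2 <= K.
      rewrite -lee_fin fineK// -/(s n x).
      have := @nneseries_lim_ge R (s ^~ x) xpredT 0 n.+1 (fun m _ _ => s0 m x).
      apply: le_trans; rewrite big_mkord (bigD1 ord_max)//= leeDl//.
      by apply: sume_ge0.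
    rewrite -(@ler_pXn2r _ 2)// ?nnegrE ?mulr_ge0 ?exprn_ge0 ?sqrtr_ge0//.
    rewrite sqr_norm exprMn sqr_sqrtr// -exprM mulnC exprM sqr_sqrtr ?(ltW r0)//.
    by move: h; rewrite mulrC ler_pdivrMr ?exprn_gt0.
  have : cvgn (series (fun n => d n x)).
    apply: normed_cvg.
    apply: (@series_le_cvg _ _ (geometric (Num.sqrt K) t)).
    - by move=> n; rewrite /= normr_ge0.
    - by move=> n; rewrite /geometric/= mulr_ge0 ?exprn_ge0 ?sqrtr_ge0.
    - exact: dK.
    - exact: is_cvg_geometric_series.
  move=> cd; have -> : u ^~ x = (fun n => u 0%N x + series (fun n => d n x) n).
    apply/funext => n; rewrite /series/= telescope_sumr//.
    by rewrite addrC subrK.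
  by apply: is_cvgD => //; exact: is_cvg_cst.
(* An upper limit is measurable even where the sequence diverges; [fine] turns infinite values, met
   at most on a null set, into 0. *)
pose v x := fine (limn_esup (fun n => (u n x)%:E)).
have mv : measurable_fun setT v.
  apply: measurableT_comp => //; apply: measurable_fun_limn_esup => n.
  by apply/measurable_EFinP; have [] := Lu n.
have uv : {ae mu, forall x, u n x @[n --> \oo] --> v x}.
  apply: ae_imp aecvg => x /cvg_ex[/= l ul]; suff -> : v x = l by [].
  rewrite /v; have : (u n x)%:E @[n --> \oo] --> l%:E.
    by apply: cvg_EFin => //; exact: nearW.
  by move/cvg_limn_einf_sup => [_ ->].
(* Fatou's lemma in the second index, [n] being fixed, turns the Cauchy estimate into the distance
   to [v] and puts [v] in L^2. *)
have key n : L2R (u n - v) /\ ipL (u n - v) (u n - v) <= (C / (1 - q) * q ^+ n) ^+ 2.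
  apply: (@fatou_L2R (fun m => u n - u (n + m)%N)).
  - by move=> m; exact: (ph_sub H).
  - by apply: measurable_funB => //; have [] := Lu n.
  - apply: ae_imp uv => x ux; apply: cvgB; first exact: cvg_cst.
    exact: (@cvg_shift (fun k => u k x)).
  move=> m; rewrite -(sqr_hnorm H) lerXn2r ?nnegrE ?hnorm_ge0//.
    by rewrite mulr_ge0 ?exprn_ge0// divr_ge0// subr_ge0 ltW.
  rewrite (hnorm_subC H (Lu _) (Lu _)); apply: (geometric_dist H) => //; exact/andP.
have Lv : L2R v.
  have -> : v = u 0%N - (u 0%N - v) by rewrite opprB addrC subrK.
  by apply: (ph_sub H) => //; have [] := key 0%N.
exists v => // e e0.
have : C / (1 - q) * q ^+ n @[n --> \oo] --> (0 : R).
  by apply: cvg_geometric; rewrite ger0_norm.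
move=> /cvgrPdist_le/(_ _ e0)[N _ NP]; exists N => n Nn.
have := NP n Nn; rewrite sub0r normrN; apply: le_trans.
have [_ kn] := key n; rewrite -ler_sqr ?nnegrE ?hnorm_ge0// (sqr_hnorm H).
by rewrite real_normK ?num_real.
Qed.

End square_integrable.

(** * Integration over the line: reflections and symmetric exhaustion *)

Section line_integrals.
Context {R : realType}.
Local Notation mu := (@lebesgue_measure R).
Implicit Types (f g F : R -> R) (a b c : R).

Lemma measurable_reflect c : measurable_fun setT (fun y : R => c - y).
Proof. exact: measurable_funB. Qed.

(** By uniqueness of Lebesgue measure, tested on half-open intervals; the reflection exchanges the
    open and the closed end, which does not change the measure. *)
Lemma lebesgue_measure_reflect c (A : set R) : measurable A ->
  pushforward mu ((fun y => c - y) : _ -> measurableTypeR R) A = mu A.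
Proof.
move=> mA; apply/esym/lebesgue_measure_unique => //=; first exact: measurable_reflect.
move=> mc _ [[a b]] _ <-.
rewrite /pushforward.
have -> : (fun y : R => c - y) @^-1` `]a, b] = `[c - b, c - a[%classic.
  apply/seteqP; split => x /=; rewrite !in_itv/= => /andP[h1 h2];
  by apply/andP; split; lra.
rewrite !lebesgue_measure_itv/= !lte_fin.
have -> : (c - b < c - a) = (a < b) by apply/idP/idP => ?; lra.
by case: ifPn => // _; rewrite -!EFinB; congr EFin; ring.
Qed.

Lemma ge0_integral_reflect c (f : R -> \bar R) : measurable_fun setT f ->
  (forall x, 0 <= f x)%E -> (\int[mu]_y f (c - y)%R = \int[mu]_y f y)%E.
Proof.
move=> mf f0.
have := @ge0_integral_pushforward _ _ (measurableTypeR R) (measurableTypeR R) R _ (measurable_reflect c) mu setT f measurableT mf.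
rewrite preimage_setT => <-//.
by apply: eq_measure_integral => [|mc A mA _]; [exact: measurable_reflect|exact: lebesgue_measure_reflect].
Qed.

Lemma Rintegral_reflect c f : intgT f ->
  intgT (fun y : R => f (c - y)) /\ \int[mu]_y f (c - y) = \int[mu]_y f y.
Proof.
move=> intf; have mf := intgT_measurable intf.
have mfc : measurable_fun setT (fun y : R => f (c - y)).
  by apply: (measurableT_comp mf); exact: measurable_reflect.
have ifc : intgT (fun y : R => f (c - y)).
  apply/integrableP; split; first exact/measurable_EFinP.
  have -> : (\int[mu]_x `|(f (c - x)%R)%:E| =
             \int[mu]_x `|(f x)%:E|)%E.
    rewrite -[RHS](ge0_integral_reflect c (f := fun x => `|(f x)%:E|%E))//.
    by apply/measurable_EFinP; exact: measurableT_comp.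
  by move/integrableP : intf => [].
split=> //; rewrite /Rintegral; congr fine.
have mEf : measurable_fun setT (EFin \o f) by exact/measurable_EFinP.
have := @integral_pushforward _ _ (measurableTypeR R) (measurableTypeR R) R _ (measurable_reflect c) mu setT (EFin \o f) mEf.
rewrite preimage_setT => /(_ ifc measurableT) <-.
by apply: eq_measure_integral => [|mc A mA _]; [exact: measurable_reflect|exact: lebesgue_measure_reflect].
Qed.

Lemma continuous_itv_integrable a b f : (forall x, a <= x <= b -> {for x, continuous f}) ->
  mu.-integrable `[a, b] (EFin \o f).
Proof.
move=> cf; apply: continuous_compact_integrable; first exact: segment_compact.
apply: continuous_in_subspaceT => x; rewrite inE/= in_itv/= => xab; exact: cf.
Qed.

Lemma FTC_segment a b f F : a < b ->
  (forall x, a <= x <= b -> is_derive x 1 F (f x)) ->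
  (forall x, a <= x <= b -> {for x, continuous f}) ->
  \int[mu]_(x in `[a, b]) f x = F b - F a.
Proof.
move=> ab dF cf.
have cF x : a <= x <= b -> {for x, continuous F}.
  move=> xab; apply: differentiable_continuous; apply/derivable1_diffP.
  by have [] := dF x xab.
rewrite /Rintegral (@continuous_FTC2 _ f F)//.
- apply: continuous_in_subspaceT => x; rewrite inE/= in_itv/= => xab; exact: cf.
- split.
  + by move=> x; rewrite in_itv/= => /andP[/ltW ax /ltW xb]; have [] := dF x (introT andP (conj ax xb)).
  + apply: cvg_at_right_filter; apply: cF; by rewrite lexx ltW.
  + apply: cvg_at_left_filter; apply: cF; by rewrite lexx ltW.
- move=> x; rewrite in_itv/= => /andP[/ltW ax /ltW xb].
  by rewrite derive1E; have [_ ->] := dF x (introT andP (conj ax xb)).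
Qed.

Definition sym_itv n : set R := `[- n%:R, n%:R]%classic.

Lemma measurable_sym_itv n : measurable (sym_itv n).
Proof. exact: measurable_itv. Qed.

Lemma bigcup_sym_itv : \bigcup_n sym_itv n = setT.
Proof.
apply/seteqP; split => // x _; exists (Num.trunc `|x|).+1 => //.
by rewrite /sym_itv/= in_itv/= -ler_norml ltW// truncnS_gt.
Qed.

Lemma ge0_integral_sym_lim f (F : nat -> R) (l : R) : measurable_fun setT f ->
  (forall x, 0 <= f x) ->
  (forall n, mu.-integrable (sym_itv n) (EFin \o f)) ->
  (forall n, \int[mu]_(x in sym_itv n) f x = F n) ->
  F n @[n --> \oo] --> l -> intgT f /\ \int[mu]_x f x = l.
Proof.
move=> mf f0 intf fF Fl.
have nd : nondecreasing_seq sym_itv.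
  apply/nondecreasing_seqP => n; apply/subsetPset => x; rewrite /sym_itv/= !in_itv/=.
  by move=> /andP[h1 h2]; rewrite -natr1; apply/andP; split; lra.
have := @ge0_nondecreasing_set_cvg_integral _ (measurableTypeR R) R _ (EFin \o f) mu nd.
move=> /(_ _ _ _) h.
have {h} : (\int[mu]_(x in sym_itv n) (f x)%:E)%E @[n --> \oo] -->
    (\int[mu]_x (f x)%:E)%E.
  rewrite -bigcup_sym_itv; apply: h.
  - by move=> n; exact: measurable_sym_itv.
  - by move=> n; apply/measurable_EFinP; exact: measurable_funTS.
  - by move=> n x _; rewrite /= lee_fin.
have Fl' : (F n)%:E @[n --> \oo] --> l%:E by apply: cvg_EFin => //; exact: nearW.
have -> : (fun n => \int[mu]_(x in sym_itv n) (f x)%:E)%E = (fun n => (F n)%:E).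
  by apply/funext => n; rewrite -fF /Rintegral fineK//; apply: integrable_fin_num; [exact: measurable_sym_itv|exact: intf].
move=> /(cvg_unique _ Fl')-/(_ (@ereal_hausdorff R)) E.
split; last by rewrite /Rintegral -E.
apply/integrableP; split; first exact/measurable_EFinP.
by under eq_integral do rewrite /= ger0_norm//; rewrite -E ltry.
Qed.

Lemma Rintegral_sym_cvg f : intgT f ->
  \int[mu]_(x in sym_itv n) f x @[n --> \oo] --> \int[mu]_x f x.
Proof.
move=> intf; have mf := intgT_measurable intf.
have -> : (fun n => \int[mu]_(x in sym_itv n) f x) =
    (fun n => \int[mu]_x (f \_ (sym_itv n)) x).
  by apply/funext => n; rewrite Rintegral_mkcond.
have [|||||_ _] := @dominated_convergence _ (measurableTypeR R) R mu setT measurableT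
  (fun n => EFin \o (f \_ (sym_itv n))) (EFin \o f) (fun x => `|f x|%:E).
- by move=> n; apply/measurable_EFinP; apply/(measurable_restrictT f); [exact: measurable_sym_itv|exact: measurable_funTS].
- exact/measurable_EFinP.
- apply: aeW => x _; apply: cvg_near_cst; near=> n.
  rewrite /= patchE mem_set//= /sym_itv/= in_itv/= -ler_norml.
  near: n; exact: nbhs_infty_ger.
- exact: intgT_norm.
- apply: aeW => x n _ /=; rewrite lee_fin patchE; case: ifP => // _.
  by rewrite normr0.
have -> : (\int[mu]_x (EFin \o f) x)%E = (\int[mu]_x f x)%:E.
  by rewrite /Rintegral fineK//; exact: integrable_fin_num.
by move=> h; exact: (fine_cvg h).
Unshelve. all: by end_near. Qed.

End line_integrals.

(** * Poisson's kernel and its conjugate *)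

Section poisson_kernels.
Context {R : realType}.
Local Notation mu := (@lebesgue_measure R).
Implicit Types (e d c x y t : R) (f g F : R -> R).

Lemma FTC_sym_itv f F n : (forall x, is_derive x (1 : R) F (f x)) -> continuous f ->
  \int[mu]_(x in sym_itv n) f x = F n%:R - F (- n%:R).
Proof.
move=> dF cf; case: n => [|n].
  by rewrite /sym_itv oppr0 set_itv1 Rintegral_set1 subrr.
have lt : - n.+1%:R < n.+1%:R :> R by have := @ltr0Sn R n; lra.
exact: (FTC_segment lt (fun x _ => dF x) (fun x _ => cf x)).
Qed.

Lemma sym_itv_integrable f n : continuous f ->
  mu.-integrable (sym_itv n) (EFin \o f).
Proof. by move=> cf; apply: continuous_itv_integrable => x _; exact: cf. Qed.

(** With [qk], the parts of a Cauchy kernel, free of the factor 1 / pi: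
    [qk e t + i pk e t = 1 / (t - i e)]. *)
Definition pk e t : R := e / (t ^+ 2 + e ^+ 2).
Definition qk e t : R := t / (t ^+ 2 + e ^+ 2).

Lemma kden_gt0 e t : 0 < e -> 0 < t ^+ 2 + e ^+ 2.
Proof. by move=> e0; rewrite ltr_wpDl ?sqr_ge0// exprn_gt0. Qed.

Lemma pk_ge0 e t : 0 < e -> 0 <= pk e t.
Proof. by move=> e0; rewrite divr_ge0 ?ltW// kden_gt0. Qed.

Lemma pk_sym e t : pk e (- t) = pk e t.
Proof. by rewrite /pk sqrrN. Qed.

Lemma qk_odd e t : qk e (- t) = - qk e t.
Proof. by rewrite /qk sqrrN mulNr. Qed.

Lemma pk_le e t : 0 < e -> pk e t <= e^-1.
Proof.
move=> e0; rewrite /pk ler_pdivrMr ?kden_gt0// mulrDr expr2 [in leRHS]expr2.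
by rewrite mulKf ?gt_eqF// lerDr mulr_ge0 ?invr_ge0 ?(ltW e0)// -expr2 sqr_ge0.
Qed.

Lemma pk_sqr_le e t : 0 < e -> pk e t ^+ 2 <= e^-1 * pk e t.
Proof. by move=> e0; rewrite expr2 ler_wpM2r ?pk_ge0 ?pk_le. Qed.

Lemma qk_sqr_le e t : 0 < e -> qk e t ^+ 2 <= e^-1 * pk e t.
Proof.
move=> e0; have h := kden_gt0 t e0.
rewrite /qk /pk mulrA mulVf ?gt_eqF// expr_div_n ler_pdivrMr ?exprn_gt0//.
by rewrite mul1r [X in _ <= _ * X]expr2 mulKf ?gt_eqF// lerDl sqr_ge0.
Qed.

Lemma qk_le e t : 0 < e -> `|qk e t| <= e^-1.
Proof.
move=> e0; rewrite -(@ler_pXn2r _ 2)// ?nnegrE ?invr_ge0 ?(ltW e0)//.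
rewrite sqr_norm (le_trans (qk_sqr_le _ e0))// expr2.
by rewrite ler_wpM2l ?pk_le// invr_ge0 ltW.
Qed.

Lemma continuous_kden e x : 0 < e -> {for x, continuous (fun t => (t ^+ 2 + e ^+ 2)^-1)}.
Proof.
move=> e0; apply: cvgV; first by rewrite gt_eqF ?kden_gt0.
by apply: cvgD; [exact: exprn_continuous|exact: cvg_cst].
Qed.

Lemma continuous_pk e : 0 < e -> continuous (pk e).
Proof. by move=> e0 x; apply: cvgM; [exact: cvg_cst|exact: continuous_kden]. Qed.

Lemma continuous_qk e : 0 < e -> continuous (qk e).
Proof. by move=> e0 x; apply: cvgM; [exact: cvg_id|exact: continuous_kden]. Qed.

Lemma continuous_shift f y : continuous f -> continuous (fun x => f (x - y)).
Proof.
move=> cf x; apply: continuous_comp; last exact: cf.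
by apply: cvgB; [exact: cvg_id|exact: cvg_cst].
Qed.

Lemma continuous_reflect f y : continuous f -> continuous (fun x => f (y - x)).
Proof.
move=> cf x; apply: continuous_comp; last exact: cf.
by apply: cvgB; [exact: cvg_cst|exact: cvg_id].
Qed.

Lemma pk_sym_itv e y n : 0 < e ->
  \int[mu]_(x in sym_itv n) pk e (x - y) =
  atan ((n%:R - y) / e) - atan ((- n%:R - y) / e).
Proof.
move=> e0; pose F x := atan ((x - y) / e).
have dF x : is_derive x (1 : R) F (pk e (x - y)).
  apply: is_derive_eq; rewrite /pk /GRing.scale/=; field.
  by rewrite !gt_eqF ?kden_gt0// addrC; have := kden_gt0 (x - y) e0.
exact: FTC_sym_itv dF (continuous_shift (continuous_pk e0)).
Qed.

Lemma pk_sym_itv_cvg e y : 0 < e ->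
  \int[mu]_(x in sym_itv n) pk e (x - y) @[n --> \oo] --> (pi : R).
Proof.
move=> e0; under eq_fun do rewrite pk_sym_itv//.
have -> : (pi : R) = pi / 2 - (- (pi / 2)) by field.
have h c : atan ((n%:R + c) / e) @[n --> \oo] --> (pi / 2 : R).
  apply: (cvg_comp _ _ _ (@cvgy_atan R)).
  apply/cvgryPge => A; near=> n; rewrite ler_pdivlMr// -lerBlDr.
  near: n; exact: nbhs_infty_ger.
apply: cvgB; first exact: h.
under eq_fun do rewrite -opprD mulNr atanN.
by apply: cvgN; exact: h.
Unshelve. all: by end_near. Qed.

Lemma pk_integral e : 0 < e -> intgT (pk e) /\ \int[mu]_x pk e x = pi.
Proof.
move=> e0; have := @ge0_integral_sym_lim R (pk e) (fun n => \int[mu]_(x in sym_itv n) pk e x) pi.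
apply=> //.
- exact: continuous_measurable_fun (continuous_pk e0).
- by move=> x; exact: pk_ge0.
- by move=> n; apply: sym_itv_integrable; exact: continuous_pk.
- have := pk_sym_itv_cvg (0 : R) e0.
  by under eq_fun do under eq_Rintegral do rewrite subr0.
Qed.

Lemma pk_reflect_integral e x : 0 < e ->
  intgT (fun y => pk e (x - y)) /\ \int[mu]_y pk e (x - y) = pi.
Proof.
by move=> e0; have [ip <-] := pk_integral e0; exact: Rintegral_reflect.
Qed.

Lemma pk_shift_integral e y : 0 < e ->
  intgT (fun x => pk e (x - y)) /\ \int[mu]_x pk e (x - y) = pi.
Proof.
move=> e0; have := pk_reflect_integral y e0.
by under eq_fun do rewrite -pk_sym opprB; under eq_Rintegral do rewrite -pk_sym opprB.
Qed.

(** The antiderivative is logarithmic, and on a symmetric interval the ratio of its arguments at the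
    two ends tends to 1 like 1 + O(1 / n). *)
Lemma qk_sym_itv_cvg e y : 0 < e ->
  \int[mu]_(x in sym_itv n) qk e (x - y) @[n --> \oo] --> (0 : R).
Proof.
move=> e0.
have E n : \int[mu]_(x in sym_itv n) qk e (x - y) =
    2^-1 * ln (1 - 4 * n%:R * y / ((n%:R + y) ^+ 2 + e ^+ 2)).
  pose F x := 2^-1 * ln ((x - y) ^+ 2 + e ^+ 2).
  have dF x : is_derive x (1 : R) F (qk e (x - y)).
    have h := kden_gt0 (x - y) e0; have hd := is_derive1_ln h.
    apply: is_derive_eq; rewrite /qk /GRing.scale/=; field.
    by rewrite gt_eqF.
  rewrite (FTC_sym_itv n dF (continuous_shift (continuous_qk e0))) /F.
  have h1 := kden_gt0 (n%:R - y) e0; have h2 := kden_gt0 (n%:R + y) e0.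
  rewrite -mulrBr -opprD sqrrN -ln_div ?posrE//; congr (_ * ln _).
  by field; rewrite gt_eqF.
under eq_fun do rewrite E.
have -> : (0 : R) = 2^-1 * ln 1 by rewrite ln1 mulr0.
apply: cvgM; first exact: cvg_cst.
apply: continuous_cvg; first exact: continuous_ln.
have -> : nbhs (1 : R) = nbhs (1 - 0 : R) by rewrite subr0.
apply: cvgB; first exact: cvg_cst.
apply/cvgrPdist_le => r r0; near=> n.
have n0 : (0 : R) < n%:R by near: n; exact: nbhs_infty_gtr.
(* This gives [n + y >= n / 2], so that the fraction is at most [16 |y| / n]; the next bound makes
   it at most [r]. *)
have n1 : 2 * `|y| <= n%:R by near: n; exact: nbhs_infty_ger.
have n2 : 16 * `|y| / r <= n%:R by near: n; exact: nbhs_infty_ger.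
have h2 := kden_gt0 (n%:R + y) e0.
rewrite sub0r normrN !normrM normfV (gtr0_norm h2) (gtr0_norm n0) normr_nat.
rewrite ler_pdivrMr//.
have h3 : n%:R ^+ 2 / 4 <= (n%:R + y) ^+ 2.
  have : n%:R / 2 <= n%:R + y by have := ler_norm (- y); rewrite normrN; lra.
  have : 0 <= n%:R / 2 :> R by rewrite divr_ge0// ltW.
  nra.
have h4 : 16 * `|y| <= n%:R * r by rewrite -ler_pdivrMr.
have : 0 <= e ^+ 2 by rewrite sqr_ge0.
have : r * (n%:R ^+ 2 / 4) <= r * (n%:R + y) ^+ 2 by rewrite ler_pM2l.
have : n%:R * (16 * `|y|) <= n%:R * (n%:R * r) by rewrite ler_pM2l.
nra.
Unshelve. all: by end_near. Qed.

End poisson_kernels.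

(** * Products of kernels by partial fractions *)

Section partial_fractions.
Context {R : realType}.
Local Notation mu := (@lebesgue_measure R).
Implicit Types (e d x y w t : R) (f g : R -> R).

(** A principal value at infinity: [qk] decays like 1 / t and has no Lebesgue integral, but
    integrable products of kernels decompose into such terms. *)
Definition sym_lim f (l : R) :=
  continuous f /\ \int[mu]_(x in sym_itv n) f x @[n --> \oo] --> l.

Lemma sym_limD f g k l : sym_lim f k -> sym_lim g l ->
  sym_lim (fun x => f x + g x) (k + l).
Proof.
move=> [cf fk] [cg gl]; split; first by move=> x; apply: cvgD; [exact: cf|exact: cg].
have -> : (fun n => \int[mu]_(x in sym_itv n) (f x + g x)) = (fun n =>
    \int[mu]_(x in sym_itv n) f x + \int[mu]_(x in sym_itv n) g x).
  apply/funext => n; rewrite RintegralD//; [exact: measurable_sym_itv|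
    exact: sym_itv_integrable..].
exact: cvgD.
Qed.

Lemma sym_limZ a f k : sym_lim f k -> sym_lim (fun x => a * f x) (a * k).
Proof.
move=> [cf fk]; split; first by move=> x; apply: cvgM; [exact: cvg_cst|exact: cf].
have -> : (fun n => \int[mu]_(x in sym_itv n) (a * f x)) = (fun n =>
    a * \int[mu]_(x in sym_itv n) f x).
  apply/funext => n; rewrite RintegralZl//; [exact: measurable_sym_itv|
    exact: sym_itv_integrable].
by apply: cvgM => //; exact: cvg_cst.
Qed.

Lemma sym_lim_integral f l : intgT f -> sym_lim f l -> \int[mu]_x f x = l.
Proof.
move=> intf [_ fl]; apply: (cvg_unique _ (Rintegral_sym_cvg intf) fl).
exact: Rhausdorff.
Qed.

Lemma sym_lim_pk e y : 0 < e -> sym_lim (fun x => pk e (x - y)) pi.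
Proof.
move=> e0; split; last exact: pk_sym_itv_cvg.
exact: continuous_shift (continuous_pk e0).
Qed.

Lemma sym_lim_qk e y : 0 < e -> sym_lim (fun x => qk e (x - y)) 0.
Proof.
move=> e0; split; last exact: qk_sym_itv_cvg.
exact: continuous_shift (continuous_qk e0).
Qed.

Lemma qk_sqr_integrable e y : 0 < e -> intgT (fun x => qk e (x - y) ^+ 2) /\
  \int[mu]_x (qk e (x - y) ^+ 2) <= e^-1 * pi.
Proof.
move=> e0; have [ip pE] := pk_shift_integral y e0.
have cq := continuous_shift (y := y) (continuous_qk e0).
have iq : intgT (fun x => qk e (x - y) ^+ 2).
  apply: intgT_le (intgTZ e^-1 ip).
    by apply: measurable_funX; exact: continuous_measurable_fun.
  by move=> x; rewrite ger0_norm ?sqr_ge0// qk_sqr_le.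
split=> //; rewrite -pE -RintegralZl//; apply: le_Rintegral => //.
  exact: intgTZ.
by move=> x _; exact: qk_sqr_le.
Qed.

Lemma pk_sqr_integrable e y : 0 < e -> intgT (fun x => pk e (x - y) ^+ 2) /\
  \int[mu]_x (pk e (x - y) ^+ 2) <= e^-1 * pi.
Proof.
move=> e0; have [ip pE] := pk_shift_integral y e0.
have cq := continuous_shift (y := y) (continuous_pk e0).
have iq : intgT (fun x => pk e (x - y) ^+ 2).
  apply: intgT_le (intgTZ e^-1 ip).
    by apply: measurable_funX; exact: continuous_measurable_fun.
  by move=> x; rewrite ger0_norm ?sqr_ge0// pk_sqr_le.
split=> //; rewrite -pE -RintegralZl//; apply: le_Rintegral => //.
  exact: intgTZ.
by move=> x _; exact: pk_sqr_le.
Qed.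

Lemma L2R_pk e y : 0 < e -> L2R (fun x => pk e (x - y)).
Proof.
move=> e0; split; last by have [] := pk_sqr_integrable y e0.
apply: continuous_measurable_fun; exact: continuous_shift (continuous_pk e0).
Qed.

Lemma L2R_qk e y : 0 < e -> L2R (fun x => qk e (x - y)).
Proof.
move=> e0; split; last by have [] := qk_sqr_integrable y e0.
apply: continuous_measurable_fun; exact: continuous_shift (continuous_qk e0).
Qed.

Lemma pk_reflectE e x y : pk e (x - y) = pk e (y - x).
Proof. by rewrite -pk_sym opprB. Qed.

Lemma qk_reflectE e x y : qk e (x - y) = - qk e (y - x).
Proof. by rewrite -qk_odd opprB. Qed.

(* Partial fractions of [1 / ((t + i e) (t + c + i d))]: its integral over the
   line vanishes, both poles being in the same half-plane; this is the real part. *)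
Lemma qk_qk_integral e d y w : 0 < e -> 0 < d ->
  (y - w) ^+ 2 + (d - e) ^+ 2 != 0 ->
  \int[mu]_x (qk e (x - y) * qk d (x - w)) =
  \int[mu]_x (pk e (x - y) * pk d (x - w)).
Proof.
move=> e0 d0 c0.
have iq := L2R_mul_integrable (L2R_qk y e0) (L2R_qk w d0).
have ip := L2R_mul_integrable (L2R_pk y e0) (L2R_pk w d0).
apply/eqP; rewrite -subr_eq0 -RintegralB//; apply/eqP.
pose c := y - w; pose k := d - e; pose D := (c ^+ 2 + k ^+ 2)^-1.
apply: sym_lim_integral; first exact: intgTB.
have -> : (0 : R) = D * c * 0 + (- (D * c) * 0 + (- (D * k) * pi + (D * k) * pi)).
  by ring.
have -> : (fun x => qk e (x - y) * qk d (x - w) - pk e (x - y) * pk d (x - w)) =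
  (fun x => (D * c) * qk e (x - y) + (- (D * c) * qk d (x - w) +
     (- (D * k) * pk e (x - y) + (D * k) * pk d (x - w)))).
  apply/funext => x; rewrite /D /c /k /qk /pk.
  have h1 := kden_gt0 (x - y) e0; have h2 := kden_gt0 (x - w) d0.
  by field; rewrite c0 !gt_eqF.
by do 3 (apply: sym_limD; first by apply: sym_limZ; [exact: sym_lim_qk || exact: sym_lim_pk]);
  apply: sym_limZ; exact: sym_lim_pk.
Qed.

(* The same for [1 / ((x - y +- i d) (y - w + i e))], imaginary parts. *)
Lemma pk_qk_integral e d x w : 0 < e -> 0 < d ->
  (x - w) ^+ 2 + (e - d) ^+ 2 != 0 ->
  \int[mu]_y (pk d (x - y) * qk e (y - w)) = pi * qk (e + d) (x - w).
Proof.
move=> e0 d0 c0.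
have -> : (fun y => pk d (x - y) * qk e (y - w)) = (fun y => pk d (y - x) * qk e (y - w)).
  by apply/funext => y; rewrite pk_reflectE.
have ip := L2R_mul_integrable (L2R_pk x d0) (L2R_qk w e0).
apply: sym_lim_integral => //.
pose t := x - w; pose k := e - d; pose K := e + d.
pose D := (t ^+ 2 + k ^+ 2)^-1; pose D' := (t ^+ 2 + K ^+ 2)^-1.
have K0 : 0 < K by rewrite addr_gt0.
have h3 := kden_gt0 t K0.
have -> : pi * qk (e + d) (x - w) =
    ((D + D') * t / 2) * pi + (((D' - D) * t / 2) * pi +
   (((D * k - D' * K) / 2) * 0 + ((D' * K - D * k) / 2) * 0)).
  by rewrite /qk -/t -/K /D'; field; rewrite gt_eqF//= c0.
have -> : (fun y => pk d (y - x) * qk e (y - w)) =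
  (fun y => ((D + D') * t / 2) * pk d (y - x) + (((D' - D) * t / 2) * pk e (y - w) +
   (((D * k - D' * K) / 2) * qk d (y - x) + ((D' * K - D * k) / 2) * qk e (y - w)))).
  apply/funext => y; rewrite /D /D' /t /k /K /qk /pk.
  have h1 := kden_gt0 (y - x) d0; have h2 := kden_gt0 (y - w) e0.
  field; rewrite c0 !gt_eqF//=.
by do 3 (apply: sym_limD; first by apply: sym_limZ; [exact: sym_lim_qk || exact: sym_lim_pk]);
  apply: sym_limZ; exact: sym_lim_qk.
Qed.

End partial_fractions.

(** * Convolution operators on the line *)

Section kernel_operators.
Context {R : realType}.
Local Notation mu := (@lebesgue_measure R).
Implicit Types (e d x y w t : R) (f g h k u rho : R -> R).

Lemma measurable_kreflect k x : continuous k -> measurable_fun setT (fun y => k (x - y)).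
Proof. by move=> ck; apply: continuous_measurable_fun; exact: continuous_reflect. Qed.

Lemma measurable_kshift k y : continuous k -> measurable_fun setT (fun x => k (x - y)).
Proof. by move=> ck; apply: continuous_measurable_fun; exact: continuous_shift. Qed.

Lemma weighted_cauchy_schwarz rho u : (forall x, 0 <= rho x) -> intgT rho ->
  measurable_fun setT u -> intgT (fun x => u x ^+ 2 * rho x) ->
  intgT (fun x => u x * rho x) /\
  (\int[mu]_x (u x * rho x)) ^+ 2 <=
  (\int[mu]_x rho x) * \int[mu]_x (u x ^+ 2 * rho x).
Proof.
move=> rho0 irho mu_ iu2; have mrho := intgT_measurable irho.
have iu : intgT (fun x => u x * rho x).
  apply: intgT_le (intgTD irho iu2); first exact: measurable_funM.
  move=> x; rewrite normrM (ger0_norm (rho0 x)).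
  have h : `|u x| <= 1 + u x ^+ 2.
    rewrite -[u x ^+ 2]sqr_norm.
    have := sqr_ge0 (`|u x| - 1); have := normr_ge0 (u x); nra.
  by have := ler_wpM2r (rho0 x) h; rewrite mulrDl mul1r.
split=> //.
set W := \int[mu]_x rho x; set U1 := \int[mu]_x (u x * rho x).
set U2 := \int[mu]_x (u x ^+ 2 * rho x).
have P a : 0 <= U2 - 2 * a * U1 + a ^+ 2 * W.
  have <- : \int[mu]_x ((u x - a) ^+ 2 * rho x) = U2 - 2 * a * U1 + a ^+ 2 * W.
    rewrite /U2 /U1 /W -!RintegralZl// -RintegralB//; last exact: intgTZ.
    rewrite -RintegralD//; last 2 first.
    - by apply: intgTB => //; exact: intgTZ.
    - exact: intgTZ.
    by apply: eq_Rintegral => x _; ring.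
  by apply: Rintegral_ge0 => x _; rewrite mulr_ge0// sqr_ge0.
have W0 : 0 <= W by apply: Rintegral_ge0.
have [W00|WN] := eqVneq W 0.
  have [->|U1N] := eqVneq U1 0; first by rewrite W00 mul0r expr0n.
  (* A weight of mass 0 makes the quadratic linear in [a], and this [a] gives it the value -1. *)
  have := P ((U2 + 1) / (2 * U1)); rewrite W00 mulr0 addr0.
  have -> : U2 - 2 * ((U2 + 1) / (2 * U1)) * U1 = - 1 by field.
  by rewrite oppr_ge0 ler10.
have Wp : 0 < W by rewrite lt_def WN.
have := P (U1 / W).
have -> : U2 - 2 * (U1 / W) * U1 + (U1 / W) ^+ 2 * W = (W * U2 - U1 ^+ 2) / W by field.
by rewrite pmulr_lge0 ?invr_gt0// subr_ge0.
Qed.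

Definition kernel_op k f x := \int[mu]_y (k (x - y) * f y).

(** As [qk] is not integrable, a kernel is only asked to be continuous, bounded and square
    integrable; its convolution is then taken on integrable functions. *)
Definition good_kernel k B C := [/\ continuous k, forall t, `|k t| <= B &
  forall y, intgT (fun x => k (x - y) ^+ 2) /\ \int[mu]_x (k (x - y) ^+ 2) <= C].

Lemma good_pk e : 0 < e -> good_kernel (pk e) e^-1 (e^-1 * pi).
Proof.
move=> e0; split; first exact: continuous_pk.
  by move=> t; rewrite ger0_norm ?pk_ge0 ?pk_le.
by move=> y; exact: pk_sqr_integrable.
Qed.

Lemma good_qk e : 0 < e -> good_kernel (qk e) e^-1 (e^-1 * pi).
Proof.
move=> e0; split; first exact: continuous_qk.
  by move=> t; exact: qk_le.
by move=> y; exact: qk_sqr_integrable.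
Qed.

Section good_kernel.
Variables (k : R -> R) (B C : R).
Hypothesis gk : good_kernel k B C.

Let ck : continuous k. Proof. by case: gk. Qed.

Lemma kernel_integrable f x : intgT f -> intgT (fun y => k (x - y) * f y).
Proof.
move=> intf; have [_ kB _] := gk.
apply: intgT_le (intgTZ B (intgT_norm intf)).
  by apply: measurable_funM; [exact: measurable_kreflect|exact: intgT_measurable].
by move=> y; rewrite normrM ler_wpM2r ?kB.
Qed.

Lemma L2R_kernel y : L2R (fun x => k (x - y)).
Proof.
have [_ _ /(_ y)[ik _]] := gk; split => //.
exact: measurable_kshift.
Qed.

Lemma measurable_kernel_product f h : measurable_fun setT f -> measurable_fun setT h ->
  measurable_fun setT (fun z : R * R => k (z.1 - z.2) * f z.2 * h z.1).
Proof.
move=> mf mh; apply: measurable_funM; first apply: measurable_funM.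
- apply: (measurableT_comp (continuous_measurable_fun ck)).
  by apply: measurable_funB; [exact: measurable_fst|exact: measurable_snd].
- by apply: (measurableT_comp mf); exact: measurable_snd.
- by apply: (measurableT_comp mh); exact: measurable_fst.
Qed.

(** Since [|k h| <= k ^ 2 + h ^ 2], the inner integral in [x] is at most [C + ipL h h] uniformly in
    [y], and [f] is integrable. *)
Lemma kernel_product_integrable f h : intgT f -> L2R h ->
  (mu \x mu)%E.-integrable setT
    (fun z : R * R => (k (z.1 - z.2) * f z.2 * h z.1)%:E).
Proof.
move=> intf Lh; have [mh h2] := Lh; have mf := intgT_measurable intf.
have mF : measurable_fun setT (fun z : R * R => (k (z.1 - z.2) * f z.2 * h z.1)%:E).
  by apply/measurable_EFinP; exact: measurable_kernel_product.
apply/(@integrable21ltyP _ _ (measurableTypeR R) (measurableTypeR R) R mu mu _ mF).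
have iA := intgT_norm (intgTZ (C + ipL h h) intf).
have [_ ] := integrableP _ _ _ iA; apply: le_lt_trans.
apply: ge0_le_integral => //.
- by move=> y _; exact: integral_ge0.
- have mA := measurableT_comp (@abse_measurable R setT) mF.
  exact: (@measurable_fun_fubini_tonelli_G _ _ (measurableTypeR R)
    (measurableTypeR R) R mu _ mA (fun z => abse_ge0 _)).
- by apply: measurableT_comp => //; apply/measurable_EFinP; exact: intgT_measurable.
move=> y _ /=; rewrite normr_id.
have [_ _ /(_ y)[ik kC]] := gk.
have ikh := intgT_norm (L2R_mul_integrable (L2R_kernel y) Lh).
have -> : (\int[mu]_x `|(k (x - y) * f y * h x)%:E| =
    (`|f y| * \int[mu]_x `|k (x - y) * h x|)%:E)%E.
  rewrite -RintegralZl// /Rintegral fineK; last first.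
    by apply: integrable_fin_num => //; exact: intgTZ.
  by apply: eq_integral => x _ /=; congr EFin; rewrite !normrM; ring.
rewrite lee_fin normrM mulrC ler_wpM2r//.
apply: (@le_trans _ _ (C + ipL h h)); last exact: ler_norm.
apply: (@le_trans _ _ (\int[mu]_x (k (x - y) ^+ 2 + h x ^+ 2))).
  apply: le_Rintegral => //; first exact: intgTD.
  move=> x _; rewrite normrM -[k _ ^+ 2]sqr_norm -[h x ^+ 2]sqr_norm.
  have := sqr_ge0 (`|k (x - y)| - `|h x|).
  have := normr_ge0 (k (x - y)); have := normr_ge0 (h x); nra.
by rewrite RintegralD// lerD.
Qed.

Lemma kernel_op_mulE f h x : intgT f ->
  (\int[mu]_y (k (x - y) * f y * h x)%:E = (kernel_op k f x * h x)%:E)%E.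
Proof.
move=> intf; have ikf := kernel_integrable x intf.
rewrite /kernel_op -RintegralZr// /Rintegral fineK//.
by apply: integrable_fin_num => //; under eq_fun do rewrite mulrC; exact: intgTZ.
Qed.

Lemma kernel_fubini f h : intgT f -> L2R h ->
  [/\ intgT (fun x => kernel_op k f x * h x),
      measurable_fun setT (fun y => f y * \int[mu]_x (k (x - y) * h x)) &
      \int[mu]_x (kernel_op k f x * h x) =
      \int[mu]_y (f y * \int[mu]_x (k (x - y) * h x))].
Proof.
move=> intf Lh; have iF := kernel_product_integrable intf Lh.
have E1 : fubini_F mu (fun z : R * R => (k (z.1 - z.2) * f z.2 * h z.1)%:E) =
    EFin \o (fun x => kernel_op k f x * h x).
  by apply/funext => x; rewrite /fubini_F /= kernel_op_mulE.
have E2 : fubini_G mu (fun z : R * R => (k (z.1 - z.2) * f z.2 * h z.1)%:E) =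
    EFin \o (fun y => f y * \int[mu]_x (k (x - y) * h x)).
  apply/funext => y; rewrite /fubini_G /=.
  have ikh := L2R_mul_integrable (L2R_kernel y) Lh.
  rewrite -RintegralZl// /Rintegral fineK; last first.
    by apply: integrable_fin_num => //; exact: intgTZ.
  by apply: eq_integral => x _ /=; congr EFin; ring.
have i1 : intgT (fun x => kernel_op k f x * h x).
  by rewrite /intgT -E1; exact: (integrable_fubini_F iF).
split=> //.
  by apply/measurable_EFinP; rewrite -E2; exact: (measurable_fubini_G iF).
rewrite /Rintegral; congr fine.
transitivity (\int[mu]_x (EFin \o (fun x => kernel_op k f x * h x)%R) x)%E => //.
rewrite -E1; transitivity (\int[mu]_y
  (EFin \o (fun y => f y * \int[mu]_x (k (x - y) * h x))%R) y)%E => //.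
by rewrite -E2; exact: Fubini iF.
Qed.

(** Fubini's theorem gives measurability of the product with a square integrable function; [pk 1] is
    one without zeros, and can be divided out. *)
Lemma measurable_kernel_op f : intgT f -> measurable_fun setT (kernel_op k f).
Proof.
move=> intf; have p1 := L2R_pk (0 : R) (ltr01 : 0 < (1 : R)).
have [/intgT_measurable m1 _ _] := kernel_fubini intf p1.
have p0 x : pk 1 (x - 0) != 0 :> R.
  by rewrite /pk gt_eqF// divr_gt0// kden_gt0.
have -> : kernel_op k f = (fun x => kernel_op k f x * pk 1 (x - 0) * (pk 1 (x - 0))^-1).
  by apply/funext => x; rewrite mulfK.
apply: measurable_funM => //; apply: continuous_measurable_fun => x.
apply: cvgV => //; exact: continuous_shift (continuous_pk ltr01) _.
Qed.

End good_kernel.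

Lemma good_kernel_sqr k B C : good_kernel k B C ->
  good_kernel (fun t => k t ^+ 2) (B ^+ 2) (B ^+ 2 * C).
Proof.
move=> [ck kB kC]; have B0 : 0 <= B by exact: le_trans (kB 0).
have k2B t : k t ^+ 2 <= B ^+ 2 by rewrite -sqr_norm lerXn2r ?nnegrE.
split.
- by move=> t; apply: (@continuous_comp _ _ _ k (fun s => s ^+ 2)); [exact: ck|exact: exprn_continuous].
- by move=> t; rewrite ger0_norm ?sqr_ge0.
move=> y; have [ik kyC] := kC y.
have le4 x : (k (x - y) ^+ 2) ^+ 2 <= B ^+ 2 * k (x - y) ^+ 2.
  by rewrite expr2 ler_wpM2r ?sqr_ge0.
have i4 : intgT (fun x => (k (x - y) ^+ 2) ^+ 2).
  apply: intgT_le (intgTZ (B ^+ 2) ik).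
    by do 2 apply: measurable_funX; exact: measurable_kshift.
  by move=> x; rewrite ger0_norm ?sqr_ge0.
split=> //; apply: (@le_trans _ _ (\int[mu]_x (B ^+ 2 * k (x - y) ^+ 2))).
  by apply: le_Rintegral => //; exact: intgTZ.
by rewrite RintegralZl// ler_wpM2l ?sqr_ge0.
Qed.

Lemma kernel_op_integral_le k B C f M : good_kernel k B C ->
  (forall t, 0 <= k t) -> (forall y, 0 <= f y) -> intgT f ->
  (forall y, intgT (fun x => k (x - y)) /\ \int[mu]_x k (x - y) <= M) ->
  (\int[mu]_x (kernel_op k f x)%:E <= (M * \int[mu]_y f y)%:E)%E.
Proof.
move=> gk k0 f0 intf kM; have [ck kB _] := gk; have mf := intgT_measurable intf.
pose G (z : R * R) := (k (z.1 - z.2) * f z.2)%:E.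
have mG : measurable_fun setT G.
  apply/measurable_EFinP; apply: measurable_funM.
    apply: (measurableT_comp (continuous_measurable_fun ck)).
    by apply: measurable_funB; [exact: measurable_fst|exact: measurable_snd].
  by apply: (measurableT_comp mf); exact: measurable_snd.
have G0 z : (0 <= G z)%E by rewrite lee_fin mulr_ge0.
have -> : (\int[mu]_x (kernel_op k f x)%:E = \int[mu]_x \int[mu]_y G (x, y))%E.
  apply: eq_integral => x _; rewrite /kernel_op /Rintegral fineK//.
  by apply: integrable_fin_num => //; exact: (kernel_integrable gk).
have -> := @fubini_tonelli _ _ (measurableTypeR R) (measurableTypeR R) R mu mu G mG G0.
have -> : (M * \int[mu]_y f y)%:E = (\int[mu]_y (M * f y)%:E)%E.
  rewrite -RintegralZl// /Rintegral fineK//.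
  by apply: integrable_fin_num => //; exact: intgTZ.
apply: ge0_le_integral => //.
- by move=> y _; exact: integral_ge0.
- exact: (@measurable_fun_fubini_tonelli_G _ _ (measurableTypeR R)
    (measurableTypeR R) R mu G mG G0).
- by apply/measurable_EFinP; exact: measurable_funM.
move=> y _; have [ik kyM] := kM y.
rewrite /fubini_G /G /=; under eq_integral do rewrite mulrC EFinM.
rewrite integralZl//.
have -> : (\int[mu]_x (k (x - y))%:E = (\int[mu]_x k (x - y))%:E)%E.
  by rewrite /Rintegral fineK//; exact: integrable_fin_num.
by rewrite -EFinM lee_fin mulrC ler_wpM2r.
Qed.

(** Young's inequality: Cauchy-Schwarz with weight [|f|] bounds the square by the mass of [|f|]
    times the convolution of [k ^ 2] with [|f|], which Tonelli's theorem integrates. *)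
Lemma L2R_kernel_op k B C f : good_kernel k B C -> intgT f -> L2R (kernel_op k f).
Proof.
move=> gk intf; have mf := intgT_measurable intf; have [ck kB kC] := gk.
have gk2 := good_kernel_sqr gk.
have iaf := intgT_norm intf.
set F1 := \int[mu]_y `|f y|.
have F10 : 0 <= F1 by exact: Rintegral_ge0.
pose Q := kernel_op (fun t => k t ^+ 2) (fun y => `|f y|).
have h1 x : kernel_op k f x ^+ 2 <= F1 * Q x.
  have ik2 : intgT (fun y => `|k (x - y)| ^+ 2 * `|f y|).
    by under eq_fun do rewrite sqr_norm; exact: (kernel_integrable gk2).
  have [|iu cs] := weighted_cauchy_schwarz (fun y => normr_ge0 (f y)) iaf _ ik2.
    by apply: measurableT_comp => //; exact: measurable_kreflect.
  move: cs; under [X in _ <= _ * X]eq_Rintegral do rewrite sqr_norm.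
  apply: le_trans; rewrite -sqr_norm lerXn2r ?nnegrE//.
    by apply: Rintegral_ge0 => y _; rewrite mulr_ge0.
  apply: (le_trans (le_normr_Rintegral _ (kernel_integrable gk x intf))) => //.
  by under eq_Rintegral do rewrite normrM.
have mQ : measurable_fun setT Q by apply: (measurable_kernel_op gk2).
suff h : (\int[mu]_x (kernel_op k f x ^+ 2)%:E <= (F1 * (C * F1))%:E)%E.
  by have [] := L2R_of_le (measurable_kernel_op gk intf) h.
apply: (@le_trans _ _ (\int[mu]_x (F1 * Q x)%:E)%E).
  apply: ge0_le_integral => //.
  - by move=> x _; rewrite lee_fin sqr_ge0.
  - by apply/measurable_EFinP; apply: measurable_funX; exact: (measurable_kernel_op gk).
  - by apply/measurable_EFinP; exact: measurable_funM.
  - by move=> x _; rewrite lee_fin.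
under eq_integral do rewrite EFinM.
rewrite ge0_integralZl//; last 2 first.
- exact/measurable_EFinP.
- by move=> x _; rewrite lee_fin; apply: Rintegral_ge0 => y _; rewrite mulr_ge0 ?sqr_ge0.
rewrite EFinM lee_wpmul2l ?lee_fin//.
apply: (kernel_op_integral_le gk2) => //.
by move=> t; rewrite sqr_ge0.
Qed.

End kernel_operators.

(** * Isometry, skewness and semigroup law of conjugate Poisson integrals *)

Section conjugate_poisson.
Context {R : realType}.
Local Notation mu := (@lebesgue_measure R).
Implicit Types (e d x y w t : R) (f g h : R -> R).

Local Notation P e := (kernel_op (pk e)).
Local Notation Q e := (kernel_op (qk e)).

(** Discards the one point where two poles may coincide and the partial fractions degenerate. *)
Lemma Rintegral_off_point f g x : measurable_fun setT f -> measurable_fun setT g ->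
  (forall y, y != x -> f y = g y) -> \int[mu]_y f y = \int[mu]_y g y.
Proof.
move=> mf mg fg; rewrite /Rintegral; congr fine.
apply: ae_eq_integral => //; [exact/measurable_EFinP..|].
exists [set x]; split=> //; first exact: lebesgue_measure_set1.
move=> y /=; apply: contra_notP => /eqP yx _; congr EFin; exact: fg.
Qed.

(** Fubini's theorem moves both kernels onto [f] and [g], which leaves [qk_qk_integral]. Two heights
    are allowed so that differences of approximations can be compared as well. *)
Lemma conjugate_poisson_isometry e d f g : 0 < e -> 0 < d -> intgT f -> intgT g ->
  ipL (Q e f) (Q d g) = ipL (P e f) (P d g).
Proof.
move=> e0 d0 intf intg; rewrite /ipL.
have [_ _ ->] := kernel_fubini (good_qk e0) intf (L2R_kernel_op (good_qk d0) intg).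
have [_ _ ->] := kernel_fubini (good_pk e0) intf (L2R_kernel_op (good_pk d0) intg).
apply: eq_Rintegral => y _; congr (_ * _).
under eq_Rintegral do rewrite mulrC.
under [RHS]eq_Rintegral do rewrite mulrC.
have [_ m1 ->] := kernel_fubini (good_qk d0) intg (L2R_kernel (good_qk e0) y).
have [_ m2 ->] := kernel_fubini (good_pk d0) intg (L2R_kernel (good_pk e0) y).
apply: (@Rintegral_off_point _ _ y) => // w wy; congr (_ * _).
under eq_Rintegral do rewrite mulrC.
under [RHS]eq_Rintegral do rewrite mulrC.
apply: qk_qk_integral => //; rewrite gt_eqF// ltr_pwDl ?sqr_ge0//.
by rewrite exprn_even_gt0//= subr_eq0 eq_sym.
Qed.

(** The semigroup law: Poisson averaging with [d] lifts the conjugate harmonic extension of [f] from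
    height [e] to height [e + d]. *)
Lemma poisson_conjugate_poisson e d f x : 0 < e -> 0 < d -> intgT f ->
  P d (Q e f) x = pi * Q (e + d) f x.
Proof.
move=> e0 d0 intf; have ed0 : 0 < e + d by exact: addr_gt0.
rewrite {1}/kernel_op; under eq_Rintegral do rewrite mulrC pk_reflectE.
have [_ m1 ->] := kernel_fubini (good_qk e0) intf (L2R_kernel (good_pk d0) x).
have iq := kernel_integrable (good_qk ed0) x intf.
rewrite /kernel_op -RintegralZl//.
apply: (@Rintegral_off_point _ _ x) => //; first exact: intgT_measurable (intgTZ _ iq).
move=> w wx; rewrite mulrC mulrA; congr (_ * _).
under eq_Rintegral do rewrite mulrC -pk_reflectE.
apply: pk_qk_integral => //; rewrite gt_eqF// ltr_pwDl ?sqr_ge0//.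
by rewrite exprn_even_gt0//= subr_eq0 eq_sym.
Qed.

Lemma conjugate_poisson_skew e f g : 0 < e -> L2R f -> intgT f ->
  L2R g -> intgT g -> ipL (Q e f) g = - ipL f (Q e g).
Proof.
move=> e0 Lf intf Lg intg; rewrite /ipL.
have [_ _ ->] := kernel_fubini (good_qk e0) intf Lg.
rewrite -[RHS]mulN1r -RintegralZl//; last first.
  exact: L2R_mul_integrable Lf (L2R_kernel_op (good_qk e0) intg).
apply: eq_Rintegral => y _; rewrite mulrCA; congr (_ * _).
have iqg := kernel_integrable (good_qk e0) y intg.
rewrite /kernel_op -RintegralZl//; apply: eq_Rintegral => x _.
by rewrite qk_reflectE mulN1r mulNr.
Qed.

(** Jensen's inequality for the probability density [pk e / pi], then Tonelli's theorem. *)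
Lemma poisson_bound e f : 0 < e -> L2R f -> intgT f ->
  L2R (P e f) /\ ipL (P e f) (P e f) <= pi ^+ 2 * ipL f f.
Proof.
move=> e0 [mf f2] intf; have gp := good_pk e0.
have mP := measurable_kernel_op gp intf.
pose F := kernel_op (pk e) (fun y => f y ^+ 2).
have mF : measurable_fun setT F := measurable_kernel_op gp f2.
apply: L2R_of_le => //.
apply: (@le_trans _ _ (\int[mu]_x (pi * F x)%:E)%E).
  apply: ge0_le_integral => //.
  - by move=> x _; rewrite lee_fin sqr_ge0.
  - by apply/measurable_EFinP; apply: measurable_funX.
  - by apply/measurable_EFinP; exact: measurable_funM.
  move=> x _; rewrite lee_fin.
  have [ip pE] := pk_reflect_integral x e0.
  have iu2 : intgT (fun y => f y ^+ 2 * pk e (x - y)).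
    by under eq_fun do rewrite mulrC; exact (kernel_integrable gp x f2).
  have [_] := weighted_cauchy_schwarz (fun y => pk_ge0 (x - y) e0) ip mf iu2.
  rewrite pE /F /kernel_op.
  under eq_Rintegral do rewrite mulrC.
  by under [X in _ <= _ * X -> _]eq_Rintegral do rewrite mulrC.
under eq_integral do rewrite EFinM.
rewrite ge0_integralZl//; last 3 first.
- exact/measurable_EFinP.
- move=> x _; rewrite lee_fin; apply: Rintegral_ge0 => y _.
  by rewrite mulr_ge0 ?sqr_ge0 ?pk_ge0.
- by rewrite lee_fin pi_ge0.
rewrite expr2 -mulrA EFinM lee_wpmul2l ?lee_fin ?pi_ge0//.
apply: (kernel_op_integral_le gp) => //.
- by move=> t; exact: pk_ge0.
- by move=> y; rewrite sqr_ge0.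
- by move=> y; have [ip ->] := pk_shift_integral y e0.
Qed.

End conjugate_poisson.

(** * Poisson averages at Lebesgue points *)

Section lebesgue_points.
Context {R : realType}.
Local Notation mu := (@lebesgue_measure R).
Implicit Types (e d x y z w t r : R) (f g h : R -> R).

Lemma L2R_locally_integrable g : L2R g -> locally_integrable setT g.
Proof.
move=> [mg g2]; split=> //; first exact: openT.
move=> K _ cK; have mK : measurable K by exact: compact_measurable.
have muK : (mu K < +oo)%E by exact: compact_finite_measure.
have i1 : mu.-integrable K (EFin \o (fun y => 1 + g y ^+ 2)).
  apply: (@integrableD _ (measurableTypeR R) R mu K mK (cst 1%E) (fun y => (g y ^+ 2)%:E)).
    apply/integrableP; split; first exact: measurable_cst.
    by rewrite (eq_integral (cst 1%E)) ?integral_cst ?mul1e// => y _; rewrite /= normr1.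
  exact: integrableS g2.
have : mu.-integrable K (EFin \o (fun y => `|g y|)).
  apply: le_integrable i1 => //.
    by apply/measurable_EFinP; apply: measurable_funTS; exact: measurableT_comp.
  move=> y _ /=; rewrite lee_fin normr_id [leRHS]ger0_norm; last by rewrite addr_ge0 ?sqr_ge0.
  rewrite -[g y ^+ 2]sqr_norm; have := sqr_ge0 (`|g y| - 1); have := normr_ge0 (g y); nra.
by move/integrableP => [_]; under eq_integral do rewrite /= normr_id.
Qed.

Lemma ae_lebesgue_pt g : L2R g -> {ae mu, forall x, lebesgue_pt g x}.
Proof. by move=> Lg; exact/lebesgue_differentiation/L2R_locally_integrable. Qed.

Definition ballind x r y : R := \1_(ball x r) y.

Lemma ballindE x r y : ballind x r y = (`|x - y| < r)%R%:R.
Proof.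
rewrite /ballind indicE; congr (nat_of_bool _)%:R.
by apply/idP/idP; rewrite inE.
Qed.

Lemma measurable_ballind x r : measurable_fun setT (ballind x r).
Proof. by apply: measurable_indic; exact: measurable_ball. Qed.

Lemma ballind_ge0 x r y : 0 <= ballind x r y.
Proof. by rewrite ballindE. Qed.

Lemma ballind_le1 x r y : ballind x r y <= 1.
Proof. by rewrite ballindE; case: (_ < _). Qed.

Lemma L2R_ballind x r : L2R (ballind x r).
Proof.
split; first exact: measurable_ballind.
rewrite /intgT (_ : EFin \o _ = EFin \o \1_(ball x r)).
  by rewrite ball_itv; exact: integrable_indic_itv.
apply/funext => y /=; congr EFin; rewrite -/(ballind x r y) ballindE.
by case: (_ < _); rewrite ?expr1n// expr0n.
Qed.

Lemma ballind_oscillation_integrable g x r : L2R g ->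
  intgT (fun y => ballind x r y * `|g y - g x|).
Proof.
move=> Lg; have Lb := L2R_ballind x r; have [mg _] := Lg.
have i1 := intgT_norm (L2R_mul_integrable Lb Lg).
have i2 := intgTZ `|g x| (L2R_mul_integrable Lb Lb).
apply: intgT_le (intgTD i1 i2).
  apply: measurable_funM; first exact: measurable_ballind.
  by apply: measurableT_comp => //; exact: measurable_funB.
move=> y; rewrite ballindE; case: (_ < _); last by rewrite !mul0r normr0 mulr0 addr0.
by rewrite !mul1r normr_id mulr1 ler_normB.
Qed.

Lemma lebesgue_pt_small g x : L2R g -> lebesgue_pt g x -> forall w, 0 < w ->
  exists2 r0, 0 < r0 & forall r, 0 < r < r0 ->
    \int[mu]_y (ballind x r y * `|g y - g x|) <= 2 * r * w.
Proof.
move=> Lg /fine_cvgP[finD cvD] w w0.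
move/cvgrPdist_lt : cvD => /(_ _ w0) cvD.
have [r0 /= r00 r0P] : \forall r \near 0^'+, davg g x r \is a fin_num /\ `|0 - fine (davg g x r)| < w.
  by apply: filterS2 finD cvD.
exists r0 => // r /andP[rp rr0].
have rb : ball_ Num.norm 0 r0 r by rewrite /= distrC subr0 gtr0_norm.
have [fr] := r0P r rb rp.
rewrite sub0r normrN => /ltW dr.
have E : davg g x r = ((2 * r)^-1 * \int[mu]_y (ballind x r y * `|g y - g x|))%:E.
  rewrite /davg /iavg lebesgue_measure_ball ?ltW//.
  have iB := ballind_oscillation_integrable x r Lg.
  rewrite EFinM; congr (_ * _)%E.
    have -> : r *+ 2 = 2 * r by rewrite mulr_natl.
    by rewrite inver gt_eqF// mulr_gt0.
  rewrite /Rintegral fineK; last exact: integrable_fin_num.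
  rewrite [LHS]integral_mkcond; apply: eq_integral => y _.
  rewrite patchE ballindE /=.
  case: ifPn => [/set_mem|/negP ny]; first by rewrite /ball/= => ->; rewrite mul1r.
  case: ltP => [xy|]; last by rewrite mul0r.
  by exfalso; apply: ny; rewrite inE.
move: dr; rewrite E /= ger0_norm; last first.
  apply: mulr_ge0; first by rewrite invr_ge0 mulr_ge0// ltW.
  apply: Rintegral_ge0 => y _.
  by rewrite mulr_ge0 ?ballind_ge0.
by rewrite mulrC ler_pdivrMr ?mulr_gt0// mulrC.
Qed.

Lemma oscillation_integrable e g x : 0 < e -> L2R g ->
  intgT (fun y => pk e (x - y) * `|g y - g x|).
Proof.
move=> e0 Lg; have [mg _] := Lg.
have [ip _] := pk_reflect_integral x e0.
have Lp : L2R (fun y => pk e (x - y)).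
  by have := L2R_pk x e0; under [X in L2R X -> _]eq_fun do rewrite pk_reflectE.
have i1 := intgT_norm (L2R_mul_integrable Lp Lg).
apply: intgT_le (intgTD i1 (intgTZ `|g x| ip)).
  apply: measurable_funM; first exact: intgT_measurable.
  by apply: measurableT_comp => //; exact: measurable_funB.
move=> y; have p0 := pk_ge0 (x - y) e0.
rewrite (normrM (pk e _) `|_|) (normrM (pk e _) (g y)) normr_id (ger0_norm p0) (mulrC `|g x|) -mulrDr ler_wpM2l//.
exact: ler_normB.
Qed.

Lemma ballind_pk_ge0 e x r y z : 0 < e -> 0 <= ballind x r y * (pk e (x - y) * `|z|).
Proof. by move=> e0; exact: (mulr_ge0 (ballind_ge0 _ _ _) (mulr_ge0 (pk_ge0 _ e0) (normr_ge0 _))). Qed.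

Lemma ballind_pk_le e x r y z : 0 < e ->
  ballind x r y * (pk e (x - y) * `|z|) <= pk e (x - y) * `|z|.
Proof.
by move=> e0; rewrite (ler_piMl (mulr_ge0 (pk_ge0 _ e0) (normr_ge0 _)))// ballind_le1.
Qed.

(* The inner ball is decomposed into dyadic shells, on which [pk e] is at most
   [e / r ^+ 2]. *)
Lemma poisson_dyadic e g x w r0 n : 0 < e -> 0 < w -> L2R g ->
  (forall r, 0 < r < r0 ->
    \int[mu]_y (ballind x r y * `|g y - g x|) <= 2 * r * w) ->
  2 ^+ n * e < r0 ->
  \int[mu]_y (ballind x (2 ^+ n * e) y * (pk e (x - y) * `|g y - g x|)) <=
  w * (10 - 8 * 2 ^- n).
Proof.
move=> e0 w0 Lg gr; have [mg _] := Lg.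
have iosc := oscillation_integrable x e0 Lg.
have miosc := intgT_measurable iosc.
have ib r : intgT (fun y => ballind x r y * (pk e (x - y) * `|g y - g x|)).
  apply: (intgT_le _ _ iosc).
    by apply: measurable_funM; [exact: measurable_ballind|exact: miosc].
  move=> y; rewrite ger0_norm; last exact: ballind_pk_ge0.
  exact: ballind_pk_le.
have ibo r := ballind_oscillation_integrable x r Lg.
(* The innermost ball contributes [2 w] and the shell at scale [2 ^+ n * e] contributes
   [4 w / 2 ^+ n]; these add up to the bound. *)
elim: n => [|n IH] nr.
  rewrite expr0 mul1r in nr *; rewrite invr1.
  apply: (@le_trans _ _ (\int[mu]_y (e^-1 * (ballind x e y * `|g y - g x|)))).
    apply: le_Rintegral => //; [exact: ib|exact: intgTZ|].
    move=> y _; rewrite mulrCA.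
    by rewrite (ler_wpM2r (mulr_ge0 (ballind_ge0 _ _ _) (normr_ge0 _)))// pk_le.
  rewrite RintegralZl//; last exact: ibo.
  have := gr e; rewrite e0 nr => /(_ erefl) h.
  rewrite mulrC ler_pdivrMr//; apply: le_trans h _; lra.
have pw : 0 < 2 ^+ n :> R by rewrite exprn_gt0.
have r1 : 0 < 2 ^+ n * e by rewrite mulr_gt0.
have r2 : 2 ^+ n.+1 * e = 2 * (2 ^+ n * e) by rewrite exprS mulrA.
have h1 : 2 ^+ n * e < r0 by rewrite r2 in nr; lra.
have h2 : 0 < 2 ^+ n.+1 * e < r0 by rewrite nr andbT r2 mulr_gt0.
set c := e / (2 ^+ n * e) ^+ 2.
have c0 : 0 <= c by rewrite divr_ge0 ?sqr_ge0// ltW.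
apply: (@le_trans _ _ (\int[mu]_y (ballind x (2 ^+ n * e) y * (pk e (x - y) * `|g y - g x|)
    + c * (ballind x (2 ^+ n.+1 * e) y * `|g y - g x|)))).
  apply: le_Rintegral => //; [exact: ib|by apply: intgTD => //; exact: intgTZ|].
  move=> y _; rewrite !ballindE; have p0 := pk_ge0 (x - y) e0.
  case: (ltP `|x - y| (2 ^+ n.+1 * e)) => a1; last first.
    by rewrite !mul0r mulr0 addr0 (mulr_ge0 _ (mulr_ge0 p0 (normr_ge0 _))).
  rewrite !mul1r; case: ltP => a2; first by rewrite mul1r lerDl (mulr_ge0 c0 (normr_ge0 _)).
  rewrite mul0r add0r ler_wpM2r// /c /pk ler_wpM2l ?(ltW e0)//.
  rewrite lef_pV2 ?posrE ?kden_gt0 ?exprn_gt0//.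
  rewrite -[(x - y) ^+ 2]sqr_norm ler_wpDr ?sqr_ge0//.
  by rewrite lerXn2r ?nnegrE// ltW.
rewrite RintegralD//; [|exact: ib|exact: intgTZ].
rewrite RintegralZl//; last exact: ibo.
apply: (@le_trans _ _ (w * (10 - 8 * 2 ^- n) + c * (2 * (2 ^+ n.+1 * e) * w))).
  by apply: lerD; [exact: IH|rewrite ler_wpM2l// gr].
rewrite le_eqVlt; apply/orP; left; apply/eqP; rewrite /c (exprS 2 n).
move: (2 ^+ n) pw => p pw.
by field; rewrite !gt_eqF.
Qed.

Lemma dyadic_scale e r0 : 0 < e -> e < r0 -> exists n,
  2 ^+ n * e < r0 <= 2 ^+ n.+1 * e.
Proof.
move=> e0 er; have ex : exists n, r0 <= 2 ^+ n * e.
  exists (Num.trunc (r0 / e)).+1; rewrite -ler_pdivrMr//.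
  apply: (le_trans (ltW (truncnS_gt _))); rewrite -natrX ler_nat ltnW// ltn_expl//.
case: (ex_minnP ex) => -[|n] nP nmin.
  by move: nP; rewrite expr0 mul1r leNgt er.
exists n; rewrite nP andbT ltNge; apply/negP => h.
by have := nmin _ h; rewrite ltnn.
Qed.

(** Up to a radius between [s / 2] and [s] the dyadic estimate applies, and [w = r / 20] turns its
    constant 10 into [r / 2]. Beyond, [pk e] is at most [e * c] times [pk 1], so that the rest is of
    order [e]. *)
Lemma poisson_oscillation g x : L2R g -> lebesgue_pt g x ->
  forall r, 0 < r -> exists2 e0, 0 < e0 & forall e, 0 < e < e0 ->
    \int[mu]_y (pk e (x - y) * `|g y - g x|) <= r.
Proof.
move=> Lg lg r r0; have w0 : 0 < r / 20 by rewrite divr_gt0.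
have [s s0 sP] := lebesgue_pt_small Lg lg w0.
pose c := 1 + (s / 2) ^- 2.
have c0 : 0 < c by rewrite addr_gt0// invr_gt0 exprn_gt0// divr_gt0.
have i1 := oscillation_integrable x (ltr01 : 0 < (1:R)) Lg.
pose K := \int[mu]_y (pk 1 (x - y) * `|g y - g x|).
have K0 : 0 <= K.
  by apply: Rintegral_ge0 => y _; exact: (mulr_ge0 (pk_ge0 _ ltr01) (normr_ge0 _)).
pose e1 := r / (2 * (c * K + 1)).
have e10 : 0 < e1 by rewrite divr_gt0// mulr_gt0// ltr_wpDl// mulr_ge0// ltW.
exists (Num.min s e1); first by rewrite lt_min s0.
move=> e /andP[e0]; rewrite lt_min => /andP[es ee1].
have [n /andP[n1 n2]] := dyadic_scale e0 es.
have io := oscillation_integrable x e0 Lg.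
have mio := intgT_measurable io.
have ib : intgT (fun y => ballind x (2 ^+ n * e) y * (pk e (x - y) * `|g y - g x|)).
  apply: (intgT_le _ _ io).
    by apply: measurable_funM; [exact: measurable_ballind|exact: mio].
  move=> y; rewrite ger0_norm; last exact: ballind_pk_ge0.
  exact: ballind_pk_le.
apply: (@le_trans _ _ (\int[mu]_y (ballind x (2 ^+ n * e) y * (pk e (x - y) * `|g y - g x|)
    + (e * c) * (pk 1 (x - y) * `|g y - g x|)))).
  apply: le_Rintegral => //; first by apply: intgTD => //; exact: intgTZ.
  move=> y _; rewrite !ballindE; have p0 := pk_ge0 (x - y) e0.
  have p1 := pk_ge0 (x - y) (ltr01 : 0 < (1:R)).
  case: ltP => a1.
    by rewrite mul1r lerDl (mulr_ge0 (mulr_ge0 (ltW e0) (ltW c0)) (mulr_ge0 p1 (normr_ge0 _))).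
  rewrite mul0r add0r mulrA ler_wpM2r// /pk -mulrA ler_wpM2l ?(ltW e0)//.
  have a2 : s / 2 <= `|x - y| by rewrite exprS in n2; lra.
  have a3 : (s / 2) ^+ 2 <= (x - y) ^+ 2.
    by rewrite -[leRHS]sqr_norm lerXn2r ?nnegrE// divr_ge0 ?ltW.
  have a4 : 0 < (s / 2) ^+ 2 by rewrite exprn_gt0// divr_gt0.
  have a5 := lt_le_trans a4 a3.
  rewrite expr1n mul1r ler_pdivlMr ?ltr_wpDr// -[leLHS]mulrC ler_pdivrMr ?kden_gt0//.
  have -> : c * ((x - y) ^+ 2 + e ^+ 2) =
     (x - y) ^+ 2 + (x - y) ^+ 2 / (s / 2) ^+ 2 + c * e ^+ 2.
    by rewrite /c; field; rewrite gt_eqF.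
  have : 1 <= (x - y) ^+ 2 / (s / 2) ^+ 2 by rewrite ler_pdivlMr// mul1r.
  have : 0 <= c * e ^+ 2 by rewrite mulr_ge0 ?sqr_ge0// ltW.
  lra.
rewrite RintegralD//; last exact: intgTZ.
rewrite RintegralZl// -/K.
have h1 := poisson_dyadic e0 w0 Lg sP n1.
have h2 : r / 20 * (10 - 8 * 2 ^- n) <= r / 2.
  have : 0 <= 2 ^- n :> R by rewrite invr_ge0 exprn_ge0.
  nra.
have h3 : e * c * K <= r / 2.
  have d0 : 0 < 2 * (c * K + 1) by rewrite mulr_gt0// ltr_wpDl// mulr_ge0// ltW.
  have : e * (2 * (c * K + 1)) <= r by rewrite -ler_pdivlMr// ltW.
  lra.
lra.
Qed.

End lebesgue_points.

(** * Truncated singular integrals against conjugate Poisson integrals *)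

Section truncated_kernel.
Context {R : realType}.
Local Notation mu := (@lebesgue_measure R).
Implicit Types (e d x y z w t r : R) (f g h : R -> R).

(** Inversion is the pointwise limit of the continuous functions [qk (1 / (n + 1))], also at 0,
    where [0^-1 = 0]. *)
Lemma measurable_invr : measurable_fun setT (fun t : R => t^-1).
Proof.
apply: (@measurable_fun_cvg _ (measurableTypeR R) R setT (fun n => qk (n.+1%:R^-1 : R))).
  move=> n; apply: continuous_measurable_fun; apply: continuous_qk.
  by rewrite invr_gt0 ltr0Sn.
move=> t _; have [->|t0] := eqVneq t 0.
  by rewrite invr0 /qk; under eq_fun do rewrite mul0r; exact: cvg_cst.
have E : t^-1 = t * (t ^+ 2 + 0 ^+ 2)^-1 by rewrite expr0n addr0; field.
rewrite E; apply: cvgM; first exact: cvg_cst.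
apply: cvgV; first by rewrite expr0n addr0 expf_neq0.
apply: cvgD; first exact: cvg_cst.
rewrite expr2; under eq_fun do rewrite expr2.
by apply: cvgM; exact: cvg_harmonic.
Qed.

Definition tk e t : R := (e < `|t|)%R%:R * t^-1.

Lemma measurable_tk e : measurable_fun setT (tk e).
Proof.
apply: measurable_funM; last exact: measurable_invr.
rewrite (_ : (fun _ => _) = \1_(~` `[- e, e]%classic)); last first.
  apply/funext => t; rewrite indicE; congr (nat_of_bool _)%:R.
  apply/idP/idP => [h|].
    by rewrite inE /= in_itv/= -ler_norml; apply/negP; rewrite -ltNge.
  by rewrite inE /= in_itv/= -ler_norml => /negP; rewrite -ltNge.
by apply: measurable_indic; apply: measurableC; exact: measurable_itv.
Qed.

Lemma tk_le e t : 0 < e -> `|tk e t| <= e^-1.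
Proof.
move=> e0; rewrite /tk normrM normfV; case: ltP => h.
  by rewrite normr1 mul1r lef_pV2 ?posrE// ?ltW// (lt_trans e0).
by rewrite normr0 mul0r invr_ge0 ltW.
Qed.

Definition trunc_hilbert f e x : R :=
  \int[mu]_(y in [set y | e < `|x - y|]) (f y / (x - y)).

Lemma trunc_hilbertE f e x : trunc_hilbert f e x = \int[mu]_y (tk e (x - y) * f y).
Proof.
rewrite /trunc_hilbert Rintegral_mkcond; apply: eq_Rintegral => y _.
rewrite patchE /tk; case: ifPn => [/set_mem/= ->|/negP h]; first by rewrite mul1r mulrC.
case: ltP => [h'|_]; last by rewrite !mul0r.
by exfalso; apply: h; rewrite inE.
Qed.

Lemma tk_integrable e f x : 0 < e -> intgT f -> intgT (fun y => tk e (x - y) * f y).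
Proof.
move=> e0 intf; apply: intgT_le (intgTZ e^-1 (intgT_norm intf)).
  apply: measurable_funM; last exact: intgT_measurable.
  by apply: (measurableT_comp (measurable_tk e)); exact: measurable_reflect.
by move=> y; rewrite normrM ler_wpM2r// tk_le.
Qed.

Lemma tk_sub_qk_le e t : 0 < e -> `|tk e t - qk e t| <= pk e t.
Proof.
move=> e0; have k0 := kden_gt0 t e0; rewrite /tk /qk /pk; case: ltP => h; last first.
  rewrite mul0r sub0r normrN normrM normfV (gtr0_norm k0).
  by rewrite ler_wpM2r ?invr_ge0 ?(ltW k0).
have t0 : t != 0 by rewrite -normr_gt0 (lt_trans e0).
have -> : 1 * t^-1 - t / (t ^+ 2 + e ^+ 2) = e * (e / t) / (t ^+ 2 + e ^+ 2).
  by field; rewrite gt_eqF.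
rewrite !normrM !normfV (gtr0_norm k0) (gtr0_norm e0).
rewrite ler_wpM2r ?invr_ge0 ?(ltW k0)// ler_piMr ?(ltW e0)//.
by rewrite ler_pdivrMr ?(lt_trans e0)// mul1r ltW.
Qed.

Lemma tk_sub_qk_integrable e x : 0 < e ->
  intgT (fun y => tk e (x - y) - qk e (x - y)) /\
  \int[mu]_y (tk e (x - y) - qk e (x - y)) = 0.
Proof.
move=> e0; have [ip _] := pk_reflect_integral x e0.
have i1 : intgT (fun y => tk e (x - y) - qk e (x - y)).
  apply: intgT_le ip; last by move=> y; exact: tk_sub_qk_le.
  apply: measurable_funB.
    by apply: (measurableT_comp (measurable_tk e)); exact: measurable_reflect.
  by apply: measurable_kreflect; exact: continuous_qk.
split=> //; have [i2] := Rintegral_reflect (x + x) i1.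
have -> : \int[mu]_y (tk e (x - (x + x - y)) - qk e (x - (x + x - y))) =
    - \int[mu]_y (tk e (x - y) - qk e (x - y)).
  rewrite -mulN1r -RintegralZl//; apply: eq_Rintegral => y _.
  have -> : x - (x + x - y) = - (x - y) by ring.
  by rewrite qk_odd /tk normrN invrN; ring.
lra.
Qed.

(** [tk e - qk e] is odd, so its integral vanishes and the constant [f x] can be subtracted; it is
    dominated by [pk e]. *)
Lemma trunc_hilbert_near e f x : 0 < e -> intgT f -> L2R f ->
  `|trunc_hilbert f e x - kernel_op (qk e) f x| <=
  \int[mu]_y (pk e (x - y) * `|f y - f x|).
Proof.
move=> e0 intf Lf; have [i1 i10] := tk_sub_qk_integrable x e0.
have it := tk_integrable x e0 intf; have iq := kernel_integrable (good_qk e0) x intf.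
have E : trunc_hilbert f e x - kernel_op (qk e) f x =
    \int[mu]_y ((tk e (x - y) - qk e (x - y)) * (f y - f x)).
  rewrite trunc_hilbertE /kernel_op -RintegralB//.
  rewrite -[LHS]subr0 -(mulr0 (f x)) -i10 -RintegralZl// -RintegralB//; last 2 first.
  - exact: intgTB.
  - exact: intgTZ.
  by apply: eq_Rintegral => y _; ring.
have io := oscillation_integrable x e0 Lf; have [mf _] := Lf.
have le y : `|(tk e (x - y) - qk e (x - y)) * (f y - f x)| <= pk e (x - y) * `|f y - f x|.
  by rewrite normrM ler_wpM2r// tk_sub_qk_le.
have i2 : intgT (fun y => (tk e (x - y) - qk e (x - y)) * (f y - f x)).
  apply: (intgT_le _ le io); apply: measurable_funM; first exact: intgT_measurable i1.
  exact: measurable_funB.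
rewrite E; apply: (le_trans (le_normr_Rintegral _ i2)) => //.
by apply: le_Rintegral => //; exact: intgT_norm.
Qed.

Lemma poisson_near e g x : 0 < e -> L2R g ->
  `|kernel_op (pk e) g x - pi * g x| <= \int[mu]_y (pk e (x - y) * `|g y - g x|).
Proof.
move=> e0 Lg; have [ip pE] := pk_reflect_integral x e0; have [mg _] := Lg.
have Lp : L2R (fun y => pk e (x - y)).
  by have := L2R_pk x e0; under [X in L2R X -> _]eq_fun do rewrite pk_reflectE.
have ig := L2R_mul_integrable Lp Lg.
have E : kernel_op (pk e) g x - pi * g x = \int[mu]_y (pk e (x - y) * (g y - g x)).
  rewrite -pE mulrC /kernel_op -RintegralZl// -RintegralB//; last exact: intgTZ.
  by apply: eq_Rintegral => y _; ring.
have io := oscillation_integrable x e0 Lg.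
have le y : `|pk e (x - y) * (g y - g x)| <= pk e (x - y) * `|g y - g x|.
  by rewrite (normrM (pk e _)) (ger0_norm (pk_ge0 _ e0)).
have i2 : intgT (fun y => pk e (x - y) * (g y - g x)).
  apply: (intgT_le _ le io); apply: measurable_funM; first exact: intgT_measurable ip.
  exact: measurable_funB.
rewrite E; apply: (le_trans (le_normr_Rintegral _ i2)) => //.
by apply: le_Rintegral => //; exact: intgT_norm.
Qed.

Lemma poisson_cvg g x : L2R g -> lebesgue_pt g x ->
  kernel_op (pk e) g x @[e --> 0^'+] --> pi * g x.
Proof.
move=> Lg lg; apply/cvgrPdist_le => r r0.
have [e0 e00 eP] := poisson_oscillation Lg lg r0.
near=> e; have e1 : 0 < e by near: e; exact: nbhs_right_gt.
rewrite distrC; apply: (le_trans (poisson_near x e1 Lg)); apply: eP; rewrite e1/=.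
by near: e; exact: nbhs_right_lt.
Unshelve. all: by end_near. Qed.

Lemma trunc_hilbert_cvg f x (l : R) : L2R f -> intgT f -> lebesgue_pt f x ->
  kernel_op (qk e) f x @[e --> 0^'+] --> l ->
  trunc_hilbert f e x @[e --> 0^'+] --> l.
Proof.
move=> Lf intf lf ql.
have -> : (fun e => trunc_hilbert f e x) = (fun e => kernel_op (qk e) f x +
    (trunc_hilbert f e x - kernel_op (qk e) f x)).
  by apply/funext => e; rewrite addrC subrK.
have -> : nbhs l = nbhs (l + 0) by rewrite addr0.
apply: cvgD => //; apply/cvgrPdist_le => r r0.
have [e0 e00 eP] := poisson_oscillation Lf lf r0.
near=> e; have e1 : 0 < e by near: e; exact: nbhs_right_gt.
rewrite sub0r normrN; apply: (le_trans (trunc_hilbert_near x e1 intf Lf)); apply: eP.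
by rewrite e1/=; near: e; exact: nbhs_right_lt.
Unshelve. all: by end_near. Qed.

End truncated_kernel.

(** * The Hilbert transformation as a strong limit and as a principal value *)

Section hilbert_transform_exists.
Context {R : realType}.
Local Notation mu := (@lebesgue_measure R).
Implicit Types (e d x y z w t r : R) (f g h v : R -> R).

Local Notation P e := (kernel_op (pk e)).
Local Notation Q e := (kernel_op (qk e)).
Local Notation H := (@prehilbertL R).
Local Notation hn := (hnorm (@ipL R)).

Definition eps n : R := n.+1%:R^-1.

Lemma eps_gt0 n : 0 < eps n.
Proof. by rewrite invr_gt0 ltr0Sn. Qed.

Lemma eps_lt r : 0 < r -> exists N, forall n, (N <= n)%N -> eps n < r.
Proof.
move=> r0; exists (Num.trunc r^-1) => n Nn.
rewrite -[ltRHS]invrK ltf_pV2 ?posrE ?invr_gt0 ?ltr0Sn//.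
by apply: (lt_le_trans (truncnS_gt _)); rewrite ler_nat ltnS.
Qed.

Lemma cvg_right_seq (F : R -> R) (l : R) (phi : nat -> nat) :
  (forall k, (k <= phi k)%N) ->
  F e @[e --> 0^'+] --> l -> F (eps (phi k)) @[k --> \oo] --> l.
Proof.
move=> phik /cvgrPdist_le Fl; apply/cvgrPdist_le => r r0.
have [e0 /= e00 eP] := Fl _ r0; have [N NP] := eps_lt e00.
near=> k; apply: eP; last exact: eps_gt0.
rewrite /= distrC subr0 gtr0_norm ?eps_gt0//; apply: NP.
by apply: leq_trans (phik k); near: k; exact: nbhs_infty_ge.
Unshelve. all: by end_near. Qed.

(** If [|P f - pi f| > r] along a sequence, the parallelogram law and [poisson_bound] give
    [|P f + pi f|^2 <= 4 pi^2 |f|^2 - r^2]; but [P f + pi f] tends to [2 pi f] almost everywhere,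
    against Fatou's lemma. *)
Lemma poisson_L2_cvg f : L2R f -> intgT f -> forall r, 0 < r ->
  exists N, forall n, (N <= n)%N -> hn (P (eps n) f - pi *: f) <= r.
Proof.
move=> Lf intf r r0; apply: contrapT => nex.
have Lpf := L2R_scale pi Lf.
have LP n : L2R (P (eps n) f) by have [] := poisson_bound (eps_gt0 n) Lf intf.
have ex N : exists n, (N <= n)%N /\ r < hn (P (eps n) f - pi *: f).
  apply: contrapT => nex'; apply: nex; exists N => n Nn.
  by rewrite leNgt; apply/negP => lt; apply: nex'; exists n.
have [phi /all_and2[phik phir]] := choice ex.
pose u k := P (eps (phi k)) f + pi *: f.
have Lu k : L2R (u k) by exact: L2R_add.
pose B := 4 * pi ^+ 2 * ipL f f - r ^+ 2.
have uB k : ipL (u k) (u k) <= B.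
  have := phir k; rewrite -ltr_sqr ?nnegrE ?hnorm_ge0 ?(ltW r0)// (sqr_hnorm H).
  rewrite (ip_sub_sqr H)// /u (ip_add_sqr H)// => h.
  have [_ h2] := poisson_bound (eps_gt0 (phi k)) Lf intf.
  have h3 : ipL (pi *: f) (pi *: f) = pi ^+ 2 * ipL f f.
    by rewrite (ph_scalel H)// (ip_scaler H)// mulrA.
  rewrite h3 in h *; rewrite /B; lra.
have m2f : measurable_fun setT ((2 * pi) *: f) by have [] := L2R_scale (2 * pi) Lf.
have [|_ le] := fatou_L2R Lu m2f _ uB.
  apply: ae_imp (ae_lebesgue_pt Lf) => x lx.
  have -> : ((2 * pi) *: f) x = pi * f x + pi * f x.
    by rewrite -[LHS]/(2 * pi * f x); ring.
  apply: cvgD; last exact: cvg_cst.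
  exact: (cvg_right_seq phik (poisson_cvg Lf lx)).
have L2f := L2R_scale (2 * pi) Lf.
have E : ipL ((2 * pi) *: f) ((2 * pi) *: f) = 4 * pi ^+ 2 * ipL f f.
  by rewrite (ph_scalel H)// (ip_scaler H)//; ring.
have : 4 * pi ^+ 2 * ipL f f <= B by rewrite -E; exact: le.
rewrite /B; have : 0 < r ^+ 2 by rewrite exprn_gt0.
lra.
Qed.

Lemma conjugate_poisson_dist e d f : 0 < e -> 0 < d -> intgT f -> L2R f ->
  hn (Q e f - Q d f) = hn (P e f - P d f).
Proof.
move=> e0 d0 intf Lf.
have LQ e' : 0 < e' -> L2R (Q e' f) by move=> h; exact: L2R_kernel_op (good_qk h) intf.
have LP e' : 0 < e' -> L2R (P e' f) by move=> h; exact: L2R_kernel_op (good_pk h) intf.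
have E : ipL (Q e f - Q d f) (Q e f - Q d f) = ipL (P e f - P d f) (P e f - P d f).
  rewrite (ip_sub_sqr H (LQ _ e0) (LQ _ d0)) (ip_sub_sqr H (LP _ e0) (LP _ d0)).
  by rewrite (conjugate_poisson_isometry e0 e0 intf intf)
    (conjugate_poisson_isometry e0 d0 intf intf) (conjugate_poisson_isometry d0 d0 intf intf).
by rewrite /hnorm E.
Qed.

Lemma qk_lipschitz e d t : 0 < e -> 0 < d -> `|qk (e + d) t - qk e t| <= 2 * d / e ^+ 2.
Proof.
move=> e0 d0; have ed0 : 0 < e + d by rewrite addr_gt0.
have k1 := kden_gt0 t e0; have k2 := kden_gt0 t ed0.
have -> : qk (e + d) t - qk e t = - (qk e t * (d * (2 * e + d) / (t ^+ 2 + (e + d) ^+ 2))).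
  by rewrite /qk; field; rewrite !gt_eqF.
rewrite normrN (normrM (qk e t)).
have -> : 2 * d / e ^+ 2 = e^-1 * (2 * d / e) by field; rewrite gt_eqF.
apply: ler_pM => //; first exact: qk_le.
rewrite ger0_norm; last first.
  by rewrite divr_ge0 ?(ltW k2)// mulr_ge0 ?(ltW d0)// addr_ge0 ?mulr_ge0 ?ltW.
rewrite ler_pdivrMr// mulrAC ler_pdivlMr//.
have := sqr_ge0 t; have : 0 <= d * (d * e) by rewrite !mulr_ge0// ltW.
have : 0 <= d * (d * d) by rewrite !mulr_ge0// ltW.
have : 0 <= d * e * e by rewrite !mulr_ge0// ltW.
have : 0 <= d * t ^+ 2 by rewrite mulr_ge0 ?sqr_ge0// ltW.
nra.
Qed.

Definition hilbert_approx f v := forall r, 0 < r ->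
  exists N, forall n, (N <= n)%N -> hn (Q (eps n) f - v) <= r.

(** By isometry the differences of conjugate Poisson integrals have the norms of the differences of
    Poisson integrals, which converge. A subsequence with errors [2 ^- k] has the geometric
    increments that completeness asks for. *)
Lemma hilbert_approx_exists f : L2R f -> intgT f ->
  exists2 v, L2R v & hilbert_approx f v.
Proof.
move=> Lf intf; have Lpf := L2R_scale pi Lf.
have LQ n : L2R (Q (eps n) f) by exact: L2R_kernel_op (good_qk (eps_gt0 n)) intf.
have LP n : L2R (P (eps n) f) by exact: L2R_kernel_op (good_pk (eps_gt0 n)) intf.
have half0 k : 0 < (2^-1 : R) ^+ k by rewrite exprn_gt0.
have [N NP] := choice (fun k => poisson_L2_cvg Lf intf (half0 k)).
have QQ n m a b : hn (P (eps n) f - pi *: f) <= a -> hn (P (eps m) f - pi *: f) <= b ->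
    hn (Q (eps n) f - Q (eps m) f) <= a + b.
  move=> na mb; rewrite conjugate_poisson_dist ?eps_gt0//.
  apply: (le_trans (hnorm_sub_triangle H (LP n) (LP m) Lpf)); apply: lerD => //.
  by rewrite (hnorm_subC H).
pose phi k := maxn k (N k).
have Nphi k : (N k <= phi k)%N by rewrite leq_maxr.
have [||n|v Lv uv] := @hcompleteL R (fun k => Q (eps (phi k)) f) 2 2^-1.
- by apply/andP; split; lra.
- by move=> k; exact: LQ.
- apply: le_trans (QQ _ _ _ _ (NP _ _ (Nphi n.+1)) (NP _ _ (Nphi n))) _.
  by have := half0 n; rewrite exprS; lra.
exists v; first exact: Lv.
move=> r r0; have r4 : 0 < r / 4 by rewrite divr_gt0.
have [K1 K1P] := uv _ (divr_gt0 r0 (ltr0n _ 2)).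
have [K2 K2P] : exists K, forall k, (K <= k)%N -> (2^-1 : R) ^+ k <= r / 4.
  have : (2^-1 : R) ^+ n @[n --> \oo] --> 0 by apply: cvg_expr; rewrite gtr0_norm; lra.
  move=> /cvgrPdist_le/(_ _ r4)[K _ KP]; exists K => k Kk.
  by have := KP k Kk; rewrite sub0r normrN gtr0_norm.
pose k := maxn K1 K2; exists (N k) => n Nn.
apply: (le_trans (hnorm_sub_triangle H (LQ n) Lv (LQ (phi k)))).
have h1 := QQ _ _ _ _ (NP _ _ Nn) (NP _ _ (Nphi k)).
have h2 := K1P k (leq_maxl _ _); have h3 := K2P k (leq_maxr _ _); lra.
Qed.

(** The limit [d -> 0] in [poisson_conjugate_poisson]. It identifies the harmonic extension of [v],
    from which pointwise values of the strong limit [v] can be recovered. *)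
Lemma hilbert_approx_poisson f v e x : L2R f -> intgT f -> L2R v ->
  hilbert_approx f v -> 0 < e -> P e v x = pi * Q e f x.
Proof.
move=> Lf intf Lv fv e0; have iaf := intgT_norm intf.
have Lp : L2R (fun y => pk e (x - y)).
  by have := L2R_pk x e0; under [X in L2R X -> _]eq_fun do rewrite pk_reflectE.
set F1 := \int[mu]_y `|f y|; have F10 : 0 <= F1 by exact: Rintegral_ge0.
set A := hn (fun y => pk e (x - y)).
pose c := A + pi * (2 / e ^+ 2 * F1) + 1.
have c0 : 0 < c.
  rewrite ltr_wpDl// addr_ge0 ?hnorm_ge0// mulr_ge0 ?pi_ge0// mulr_ge0//.
  by rewrite divr_ge0// sqr_ge0.
apply/eqP; rewrite -subr_eq0 -normr_le0; apply/ler_addgt0Pr => r r0; rewrite add0r.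
have rc : 0 < r / c by rewrite divr_gt0.
have [N1 N1P] := fv _ rc; have [N2 N2P] := eps_lt rc.
pose n := maxn N1 N2; have d0 := eps_gt0 n; have ed0 := addr_gt0 e0 d0.
have LQ : L2R (Q (eps n) f) by exact: L2R_kernel_op (good_qk d0) intf.
have h1 : `|P e v x - pi * Q (e + eps n) f x| <= A * (r / c).
  rewrite (addrC e) -poisson_conjugate_poisson//.
  have -> : P e v x - P e (Q (eps n) f) x = ipL (fun y => pk e (x - y)) (v - Q (eps n) f).
    by rewrite (ip_subr H).
  apply: (le_trans (cauchy_schwarz H Lp (ph_sub H Lv LQ))).
  rewrite ler_wpM2l ?hnorm_ge0// (hnorm_subC H)//; apply: N1P; exact: leq_maxl.
have h2 : `|Q (e + eps n) f x - Q e f x| <= 2 / e ^+ 2 * F1 * (r / c).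
  have i1 := kernel_integrable (good_qk ed0) x intf.
  have i2 := kernel_integrable (good_qk e0) x intf.
  rewrite /kernel_op -RintegralB//; have i3 := intgTB i1 i2.
  apply: (le_trans (le_normr_Rintegral _ i3)) => //.
  apply: (@le_trans _ _ (\int[mu]_y (2 * eps n / e ^+ 2 * `|f y|))).
    apply: le_Rintegral => //; [exact: intgT_norm|exact: intgTZ|].
    by move=> y _; rewrite -mulrBl normrM ler_wpM2r// qk_lipschitz.
  rewrite RintegralZl// -/F1.
  have -> : 2 * eps n / e ^+ 2 * F1 = 2 / e ^+ 2 * F1 * eps n by ring.
  apply: ler_wpM2l; first by rewrite mulr_ge0// divr_ge0// sqr_ge0.
  by apply/ltW/N2P; exact: leq_maxr.
have -> : P e v x - pi * Q e f x = (P e v x - pi * Q (e + eps n) f x)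
    + pi * (Q (e + eps n) f x - Q e f x) by ring.
apply: (le_trans (ler_normD _ _)); rewrite normrM (ger0_norm (pi_ge0 R)).
have h3 := ler_wpM2l (pi_ge0 R) h2.
apply: (le_trans (lerD h1 h3)).
have -> : A * (r / c) + pi * (2 / e ^+ 2 * F1 * (r / c)) = (c - 1) * (r / c).
  by rewrite /c; ring.
by rewrite mulrBl mul1r mulrC divfK ?gt_eqF// gerDl oppr_le0 ltW.
Qed.

(** At common Lebesgue points [P e v] tends to [pi v] and equals [pi] times [Q e f], while the
    truncated integral differs from [Q e f] by a vanishing oscillation of [f]. *)
Lemma hilbert_approx_trunc f v : L2R f -> intgT f -> L2R v -> hilbert_approx f v ->
  {ae mu, forall x, trunc_hilbert f e x @[e --> 0^'+] --> v x}.
Proof.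
move=> Lf intf Lv fv.
apply: ae_imp2 (ae_lebesgue_pt Lf) (ae_lebesgue_pt Lv) => x lf lv.
apply: trunc_hilbert_cvg => //.
have pi0 : pi != 0 :> R by rewrite gt_eqF// pi_gt0.
have -> : v x = pi^-1 * (pi * v x) by rewrite mulKf.
have h := poisson_cvg Lv lv.
have : pi^-1 * P e v x @[e --> 0^'+] --> pi^-1 * (pi * v x).
  by apply: cvgM => //; exact: cvg_cst.
apply: cvg_trans; apply: near_eq_cvg; near=> e.
have e0 : 0 < e by near: e; exact: nbhs_right_gt.
by rewrite (hilbert_approx_poisson x Lf intf Lv fv e0) mulKf.
Unshelve. all: by end_near. Qed.

Lemma hilbert_approx_norm f v : L2R f -> intgT f -> L2R v -> hilbert_approx f v ->
  hn v = pi * hn f.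
Proof.
move=> Lf intf Lv fv; have Lpf := L2R_scale pi Lf.
have -> : pi * hn f = hn (pi *: f) by rewrite (hnorm_scale H)// ger0_norm ?pi_ge0.
apply/eqP; rewrite -subr_eq0 -normr_le0; apply/ler_addgt0Pr => r r0; rewrite add0r.
have r20 : 0 < r / 2 by rewrite divr_gt0.
have [N1 N1P] := fv _ r20; have [N2 N2P] := poisson_L2_cvg Lf intf r20.
pose n := maxn N1 N2; have d0 := eps_gt0 n.
have LQ : L2R (Q (eps n) f) by exact: L2R_kernel_op (good_qk d0) intf.
have LP : L2R (P (eps n) f) by exact: L2R_kernel_op (good_pk d0) intf.
have E : hn (Q (eps n) f) = hn (P (eps n) f).
  by rewrite /hnorm conjugate_poisson_isometry.
have h1 := le_trans (hnorm_near H LQ Lv) (N1P n (leq_maxl _ _)).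
have h2 := le_trans (hnorm_near H LP Lpf) (N2P n (leq_maxr _ _)).
rewrite E in h1; rewrite [leRHS](splitr r).
apply: (le_trans (ler_distD (hn (P (eps n) f)) _ _)).
by rewrite distrC in h1; exact (lerD h1 h2).
Qed.

Lemma hilbert_approx_skew f v g (u : R -> R) : L2R f -> intgT f -> L2R v -> hilbert_approx f v ->
  L2R g -> intgT g -> L2R u -> hilbert_approx g u -> ipL v g = - ipL f u.
Proof.
move=> Lf intf Lv fv Lg intg Lu gu.
pose c := hn f + hn g + 1.
have c0 : 0 < c by rewrite ltr_wpDl// addr_ge0 ?hnorm_ge0.
apply/eqP; rewrite -subr_eq0 opprK -normr_le0; apply/ler_addgt0Pr => r r0; rewrite add0r.
have rc : 0 < r / c by rewrite divr_gt0.
have [N1 N1P] := fv _ rc; have [N2 N2P] := gu _ rc.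
pose n := maxn N1 N2; have d0 := eps_gt0 n.
have LQf : L2R (Q (eps n) f) by exact: L2R_kernel_op (good_qk d0) intf.
have LQg : L2R (Q (eps n) g) by exact: L2R_kernel_op (good_qk d0) intg.
have sk := conjugate_poisson_skew d0 Lf intf Lg intg.
have -> : ipL v g + ipL f u = - ipL (Q (eps n) f - v) g - ipL f (Q (eps n) g - u).
  by rewrite (ip_subl H)// (ip_subr H)// sk; ring.
apply: (le_trans (ler_normB _ _)); rewrite normrN.
have h1 := cauchy_schwarz H (ph_sub H LQf Lv) Lg.
have h2 := cauchy_schwarz H Lf (ph_sub H LQg Lu).
have h3 := ler_wpM2r (hnorm_ge0 ipL g) (N1P n (leq_maxl _ _)).
have h4 := ler_wpM2l (hnorm_ge0 ipL f) (N2P n (leq_maxr _ _)).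
apply: (le_trans (lerD (le_trans h1 h3) (le_trans h2 h4))).
have -> : r / c * hn g + hn f * (r / c) = (c - 1) * (r / c) by rewrite /c; ring.
by rewrite mulrBl mul1r mulrC divfK ?gt_eqF// gerDl oppr_le0 ltW.
Qed.

End hilbert_transform_exists.

(** * Carleman's kernel *)

Section hyperbolic_kernel.
Context {R : realType}.
Local Notation mu := (@lebesgue_measure R).
Implicit Types (x y z v t r xi al : R).

(* [hk v = 1 / (2 cosh (v / 2))], the Carleman kernel in logarithmic coordinates. *)
Definition hk v : R := expR (v / 2) / (1 + expR v).

Lemma hk_gt0 v : 0 < hk v.
Proof. by rewrite divr_gt0 ?expR_gt0// addr_gt0// expR_gt0. Qed.

Lemma expR_half v : expR (v / 2) ^+ 2 = expR v.
Proof. by rewrite expr2 -expRD; congr expR; field. Qed.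

Lemma hkN v : hk (- v) = hk v.
Proof.
rewrite /hk mulNr !expRN; have := expR_half v; have := expR_gt0 (v / 2).
move: (expR (v / 2)) => e e0 <-.
by field; rewrite !gt_eqF// addr_gt0// exprn_gt0.
Qed.

Lemma hk_le v : hk v <= expR (v / 2).
Proof.
rewrite /hk ler_pdivrMr ?addr_gt0 ?expR_gt0// ler_peMr ?expR_ge0//.
by rewrite lerDl expR_ge0.
Qed.

Definition hkA v : R := 2 * atan (expR (v / 2)).

Lemma is_derive_hkA v : is_derive v (1 : R) hkA (hk v).
Proof.
apply: is_derive_eq; rewrite expR_half /hk /GRing.scale/=; field.
by rewrite gt_eqF// addr_gt0// expR_gt0.
Qed.

Lemma continuous_expR_half : continuous (fun v => expR (v / 2)).
Proof.
move=> v; apply: continuous_comp; last exact: continuous_expR.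
by apply: cvgM; [exact: cvg_id|exact: cvg_cst].
Qed.

Lemma continuous_hk : continuous hk.
Proof.
move=> v; apply: cvgM; first exact: continuous_expR_half.
apply: cvgV; first by rewrite gt_eqF// addr_gt0// expR_gt0.
by apply: cvgD; [exact: cvg_cst|exact: continuous_expR].
Qed.

Lemma hkAN v : hkA (- v) = pi - hkA v.
Proof.
suff : hkA (- v) + hkA v = pi by move=> <-; rewrite addrK.
pose F w := hkA (- w) + hkA w.
have dF w : is_derive w (1 : R) F 0.
  have d1 := is_derive_hkA w; have d2 := is_derive_hkA (- w).
  have d3 : is_derive w (1 : R) (fun z => hkA (- z)) (- hk w).
    have := @is_derive1_comp R hkA (fun z : R => - z) w _ (-1) d2.
    by rewrite hkN mulrN1; apply; apply: is_derive_eq.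
  by apply: is_derive_eq; rewrite addNr.
have -> : hkA (- v) + hkA v = F 0 by exact: (@is_derive_0_is_cst R F v 0 dF).
rewrite /F oppr0 /hkA mul0r expR0 atan1; lra.
Qed.

Lemma FTC_le (f g F G : R -> R) a b : a <= b ->
  (forall x, is_derive x (1 : R) F (f x)) -> (forall x, is_derive x (1 : R) G (g x)) ->
  continuous f -> continuous g -> (forall x, a <= x <= b -> f x <= g x) ->
  F b - F a <= G b - G a.
Proof.
rewrite le_eqVlt => /predU1P[->|ab] dF dG cf cg fg; first by rewrite !subrr.
have -> := esym (FTC_segment ab (fun x _ => dF x) (fun x _ => cf x)).
have -> := esym (FTC_segment ab (fun x _ => dG x) (fun x _ => cg x)).
apply: le_Rintegral; first exact: measurable_itv.
- by apply: continuous_itv_integrable => x _; exact: cf.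
- by apply: continuous_itv_integrable => x _; exact: cg.
- by move=> x; rewrite /= in_itv/=; exact: fg.
Qed.

Lemma is_derive_2expR_half x : is_derive x (1 : R) (fun v => 2 * expR (v / 2)) (expR (x / 2)).
Proof. by apply: is_derive_eq; rewrite /GRing.scale/=; field. Qed.

Lemma cvg_expR_half : expR (- n%:R / 2 : R) @[n --> \oo] --> (0 : R).
Proof.
under eq_fun do rewrite mulNr.
apply: (cvg_comp (fun n : nat => n%:R / 2 : R) (fun v => expR (- v)) _ (@cvgr_expR R)).
apply/cvgryPge => A; near=> n; rewrite ler_pdivlMr//.
by near: n; exact: nbhs_infty_ger.
Unshelve. all: by end_near. Qed.

Lemma hkA_ge0 v : 0 <= hkA v.
Proof. by rewrite mulr_ge0// -[X in X <= _]atan0; apply: le_atan; rewrite expR_ge0. Qed.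

Lemma hkA_cvgN : hkA (- n%:R) @[n --> \oo] --> 0.
Proof.
have -> : (0 : R) = 2 * atan 0 by rewrite atan0 mulr0.
apply: cvgM; first exact: cvg_cst.
by apply: continuous_cvg; [exact: continuous_atan|exact: cvg_expR_half].
Qed.

Lemma hkA_le x : hkA x <= 2 * expR (x / 2).
Proof.
have h n : (- n%:R <= x) -> hkA x - hkA (- n%:R) <= 2 * expR (x / 2).
  move=> nx; apply: (@le_trans _ _ (2 * expR (x / 2) - 2 * expR (- n%:R / 2))).
    apply: (FTC_le nx is_derive_hkA is_derive_2expR_half continuous_hk continuous_expR_half).
    by move=> y _; exact: hk_le.
  by rewrite gerBl mulr_ge0// expR_ge0.
have : (hkA x - hkA (- n%:R)) @[n --> \oo] --> hkA x - 0.
  by apply: cvgB; [exact: cvg_cst|exact: hkA_cvgN].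
rewrite subr0 => /cvgr_to_le; apply; near=> n; apply: h.
by rewrite lerNl; near: n; exact: nbhs_infty_ger.
Unshelve. all: by end_near. Qed.

Lemma hk_integral : intgT hk /\ \int[mu]_x hk x = pi.
Proof.
apply: (@ge0_integral_sym_lim R hk (fun n => hkA n%:R - hkA (- n%:R))).
- exact: continuous_measurable_fun continuous_hk.
- by move=> x; rewrite ltW// hk_gt0.
- by move=> n; exact: sym_itv_integrable continuous_hk.
- by move=> n; exact: FTC_sym_itv is_derive_hkA continuous_hk.
have -> : (pi : R) = pi - 0 - 0 by rewrite !subr0.
apply: cvgB; last exact: hkA_cvgN.
have -> : (fun n => hkA n%:R) = (fun n => pi - hkA (- n%:R)).
  by apply/funext => n; rewrite hkAN opprB addrC subrK.
by apply: cvgB; [exact: cvg_cst|exact: hkA_cvgN].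
Qed.

Definition kap xi al v : R := cos (xi * v + al) * hk v.

Lemma continuous_cos_affine xi al : continuous (fun v => cos (xi * v + al)).
Proof.
move=> v; apply: continuous_comp; last exact: continuous_cos.
by apply: cvgD; [apply: cvgM; [exact: cvg_cst|exact: cvg_id]|exact: cvg_cst].
Qed.

Lemma continuous_kap xi al : continuous (kap xi al).
Proof. by move=> v; apply: cvgM; [exact: continuous_cos_affine|exact: continuous_hk]. Qed.

Lemma kap_le xi al v : `|kap xi al v| <= hk v.
Proof.
by rewrite normrM [X in _ * X]gtr0_norm ?hk_gt0// ler_piMl ?(ltW (hk_gt0 _))// cos_max.
Qed.

Lemma intgT_kap xi al : intgT (kap xi al).
Proof.
apply: intgT_le (kap_le xi al) hk_integral.1.
exact: continuous_measurable_fun (@continuous_kap xi al).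
Qed.

(** The Fourier transform of [hk], in closed form pi / cosh (pi xi). *)
Definition gam xi : R := \int[mu]_v kap xi 0 v.

(** The phase splits the cosine into an even and an odd part, and the odd one integrates to 0
    because [hk] is even. *)
Lemma kap_integral xi al : \int[mu]_v kap xi al v = cos al * gam xi.
Proof.
have sE v : kap xi (- (pi / 2)) v = sin (xi * v) * hk v by rewrite /kap cosBpihalf.
have s0 : \int[mu]_v kap xi (- (pi / 2)) v = 0.
  have [_] := Rintegral_reflect 0 (intgT_kap xi (- (pi / 2))).
  have -> : \int[mu]_v kap xi (- (pi / 2)) (0 - v) = - \int[mu]_v kap xi (- (pi / 2)) v.
    rewrite -[RHS]mulN1r -RintegralZl//; last exact: intgT_kap.
    by apply: eq_Rintegral => v _; rewrite !sE sub0r mulrN sinN hkN mulN1r mulNr.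
  lra.
have -> : cos al * gam xi = cos al * gam xi - sin al * \int[mu]_v kap xi (- (pi / 2)) v.
  by rewrite s0 mulr0 subr0.
rewrite /gam -!RintegralZl//; [|exact: intgT_kap..].
rewrite -RintegralB//; [|exact/intgTZ/intgT_kap..].
by apply: eq_Rintegral => v _; rewrite sE /kap addr0 cosD; ring.
Qed.

Lemma kap_segment_le xi al x y : x < y ->
  `|\int[mu]_(v in `[x, y]) kap xi al v| <= hkA y - hkA x.
Proof.
move=> xy; have <- := FTC_segment xy (fun v _ => is_derive_hkA v) (fun v _ => continuous_hk (x := v)).
have ik : mu.-integrable `[x, y] (EFin \o kap xi al).
  by apply: continuous_itv_integrable => v _; exact: continuous_kap.
apply: (le_trans (le_normr_Rintegral _ ik)); first exact: measurable_itv.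
apply: le_Rintegral; first exact: measurable_itv.
- exact: integrable_norm.
- by apply: continuous_itv_integrable => v _; exact: continuous_hk.
- by move=> v _; exact: kap_le.
Qed.

Lemma kap_tail xi al x y : x < y ->
  `|cos al * gam xi - \int[mu]_(v in `[x, y]) kap xi al v| <=
  2 * expR (x / 2) + 2 * expR (- y / 2).
Proof.
move=> xy; rewrite -kap_integral.
have [ih hE] := hk_integral; have ik := intgT_kap xi al.
set D : set R := `[x, y]%classic.
have mD : measurable D by exact: measurable_itv.
have restr f : intgT f -> intgT (f \_ D).
  move=> intf; apply: intgT_le (intgT_norm intf).
    apply/(measurable_restrictT f) => //.
    by apply: measurable_funTS; exact: intgT_measurable.
  by move=> v; rewrite patchE; case: ifP => // _; rewrite normr0.
have E f : intgT f -> \int[mu]_v f v - \int[mu]_(v in D) f v =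
    \int[mu]_v (f v - (f \_ D) v).
  by move=> intf; rewrite [X in _ - X]Rintegral_mkcond -RintegralB//; exact: restr.
rewrite E//.
have i1 : intgT (fun v => kap xi al v - (kap xi al \_ D) v) by apply: intgTB => //; exact: restr.
have i2 : intgT (fun v => hk v - (hk \_ D) v) by apply: intgTB => //; exact: restr.
apply: (le_trans (le_normr_Rintegral _ i1)) => //.
apply: (@le_trans _ _ (\int[mu]_v (hk v - (hk \_ D) v))).
  apply: le_Rintegral => //; first exact: intgT_norm.
  move=> v _; rewrite !patchE; case: ifP => _; first by rewrite !subrr normr0.
  by rewrite !subr0 kap_le.
rewrite -E// hE (FTC_segment xy (fun v _ => is_derive_hkA v) (fun v _ => continuous_hk (x := v))).
have := hkA_le x; have := hkA_le (- y); rewrite hkAN; lra.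
Qed.

Lemma gam0 : gam 0 = pi.
Proof.
rewrite /gam -hk_integral.2; apply: eq_Rintegral => v _.
by rewrite /kap mul0r addr0 cos0 mul1r.
Qed.

Lemma continuous_gam : continuous gam.
Proof.
move=> xi.
have h := @continuity_under_integral R _ (measurableTypeR R) mu (fun l v => kap l 0 v) setT measurableT
  (xi - 1) (xi + 1).
have : {in `]xi - 1, xi + 1[%classic, continuous gam}.
  apply: (h _ _ hk).
  - by move=> l _; exact: intgT_kap.
  - apply: aeW => v _ l _; apply: cvgM; last exact: cvg_cst.
    have := @continuous_cos_affine v 0 l.
    by under eq_fun do rewrite mulrC.
  - exact: hk_integral.1.
  - by move=> l _; apply: aeW => v _; exact: kap_le.
by apply; rewrite inE/= in_itv/=; apply/andP; split; lra.
Qed.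

Definition hk' v : R := hk v * (1 - expR v) / (1 + expR v) / 2.

Lemma is_derive_hk v : is_derive v (1 : R) hk (hk' v).
Proof.
have p0 : 1 + expR v != 0 by rewrite gt_eqF// addr_gt0// expR_gt0.
apply: is_derive_eq; rewrite /hk' /hk /GRing.scale/= -expR_half.
rewrite -expR_half in p0; move: (expR (v / 2)) p0 => e p0.
by field.
Qed.

Lemma hk'_le v : `|hk' v| <= hk v / 2.
Proof.
have e0 := expR_gt0 v; have p0 : 0 < 1 + expR v by rewrite addr_gt0.
have q1 : `|(1 - expR v) / (1 + expR v)| <= 1.
  rewrite normrM normfV (gtr0_norm p0) ler_pdivrMr// mul1r.
  by rewrite ler_norml; apply/andP; split; lra.
have -> : hk' v = hk v * ((1 - expR v) / (1 + expR v)) * 2^-1 by rewrite /hk'; ring.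
rewrite (normrM (hk v * _)) (normrM (hk v)) (gtr0_norm (hk_gt0 v)) [Num.norm 2^-1]ger0_norm//.
by rewrite ler_wpM2r// ler_piMr// ltW// hk_gt0.
Qed.

Lemma continuous_hk' : continuous hk'.
Proof.
move=> v; apply: cvgM; last exact: cvg_cst.
apply: cvgM; first apply: cvgM; first exact: continuous_hk.
  by apply: cvgB; [exact: cvg_cst|exact: continuous_expR].
apply: cvgV; first by rewrite gt_eqF// addr_gt0// expR_gt0.
by apply: cvgD; [exact: cvg_cst|exact: continuous_expR].
Qed.

(* Riemann-Lebesgue by one integration by parts. *)
Lemma gam_decay xi : 0 < xi -> gam xi <= pi / (2 * xi).
Proof.
move=> xi0; have [ih hE] := hk_integral; have ik := intgT_kap xi 0.
have cs : continuous (fun v => sin (xi * v)).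
  move=> v; apply: continuous_comp; last exact: continuous_sin.
  by apply: cvgM; [exact: cvg_cst|exact: cvg_id].
have cd : continuous (fun v => sin (xi * v) * hk' v).
  by move=> v; apply: cvgM; [exact: cs|exact: continuous_hk'].
have le v : `|sin (xi * v) * hk' v| <= 2^-1 * hk v.
  rewrite normrM; apply: (@le_trans _ _ (1 * `|hk' v|)).
    by rewrite ler_wpM2r// sin_max.
  by rewrite mul1r mulrC; exact: hk'_le.
have id : intgT (fun v => sin (xi * v) * hk' v).
  by apply: (intgT_le _ le (intgTZ _ ih)); exact: continuous_measurable_fun.
have cx : continuous (fun v => xi * kap xi 0 v + sin (xi * v) * hk' v).
  move=> v; apply: cvgD; last exact: cd.
  by apply: cvgM; [exact: cvg_cst|exact: continuous_kap].
have dF v : is_derive v (1 : R) (fun v => sin (xi * v) * hk v)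
    (xi * kap xi 0 v + sin (xi * v) * hk' v).
  have := is_derive_hk v => dh.
  by apply: is_derive_eq; rewrite /kap addr0 /GRing.scale/=; ring.
have E : \int[mu]_v (xi * kap xi 0 v + sin (xi * v) * hk' v) = 0.
  apply: sym_lim_integral; first by apply: intgTD => //; exact: intgTZ.
  split=> //; under eq_fun do rewrite (FTC_sym_itv _ dF cx).
  have hn n : `|sin (xi * n%:R) * hk n%:R - sin (xi * - n%:R) * hk (- n%:R)| <=
      2 * expR (- n%:R / 2).
    rewrite hkN (mulrN xi) sinN.
    have -> : sin (xi * n%:R) * hk n%:R - - sin (xi * n%:R) * hk n%:R =
      2 * (sin (xi * n%:R) * hk n%:R) by ring.
    rewrite (normrM 2) normr_nat ler_wpM2l// (normrM (sin _)); apply: (@le_trans _ _ (1 * `|hk n%:R|)).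
      by rewrite ler_wpM2r// sin_max.
    by rewrite mul1r gtr0_norm ?hk_gt0// -hkN; exact: hk_le.
  apply/cvgrPdist_le => r r0; near=> n.
  rewrite sub0r normrN; apply: (le_trans (hn n)).
  rewrite mulrC -ler_pdivlMr//; near: n.
  have r2 : 0 < r / 2 by rewrite divr_gt0.
  move/cvgrPdist_le : cvg_expR_half => /(_ _ r2); apply: filterS => n.
  by rewrite sub0r normrN ger0_norm// expR_ge0.
move: E; rewrite RintegralD//; last exact: intgTZ.
rewrite RintegralZl// -/(gam xi) => E.
have : `|\int[mu]_v (sin (xi * v) * hk' v)| <= 2^-1 * pi.
  apply: (le_trans (le_normr_Rintegral _ id)) => //.
  rewrite -hE -RintegralZl//; apply: le_Rintegral => //; [exact: intgT_norm|exact: intgTZ].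
rewrite ler_norml => /andP[h _].
rewrite ler_pdivlMr ?mulr_gt0//.
have -> : gam xi * (2 * xi) = 2 * (xi * gam xi) by ring.
by move: E h; move: (xi * gam xi) (Rintegral _ _ _) => u v E h; clear -E h; lra.
Unshelve. all: by end_near. Qed.

Lemma gam_surjective m : 0 < m <= 1 -> exists xi, gam xi = pi * m.
Proof.
move=> /andP[m0 m1]; have pi0 := pi_gt0 R.
(* The point at which the bound of [gam_decay] equals [pi * m]. *)
pose X := (2 * m)^-1; have X0 : 0 < X by rewrite invr_gt0 mulr_gt0.
have gX : gam X <= pi * m.
  apply: (le_trans (gam_decay X0)); rewrite le_eqVlt; apply/orP; left; apply/eqP.
  by rewrite /X; field; rewrite gt_eqF.
have g0 : pi * m <= gam 0 by rewrite gam0 ler_piMr// ltW.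
have cg : {within `[0, X], continuous gam}.
  exact: continuous_subspaceT continuous_gam.
have [|xi _ <-] := IVT (ltW X0) cg (v := pi * m); last by exists xi.
by rewrite ge_min le_max gX g0 orbT.
Qed.

End hyperbolic_kernel.

(** * Truncated eigenfunctions of Carleman's operator *)

Section carleman_estimate.
Context {R : realType}.
Local Notation mu := (@lebesgue_measure R).
Implicit Types (s t x y xi th e c : R).

(* The real part of [e ^ (- i th) s ^ (- 1 / 2 + i xi)], a generalized eigenfunction
   of Carleman's operator [f |-> int f(s) / (s + t) ds], with eigenvalue [gam xi]. *)
Definition phi xi th s : R := expR (- ln s / 2) * cos (xi * ln s - th).

Lemma expR_half_ln s : 0 < s -> expR (ln s / 2) ^+ 2 = s.
Proof. by move=> s0; rewrite expR_half lnK ?posrE. Qed.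

Lemma is_derive_ln_shift s t (K k : R -> R) : 0 < s ->
  is_derive (ln s - t) (1 : R) K (k (ln s - t)) ->
  is_derive s (1 : R) (fun s => K (ln s - t)) (s^-1 * k (ln s - t)).
Proof.
move=> s0 dK; have dl := is_derive1_ln s0.
have d2 : is_derive s (1 : R) (fun s => ln s - t) s^-1.
  by apply: is_derive_eq; rewrite subr0.
by have := @is_derive1_comp R K (fun s => ln s - t) s _ _ dK; rewrite mulrC; apply.
Qed.

Lemma continuous_phi xi th s : 0 < s -> {for s, continuous (phi xi th)}.
Proof.
move=> s0; have cl : {for s, continuous (@ln R)} by exact: continuous_ln.
apply: cvgM; (apply: continuous_comp; last by [exact: continuous_expR|exact: continuous_cos]).
  by apply: cvgM; [apply: cvgN|exact: cvg_cst].
by apply: cvgB; [apply: cvgM => //; exact: cvg_cst|exact: cvg_cst].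
Qed.

Lemma continuous_phi_div xi th s t : 0 < s -> s + t != 0 ->
  {for s, continuous (fun s => phi xi th s / (s + t))}.
Proof.
move=> s0 st; apply: cvgM; first exact: continuous_phi.
by apply: cvgV => //; apply: cvgD; [exact: cvg_id|exact: cvg_cst].
Qed.

Lemma phi_le xi th s : `|phi xi th s| <= expR (- ln s / 2).
Proof.
by rewrite normrM (gtr0_norm (expR_gt0 _)) ler_piMr ?expR_ge0// cos_max.
Qed.

(** The substitution [v = ln s - ln t], carried out on antiderivatives; the factor [t ^ (i xi)] goes
    into the phase. *)
Lemma carleman_formula xi th e c t : 0 < e -> e < c -> 0 < t ->
  \int[mu]_(s in `[e, c]) (phi xi th s / (s + t)) =
  expR (- ln t / 2) *
  \int[mu]_(v in `[ln e - ln t, ln c - ln t]) kap xi (xi * ln t - th) v.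
Proof.
move=> e0 ec t0; set al := xi * ln t - th; have c0 := lt_trans e0 ec.
have lec : ln e - ln t < ln c - ln t by rewrite ltrD2r ltr_ln ?posrE.
(* The base point lies strictly to the left, so that [K] has a two-sided derivative at the lower end
   as well. *)
pose x0 := ln e - ln t - 1.
pose K x := \int[mu]_(v in `[x0, x]) kap xi al v.
have dK x : x0 < x -> is_derive x (1 : R) K (kap xi al x).
  move=> xx; have ik : mu.-integrable `[x0, x + 1] (EFin \o kap xi al).
    by apply: continuous_itv_integrable => v _; exact: continuous_kap.
  have x1 : x < x + 1 by rewrite ltrDl.
  have [|d E] := continuous_FTC1_closed x1 ik xx; first exact: continuous_kap.
  by apply: DeriveDef; [exact: d|rewrite -derive1E E].
have -> : \int[mu]_(v in `[ln e - ln t, ln c - ln t]) kap xi al v =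
    K (ln c - ln t) - K (ln e - ln t).
  apply: FTC_segment => // x /andP[h _]; last exact: continuous_kap.
  by apply: dK; rewrite /x0; lra.
pose M s := expR (- ln t / 2) * K (ln s - ln t).
have -> : expR (- ln t / 2) * (K (ln c - ln t) - K (ln e - ln t)) = M c - M e.
  by rewrite mulrBr.
apply: (FTC_segment ec) => s /andP[es sc]; have s0 := lt_le_trans e0 es; last first.
  by apply: continuous_phi_div => //; rewrite gt_eqF// addr_gt0.
have dKs : is_derive (ln s - ln t) (1 : R) K (kap xi al (ln s - ln t)).
  by apply: dK; have := es; rewrite -ler_ln ?posrE// /x0; lra.
have dM := is_derive_ln_shift s0 dKs.
apply: is_derive_eq; rewrite /GRing.scale/= /phi /kap /hk.
have -> : xi * (ln s - ln t) + al = xi * ln s - th by rewrite /al; ring.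
rewrite !mulNr mulrBl !expRD !expRN lnK ?posrE// lnK ?posrE//.
have := expR_half_ln s0; have := expR_half_ln t0.
have := expR_gt0 (ln s / 2); have := expR_gt0 (ln t / 2).
move: (expR (ln s / 2)) (expR (ln t / 2)) (cos _) => u v C v0 u0 vt us.
rewrite -us -vt; field.
by rewrite !gt_eqF ?addr_gt0 ?exprn_gt0.
Qed.

Definition phi_cut xi th e c s : R := if e <= s <= c then phi xi th s else 0.

Definition carleman xi th e c t : R := \int[mu]_(s in `[e, c]) (phi xi th s / (s + t)).

(** On [e, c] the error consists of two tails of [hk], of size [sqrt (e / t) + sqrt (t / c)] before
    the factor [t ^ (- 1 / 2)]; off [e, c] it is the integral itself. Poisson kernels serve as
    majorants because their mass is pi for all [e] and [c], so that the error stays bounded in L^2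
    as [e] tends to 0. *)
Lemma carleman_error xi th e c t : 0 < e -> e < c -> 0 < t ->
  (carleman xi th e c t - gam xi * phi_cut xi th e c t) ^+ 2 <=
  16 * (pk c t + pk e t).
Proof.
move=> e0 ec t0; have c0 := lt_trans e0 ec.
have lec : ln e - ln t < ln c - ln t by rewrite ltrD2r ltr_ln ?posrE.
rewrite /carleman carleman_formula//; set al := xi * ln t - th.
set I := \int[mu]_(v in _) _.
have ee := expR_half_ln e0; have cc := expR_half_ln c0; have tt := expR_half_ln t0.
set se := expR (ln e / 2) in ee; set sc := expR (ln c / 2) in cc.
set st := expR (ln t / 2) in tt.
have se0 : 0 < se := expR_gt0 _; have sc0 : 0 < sc := expR_gt0 _.
have st0 : 0 < st := expR_gt0 _.
have tE : expR (- ln t / 2) = st^-1 by rewrite mulNr expRN.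
rewrite tE.
have ke := kden_gt0 t e0; have kc := kden_gt0 t c0.
have pe0 := pk_ge0 t e0; have pc0 := pk_ge0 t c0.
(* [I1] is the tail of [hk] on the right, of use for [t < e]; [I2] is the tail on the left, of use
   for [t > c]. *)
have I1 : `|I| <= 2 * (st / se).
  apply: (le_trans (kap_segment_le xi al lec)).
  have h1 := hkA_le (- (ln e - ln t)); have h2 := hkA_le (ln c - ln t).
  have h3 := hkA_ge0 (- (ln c - ln t)).
  move: h1 h3; rewrite !hkAN => h1 h3.
  have -> : st / se = expR (- (ln e - ln t) / 2).
    by rewrite opprB mulrBl expRD expRN.
  lra.
have I2 : `|I| <= 2 * (sc / st).
  apply: (le_trans (kap_segment_le xi al lec)).
  have h1 := hkA_le (ln c - ln t); have h2 := hkA_ge0 (ln e - ln t).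
  have -> : sc / st = expR ((ln c - ln t) / 2) by rewrite mulrBl expRD expRN.
  lra.
rewrite /phi_cut; case: ifPn => [/andP[et tc]|].
  have -> : st^-1 * I - gam xi * phi xi th t = - (st^-1 * (cos al * gam xi - I)).
    by rewrite /phi tE -/al; ring.
  rewrite sqrrN exprMn exprVn tt.
  have h := kap_tail xi al lec; rewrite -/I in h.
  have E1 : expR ((ln e - ln t) / 2) = se / st by rewrite mulrBl expRD expRN.
  have E2 : expR (- (ln c - ln t) / 2) = st / sc.
    by rewrite opprB mulrBl expRD expRN.
  rewrite E1 E2 in h.
  have h2 : (cos al * gam xi - I) ^+ 2 <= 8 * (e / t) + 8 * (t / c).
    rewrite -[leLHS]sqr_norm.
    apply: (@le_trans _ _ ((2 * (se / st) + 2 * (st / sc)) ^+ 2)).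
      by rewrite lerXn2r ?nnegrE// addr_ge0// mulr_ge0// divr_ge0// ltW.
    have -> : 8 * (e / t) + 8 * (t / c) = 8 * (se / st) ^+ 2 + 8 * (st / sc) ^+ 2.
      by rewrite !expr_div_n ee tt cc.
    have := sqr_ge0 (se / st - st / sc); nra.
  rewrite mulrC ler_pdivrMr//; apply: (le_trans h2).
  have a1 : e / t <= 2 * (pk e t * t).
    rewrite /pk ler_pdivrMr// -!mulrA.
    have -> : 2 * (e * ((t ^+ 2 + e ^+ 2)^-1 * (t * t))) = e * (2 * t ^+ 2 / (t ^+ 2 + e ^+ 2)).
      by ring.
    rewrite -[leLHS]mulr1 ler_wpM2l ?(ltW e0)// ler_pdivlMr// mul1r.
    have : e ^+ 2 <= t ^+ 2 by rewrite lerXn2r ?nnegrE ?(ltW e0) ?(ltW t0) ?(ltW c0).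
    lra.
  have a2 : t / c <= 2 * (pk c t * t).
    rewrite /pk ler_pdivrMr//.
    have -> : 2 * (c / (t ^+ 2 + c ^+ 2) * t) * c = t * (2 * c ^+ 2 / (t ^+ 2 + c ^+ 2)).
      by ring.
    rewrite -[leLHS]mulr1 ler_wpM2l ?(ltW t0)// ler_pdivlMr// mul1r.
    have : t ^+ 2 <= c ^+ 2 by rewrite lerXn2r ?nnegrE ?(ltW e0) ?(ltW t0) ?(ltW c0).
    lra.
  rewrite -mulrA mulrDl; lra.
rewrite mulr0 subr0 negb_and -!ltNge => /orP[te|ct].
  apply: (@le_trans _ _ (16 * pk e t)); last by lra.
  rewrite -sqr_norm normrM (gtr0_norm (_ : 0 < st^-1)) ?invr_gt0//.
  apply: (@le_trans _ _ ((2 / se) ^+ 2)).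
    rewrite lerXn2r ?nnegrE//; first by rewrite mulr_ge0// invr_ge0 ltW.
      by rewrite divr_ge0// ltW.
    rewrite mulrC ler_pdivrMr//; apply: (le_trans I1).
    by rewrite le_eqVlt; apply/orP; left; apply/eqP; ring.
  rewrite expr_div_n ee /pk ler_pdivrMr//.
  have -> : 16 * (e / (t ^+ 2 + e ^+ 2)) * e = 16 * e ^+ 2 / (t ^+ 2 + e ^+ 2) by ring.
  rewrite ler_pdivlMr//.
  have : t ^+ 2 <= e ^+ 2 by rewrite lerXn2r ?nnegrE ?(ltW e0) ?(ltW t0) ?(ltW te).
  have := sqr_ge0 e; nra.
apply: (@le_trans _ _ (16 * pk c t)); last by lra.
rewrite -sqr_norm normrM (gtr0_norm (_ : 0 < st^-1)) ?invr_gt0//.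
apply: (@le_trans _ _ ((2 * sc / t) ^+ 2)).
  rewrite lerXn2r ?nnegrE//; first by rewrite mulr_ge0// invr_ge0 ltW.
    by rewrite divr_ge0 ?mulr_ge0 ?ltW.
  rewrite mulrC ler_pdivrMr//; apply: (le_trans I2).
  rewrite -tt le_eqVlt; apply/orP; left; apply/eqP; field.
  by rewrite gt_eqF.
rewrite expr_div_n exprMn cc /pk ler_pdivrMr ?exprn_gt0//.
have -> : 16 * (c / (t ^+ 2 + c ^+ 2)) * t ^+ 2 = c * (16 * t ^+ 2 / (t ^+ 2 + c ^+ 2)) by ring.
rewrite mulrC ler_wpM2l ?(ltW c0)// ler_pdivlMr//.
have : c ^+ 2 <= t ^+ 2 by rewrite lerXn2r ?nnegrE ?(ltW c0) ?(ltW t0) ?(ltW ct).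
have := sqr_ge0 t; nra.
Qed.

Lemma phi_abs_integral xi th e c : 0 < e -> e < c ->
  mu.-integrable `[e, c] (EFin \o phi xi th) /\
  \int[mu]_(s in `[e, c]) `|phi xi th s| <= 2 * expR (ln c / 2).
Proof.
move=> e0 ec; have ip : mu.-integrable `[e, c] (EFin \o phi xi th).
  apply: continuous_itv_integrable => s /andP[es _]; apply: continuous_phi.
  exact: lt_le_trans es.
have cE s : e <= s <= c -> {for s, continuous (fun s => expR (- ln s / 2))}.
  move=> /andP[es _]; have s0 := lt_le_trans e0 es.
  apply: continuous_comp; last exact: continuous_expR.
  by apply: cvgM; [apply: cvgN; exact: continuous_ln|exact: cvg_cst].
split=> //.
apply: (@le_trans _ _ (\int[mu]_(s in `[e, c]) expR (- ln s / 2))).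
  apply: le_Rintegral; first exact: measurable_itv.
  - exact: integrable_norm.
  - exact: continuous_itv_integrable.
  - by move=> s _; exact: phi_le.
have dF s : e <= s <= c ->
    is_derive s (1 : R) (fun s => 2 * expR (ln s / 2)) (expR (- ln s / 2)).
  move=> /andP[es _]; have s0 := lt_le_trans e0 es; have dl := is_derive1_ln s0.
  have -> : - ln s / 2 = - (ln s / 2) by ring.
  rewrite expRN; apply: is_derive_eq; rewrite /GRing.scale/=.
  have := expR_half_ln s0; have := expR_gt0 (ln s / 2).
  move: (expR (ln s / 2)) => u u0 us; rewrite -us; field.
  by rewrite gt_eqF.
by rewrite (FTC_segment ec dF cE) gerBl mulr_ge0// expR_ge0.
Qed.

Lemma inv_integral e c : 0 < e -> e < c ->
  mu.-integrable `[e, c] (EFin \o (fun s => s^-1)) /\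
  \int[mu]_(s in `[e, c]) s^-1 = ln c - ln e.
Proof.
move=> e0 ec.
have ci s : e <= s <= c -> {for s, continuous (fun s : R => s^-1)}.
  by move=> /andP[es _]; apply: inv_continuous; rewrite gt_eqF// (lt_le_trans e0).
split; first exact: continuous_itv_integrable.
apply: FTC_segment => // s /andP[es _]; apply: is_derive1_ln; exact: lt_le_trans es.
Qed.

End carleman_estimate.

(** * The finite Hilbert transformation *)

Section interval_space.
Context {R : realType}.
Variables (a b : R).
Local Notation mu := (@lebesgue_measure R).
Implicit Types (f g : R -> R).

Definition cut f x : R := if a < x < b then f x else 0.

(** L^2 of the interval as functions on the line that vanish off it, so that A becomes a compression
    of the transformation of the line. *)
Definition L2ab f := L2R f /\ forall x, ~~ (a < x < b) -> f x = 0.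

Lemma cutE f : cut f = f \_ `]a, b[%classic.
Proof.
apply/funext => x; rewrite /cut patchE; congr (if _ then _ else _).
by apply/idP/idP => [h|]; [rewrite inE /= in_itv|rewrite inE /= in_itv].
Qed.

Lemma measurable_cut f : measurable_fun setT f -> measurable_fun setT (cut f).
Proof.
move=> mf; rewrite cutE; apply/(measurable_restrictT f); first exact: measurable_itv.
exact: measurable_funTS.
Qed.

Lemma cut_le f x : `|cut f x| <= `|f x|.
Proof. by rewrite /cut; case: ifP => // _; rewrite normr0. Qed.

Lemma L2ab_cut f : L2R f -> L2ab (cut f).
Proof.
move=> Lf; have [mf _] := Lf; split; last by move=> x /negbTE h; rewrite /cut h.
exact: L2R_le (measurable_cut mf) (cut_le f) Lf.
Qed.

Lemma ipL_cut f g : L2ab g -> ipL (cut f) g = ipL f g.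
Proof.
move=> [_ g0]; apply: eq_Rintegral => x _; rewrite /cut.
by case: ifPn => // h; rewrite (g0 x h) !mulr0.
Qed.

Lemma prehilbert_ab : prehilbert L2ab (@ipL R).
Proof.
have H := @prehilbertL R; split.
- move=> u v [Lu u0] [Lv v0]; split; first exact: (ph_add H).
  by move=> x h; rewrite -[LHS]/(u x + v x) u0// v0// addr0.
- move=> c u [Lu u0]; split; first exact: (ph_scale H).
  by move=> x h; rewrite -[LHS]/(c * u x) u0// mulr0.
- exact: (ph_sym H).
- by move=> u v w [Lu _] [Lv _] [Lw _]; exact: (ph_addl H).
- by move=> c u w [Lu _] [Lw _]; exact: (ph_scalel H).
- exact: (ph_ge0 H).
Qed.

Lemma hcomplete_ab : hcomplete L2ab (@ipL R).
Proof.
move=> u C q q01 Du uC; have H := @prehilbertL R.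
have Lu n : L2R (u n) by have [] := Du n.
have [v Lv uv] := hcompleteL q01 Lu uC.
exists (cut v); first exact: L2ab_cut.
move=> e e0; have [N NP] := uv e e0; exists N => n Nn.
apply: le_trans (NP n Nn).
have L1 := ph_sub H (Lu n) Lv.
have L2 := ph_sub H (Lu n) (L2ab_cut Lv).1.
rewrite /hnorm ler_sqrt ?(ph_ge0 H)//.
apply: le_Rintegral => //; [exact: L2R_mul_integrable|exact: L2R_mul_integrable|].
move=> x _; rewrite -!expr2 /cut.
rewrite -[(u n - _) x]/(u n x - (if a < x < b then v x else 0)) -[(u n - v) x]/(u n x - v x).
case: ifPn => // h; have [_ /(_ x h) ->] := Du n.
by rewrite subr0 expr0n sqr_ge0.
Qed.

Lemma L2ab_intgT f : L2ab f -> intgT f.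
Proof.
move=> [[mf f2] f0].
have ii : intgT (\1_(`]a, b[%classic) : R -> R) by exact: integrable_indic_itv.
apply: (intgT_le mf _ (intgTD ii f2)) => x.
rewrite indicE; have [h|h] := boolP (a < x < b); last first.
  by rewrite f0// normr0 expr0n addr0.
rewrite mem_set/=; last by rewrite in_itv.
rewrite -[f x ^+ 2]sqr_norm; have := sqr_ge0 (`|f x| - 1); have := normr_ge0 (f x).
rewrite /=; nra.
Qed.

Lemma hnorm_cut_le f : L2R f -> hnorm (@ipL R) (cut f) <= hnorm (@ipL R) f.
Proof.
move=> Lf; have H := @prehilbertL R; have [Lc _] := L2ab_cut Lf.
rewrite /hnorm ler_sqrt ?(ph_ge0 H)//.
apply: le_Rintegral => //; [exact: L2R_mul_integrable|exact: L2R_mul_integrable|].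
move=> x _; rewrite -!expr2 -[leLHS]sqr_norm -[leRHS]sqr_norm.
by rewrite lerXn2r ?nnegrE//; exact: cut_le.
Qed.

End interval_space.

Section polarization.
Context {R : realType} {V W : lmodType R}.
Variables (D : V -> Prop) (ip : V -> V -> R) (D' : W -> Prop) (ip' : W -> W -> R).
Hypotheses (H : prehilbert D ip) (H' : prehilbert D' ip').

Lemma polar_isometry (k : R) u v u' v' : D u -> D v -> D' u' -> D' v' ->
  hnorm ip u = k * hnorm ip' u' -> hnorm ip v = k * hnorm ip' v' ->
  hnorm ip (u + v) = k * hnorm ip' (u' + v') -> ip u v = k ^+ 2 * ip' u' v'.
Proof.
move=> Du Dv Du' Dv' E1 E2 E.
have : ip (u + v) (u + v) = k ^+ 2 * ip' (u' + v') (u' + v').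
  by rewrite -(sqr_hnorm H) E exprMn (sqr_hnorm H').
have F1 : ip u u = k ^+ 2 * ip' u' u' by rewrite -(sqr_hnorm H) E1 exprMn (sqr_hnorm H').
have F2 : ip v v = k ^+ 2 * ip' v' v' by rewrite -(sqr_hnorm H) E2 exprMn (sqr_hnorm H').
rewrite (ip_add_sqr H Du Dv) (ip_add_sqr H' Du' Dv') F1 F2; lra.
Qed.

End polarization.

(** * The Hilbert transformation as an operator, and its compression to ]a, b[ *)

Section hilbert_operator.
Context {R : realType}.
Local Notation mu := (@lebesgue_measure R).
Local Notation H := (@prehilbertL R).
Local Notation hn := (hnorm (@ipL R)).
Implicit Types (f g : R -> R).

(** The premises stand below the existential so that the choice yields a total function, with
    arbitrary values outside its natural domain. *)
Lemma hilb_exists f : exists v, L2R f -> intgT f -> L2R v /\ hilbert_approx f v.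
Proof.
have [[Lf intf]|nf] := pselect (L2R f /\ intgT f); last first.
  by exists 0 => Lf intf; exfalso; apply: nf.
have [v Lv fv] := hilbert_approx_exists Lf intf.
by exists v => _ _; split; [exact: Lv|exact: fv].
Qed.

(* [hilb f] is the principal value integral of [f y / (x - y)] over the line. *)
Definition hilb f : R -> R := sval (cid (hilb_exists f)).

Lemma hilbP f : L2R f -> intgT f -> L2R (hilb f) /\ hilbert_approx f (hilb f).
Proof. exact (svalP (cid (hilb_exists f))). Qed.

Lemma hilb_norm f : L2R f -> intgT f -> hn (hilb f) = pi * hn f.
Proof. by move=> Lf intf; have [L a] := hilbP Lf intf; exact: hilbert_approx_norm. Qed.

Lemma hilb_skew f g : L2R f -> intgT f -> L2R g -> intgT g ->
  ipL (hilb f) g = - ipL f (hilb g).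
Proof.
move=> Lf intf Lg intg; have [L1 a1] := hilbP Lf intf; have [L2 a2] := hilbP Lg intg.
exact: (hilbert_approx_skew Lf intf L1 a1 Lg intg L2 a2).
Qed.

Lemma hilbert_approx_add f g v w : L2R f -> intgT f -> L2R v -> hilbert_approx f v ->
  L2R g -> intgT g -> L2R w -> hilbert_approx g w -> hilbert_approx (f + g) (v + w).
Proof.
move=> Lf intf Lv fv Lg intg Lw gw r r0; have r2 : 0 < r / 2 by rewrite divr_gt0.
have [N1 N1P] := fv _ r2; have [N2 N2P] := gw _ r2.
exists (maxn N1 N2) => n; rewrite geq_max => /andP[n1 n2]; have d0 : 0 < (eps n : R) by exact: eps_gt0.
have L1 := L2R_kernel_op (good_qk d0) intf.
have L2 := L2R_kernel_op (good_qk d0) intg.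
have -> : kernel_op (qk (eps n)) (f + g) - (v + w) =
    (kernel_op (qk (eps n)) f - v) + (kernel_op (qk (eps n)) g - w).
  rewrite addrACA -opprD; congr (_ - _); apply/funext => x.
  rewrite -[RHS]/(kernel_op (qk (eps n)) f x + kernel_op (qk (eps n)) g x).
  rewrite /kernel_op -RintegralD//; [|exact: (kernel_integrable (good_qk d0))..].
  by apply: eq_Rintegral => y _; rewrite -mulrDr.
rewrite [leRHS]splitr.
apply: (le_trans (hnorm_triangle H (ph_sub H L1 Lv) (ph_sub H L2 Lw))).
exact (lerD (N1P n n1) (N2P n n2)).
Qed.

(** Polarization of the norm identity. As [hilb (f + g)] is chosen on its own, the norm for [f + g]
    is taken from [hilb f + hilb g], which is a limit of the same approximations. *)
Lemma hilb_isometry f g : L2R f -> intgT f -> L2R g -> intgT g ->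
  ipL (hilb f) (hilb g) = pi ^+ 2 * ipL f g.
Proof.
move=> Lf intf Lg intg; have [L1 a1] := hilbP Lf intf; have [L2 a2] := hilbP Lg intg.
have Lfg := L2R_add Lf Lg; have intfg : intgT (f + g) by exact: intgTD.
have L12 := L2R_add L1 L2.
have a12 := hilbert_approx_add Lf intf L1 a1 Lg intg L2 a2.
have E := hilbert_approx_norm Lfg intfg L12 a12.
exact (polar_isometry H H L1 L2 Lf Lg (hilb_norm Lf intf) (hilb_norm Lg intg) E).
Qed.

Lemma hilb_trunc f : L2R f -> intgT f ->
  {ae mu, forall x, trunc_hilbert f e x @[e --> 0^'+] --> hilb f x}.
Proof. by move=> Lf intf; have [L1 a1] := hilbP Lf intf; exact: hilbert_approx_trunc. Qed.

(** At a positive distance from the support the truncation is inactive for small [e], and the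
    principal value is an ordinary integral. *)
Lemma hilb_outside f p q : L2R f -> intgT f ->
  (forall y, ~~ (p <= y <= q) -> f y = 0) ->
  {ae mu, forall x, (x < p) || (q < x) -> hilb f x = \int[mu]_y (f y / (x - y))}.
Proof.
move=> Lf intf f0; apply: ae_imp (hilb_trunc Lf intf) => x fx xpq.
pose d := if x < p then p - x else x - q.
have d0 : 0 < d by rewrite /d; case: ifP xpq => /= h; rewrite subr_gt0.
apply: (cvg_unique _ fx); first exact: Rhausdorff.
apply: cvg_near_cst; near=> e.
have ed : e < d by near: e; exact: nbhs_right_lt.
rewrite /trunc_hilbert Rintegral_mkcond; apply: eq_Rintegral => y _.
rewrite patchE; case: ifPn => // /negP h.
rewrite f0 ?mul0r//; apply/negP => /andP[py yq]; apply: h; rewrite inE /=.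
apply: (lt_le_trans ed); rewrite /d; case: ifP xpq => /= xp xq.
  by rewrite distrC ger0_norm; lra.
by rewrite ger0_norm; lra.
Unshelve. all: by end_near. Qed.

Section operator_ab.
Variables (a b : R).
Local Notation L2ab := (L2ab a b).

(* [A = - i Sop] on ]a, b[. *)
Definition Sop f : R -> R := cut a b (pi^-1 *: hilb f).

Lemma L2R_hilb f : L2ab f -> L2R (hilb f).
Proof. by move=> Df; have [] := hilbP Df.1 (L2ab_intgT Df). Qed.

Lemma Sop_dom f : L2ab f -> L2ab (Sop f).
Proof. by move=> Df; exact (L2ab_cut a b (L2R_scale pi^-1 (L2R_hilb Df))). Qed.

Lemma Sop_ip f g : L2ab f -> L2ab g -> ipL (Sop f) g = pi^-1 * ipL (hilb f) g.
Proof.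
move=> Df Dg; apply: etrans (ipL_cut _ Dg) _.
exact (ph_scalel H pi^-1 (L2R_hilb Df) Dg.1).
Qed.

Lemma Sop_skew f g : L2ab f -> L2ab g -> ipL (Sop f) g = - ipL f (Sop g).
Proof.
move=> Df Dg; rewrite (Sop_ip Df Dg) (ph_sym H f (Sop g)) (Sop_ip Dg Df).
rewrite (hilb_skew Df.1 (L2ab_intgT Df) Dg.1 (L2ab_intgT Dg)) (ph_sym H f).
by move: (ipL _ _) => x; exact: mulrN.
Qed.

Lemma Sop_bounded f : L2ab f -> hn (Sop f) <= hn f.
Proof.
move=> Df; have L2 := L2R_scale pi^-1 (L2R_hilb Df).
have E : hn (pi^-1 *: hilb f) = hn f.
  apply: etrans (hnorm_scale H pi^-1 (L2R_hilb Df)) _.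
  rewrite (hilb_norm Df.1 (L2ab_intgT Df)) ger0_norm ?invr_ge0 ?pi_ge0//.
  by rewrite mulKf// gt_eqF// pi_gt0.
rewrite -E; exact: hnorm_cut_le.
Qed.

End operator_ab.

End hilbert_operator.

Section reflection.
Context {R : realType}.
Local Notation mu := (@lebesgue_measure R).
Implicit Types (f : R -> R).

Lemma L2R_reflect c f : L2R f ->
  L2R (fun y => f (c - y)) /\ ipL (fun y => f (c - y)) (fun y => f (c - y)) = ipL f f.
Proof.
move=> [mf f2]; have [i2 E] := Rintegral_reflect c f2.
split; last first.
  rewrite /ipL; under eq_Rintegral do rewrite -expr2.
  by rewrite E; apply: eq_Rintegral => x _; rewrite expr2.
by split => //; apply: (measurableT_comp mf); exact: measurable_reflect.
Qed.

(** A translation is the product of two reflections. *)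
Lemma Rintegral_shift c f : intgT f ->
  intgT (fun y => f (y - c)) /\ \int[mu]_y f (y - c) = \int[mu]_y f y.
Proof.
move=> /(Rintegral_reflect 0)[i1 E1]; have := Rintegral_reflect c i1; rewrite E1.
by have -> : (fun y => f (0 - (c - y))) = (fun y => f (y - c))
  by apply/funext => y; rewrite sub0r opprB.
Qed.

Lemma L2R_shift c f : L2R f ->
  L2R (fun y => f (y - c)) /\ ipL (fun y => f (y - c)) (fun y => f (y - c)) = ipL f f.
Proof.
move=> /(L2R_reflect 0)[i1 E1]; have := L2R_reflect c i1; rewrite E1.
by have -> : (fun y => f (0 - (c - y))) = (fun y => f (y - c))
  by apply/funext => y; rewrite sub0r opprB.
Qed.

Lemma L2R_ae_bound f (a B : R) c e : measurable_fun setT f -> 0 < c -> 0 < e -> 0 <= B ->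
  {ae mu, forall x, f x ^+ 2 <= B * (pk c (x - a) + pk e (x - a))} ->
  L2R f /\ ipL f f <= B * (pi + pi).
Proof.
move=> mf c0 e0 B0 fB; apply: L2R_of_le => //.
have [ic Ec] := pk_shift_integral a c0; have [ie Ee] := pk_shift_integral a e0.
have ip := intgTZ B (intgTD ic ie).
have E : \int[mu]_x (B * (pk c (x - a) + pk e (x - a))) = B * (pi + pi).
  by rewrite RintegralZl//; [rewrite RintegralD// Ec Ee|exact: intgTD].
rewrite -E /Rintegral fineK; last exact: integrable_fin_num.
apply: ae_ge0_le_integral => //.
- by move=> x _; rewrite lee_fin sqr_ge0.
- by apply/measurable_EFinP; exact: measurable_funX.
- move=> x _; rewrite lee_fin; apply: mulr_ge0 => //.
  by apply: addr_ge0; exact: pk_ge0.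
- by apply/measurable_EFinP; exact: intgT_measurable ip.
- by apply: ae_imp fB => x fx _; rewrite lee_fin.
Qed.

End reflection.

(** * Approximate null vectors at an end point *)

Section carleman_cut.
Context {R : realType}.
Local Notation mu := (@lebesgue_measure R).
Variables (xi th e c : R).
Hypotheses (e0 : 0 < e) (ec : e < c).
Local Notation g := (phi_cut xi th e c).

Lemma phi_cutE (k : R -> R) : (fun s => g s * k s) = (fun s => phi xi th s * k s) \_ `[e, c].
Proof.
apply/funext => s; rewrite /phi_cut patchE.
have [h|h] := boolP (e <= s <= c); first by rewrite mem_set//= in_itv/= h.
by rewrite memNset ?mul0r//= in_itv/=; exact/negP.
Qed.

Lemma phi_cut_integral (k : R -> R) : (forall s, e <= s <= c -> {for s, continuous k}) ->
  intgT (fun s => g s * k s) /\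
  \int[mu]_s (g s * k s) = \int[mu]_(s in `[e, c]) (phi xi th s * k s).
Proof.
move=> ck; rewrite phi_cutE; split; last by rewrite [in RHS]Rintegral_mkcond.
rewrite /intgT -restrict_EFin; apply/integrable_restrict => //.
rewrite setTI; apply: continuous_itv_integrable => s se.
by apply: cvgM; [apply: continuous_phi; apply: (lt_le_trans e0); case/andP: se|exact: ck].
Qed.

Lemma phi_cut_intgT : intgT g.
Proof.
have [] := @phi_cut_integral (fun=> 1); first by move=> s _; exact: cvg_cst.
by under eq_fun do rewrite mulr1.
Qed.

Lemma phi_cut_sqr s : g s ^+ 2 = g s * phi xi th s.
Proof. by rewrite /phi_cut; case: ifP => _; rewrite ?expr2 ?mul0r. Qed.

Lemma L2R_phi_cut : L2R g.
Proof.
split; first exact: intgT_measurable phi_cut_intgT.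
under eq_fun do rewrite phi_cut_sqr.
have [] // := @phi_cut_integral (phi xi th).
by move=> s /andP[es _]; apply: continuous_phi; exact: lt_le_trans es.
Qed.

Lemma phi_cut_carleman t : 0 < t ->
  intgT (fun s => g s / (s + t)) /\ \int[mu]_s (g s / (s + t)) = carleman xi th e c t.
Proof.
move=> t0; apply: phi_cut_integral => s /andP[es _].
apply: cvgV; first by rewrite gt_eqF// addr_gt0// (lt_le_trans e0).
by apply: cvgD; [exact: cvg_id|exact: cvg_cst].
Qed.

Lemma phi_cut0 s : ~~ (e <= s <= c) -> g s = 0.
Proof. by rewrite /phi_cut => /negbTE ->. Qed.

Lemma phi_cut_abs : \int[mu]_s `|g s| <= 2 * expR (ln c / 2).
Proof.
have [_] := phi_abs_integral xi th e0 ec; apply: le_trans.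
rewrite [leRHS]Rintegral_mkcond le_eqVlt; apply/orP; left; apply/eqP.
apply: eq_Rintegral => s _; rewrite /phi_cut patchE.
have [h|h] := boolP (e <= s <= c); first by rewrite mem_set//= in_itv/= h.
by rewrite memNset ?normr0//= in_itv/=; exact/negP.
Qed.

End carleman_cut.

(** The two phases complement each other by [cos ^ 2 + sin ^ 2 = 1], which leaves the integral of 1
    / s; their norms cannot both stay bounded as [e] tends to 0. *)
Lemma phi_cut_norms {R : realType} (xi e c : R) : 0 < e -> e < c ->
  ipL (phi_cut xi 0 e c) (phi_cut xi 0 e c) +
  ipL (phi_cut xi (pi / 2) e c) (phi_cut xi (pi / 2) e c) = ln c - ln e.
Proof.
move=> e0 ec; have [_ <-] := inv_integral e0 ec.
have [[m1 i1] [m2 i2]] := (L2R_phi_cut xi 0 c e0, L2R_phi_cut xi (pi / 2) c e0).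
rewrite /ipL; under eq_Rintegral do rewrite -expr2.
under [X in _ + X = _]eq_Rintegral do rewrite -expr2.
rewrite -RintegralD// [in RHS]Rintegral_mkcond; apply: eq_Rintegral => s _.
rewrite patchE /phi_cut; have [h|h] := boolP (e <= s <= c); last first.
  by rewrite memNset ?expr0n ?addr0//= in_itv/=; exact/negP.
rewrite mem_set//= ?in_itv//= /phi !exprMn -mulrDr.
have s0 : 0 < s by apply: (lt_le_trans e0); case/andP: h.
rewrite subr0 cosBpihalf cos2Dsin2 mulr1 mulNr expRN exprVn.
by rewrite expR_half_ln.
Qed.

Lemma ae_neq {R : realType} (a : R) : {ae (@lebesgue_measure R), forall x, x != a}.
Proof.
exists [set a]; split; [exact: measurable_set1|exact: lebesgue_measure_set1|].
by move=> x /= /negP; rewrite negbK => /eqP.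
Qed.

Lemma ipL_cutC {R : realType} (a b : R) (f g : R -> R) :
  ipL (cut a b f) g = ipL f (cut a b g).
Proof.
by apply: eq_Rintegral => x _; rewrite /cut; case: ifP => // _; rewrite mulr0 mul0r.
Qed.

Section carleman_eigenvector.
Context {R : realType}.
Local Notation mu := (@lebesgue_measure R).
Local Notation H := (@prehilbertL R).
Local Notation hn := (hnorm (@ipL R)).
Variables (a b xi th e : R).
(** Half the length of the interval: the support of [bump] then keeps the distance [c] from [b]. *)
Let c := (b - a) / 2.
Hypotheses (ab : a < b) (e0 : 0 < e) (ec : e < c).
Local Notation g := (phi_cut xi th e c).

Let c0 : 0 < c. Proof. exact: lt_trans ec. Qed.
Let bE : b = a + 2 * c. Proof. by rewrite /c; lra. Qed.

(* [bump'] is the reflection of [bump] at the end point [a]. *)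
Definition bump : R -> R := fun y => g (y - a).
Definition bump' : R -> R := fun y => g (a - y).

Lemma bump_dom : L2ab a b bump.
Proof.
split; first by have [] := L2R_shift a (L2R_phi_cut xi th c e0).
move=> x xab; apply: phi_cut0; apply: contra xab => /andP[h1 h2].
by apply/andP; split; move: e0 c0 bE h1 h2; lra.
Qed.

Lemma bump_norm : ipL bump bump = ipL g g.
Proof. by have [] := L2R_shift a (L2R_phi_cut xi th c e0). Qed.

Lemma L2R_bump' : L2R bump'.
Proof. by have [] := L2R_reflect a (L2R_phi_cut xi th c e0). Qed.

Lemma intgT_bump : intgT bump.
Proof. exact: L2ab_intgT bump_dom. Qed.

Lemma intgT_bump' : intgT bump'.
Proof. by have [] := Rintegral_reflect a (phi_cut_intgT xi th c e0). Qed.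

Lemma bump'_eq0 x : a <= x -> bump' x = 0.
Proof.
move=> ax; apply: phi_cut0; apply/negP => /andP[h _]; move: e0 ax h; lra.
Qed.

(** For [x = a - t] and [y = a + s] one has [x - y = - (s + t)]: the kernel across the end point is
    Carleman's. *)
Lemma hilb_bump_left :
  {ae mu, forall x, x < a -> hilb bump x = - carleman xi th e c (a - x)}.
Proof.
have f0 y : ~~ (a <= y <= b) -> bump y = 0.
  move=> h; apply: (bump_dom.2 y); apply: contra h => /andP[h1 h2].
  by rewrite !ltW.
apply: ae_imp (hilb_outside bump_dom.1 intgT_bump f0) => x + xa.
rewrite xa => /(_ isT) ->; have t0 : 0 < a - x by rewrite subr_gt0.
have [ik Ek] := phi_cut_carleman xi th c e0 t0.
have [_ E2] := Rintegral_shift a ik.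
rewrite -Ek -E2 -[RHS]mulN1r -RintegralZl//; last by have [] := Rintegral_shift a ik.
apply: eq_Rintegral => y _; rewrite mulN1r -mulrN -invrN; congr (_ / _); lra.
Qed.

(** Beyond [b] the distance to the support is at least [t / 2], and the L^1 norm of [bump] is at
    most [2 sqrt c]; the square is at most [16 c / t ^ 2], which [c <= t] turns into a multiple of
    [pk c]. *)
Lemma hilb_bump_right : {ae mu, forall x, b <= x -> hilb bump x ^+ 2 <= 32 * pk c (x - a)}.
Proof.
have f0 y : ~~ (a <= y <= a + c) -> bump y = 0.
  move=> h; apply: phi_cut0; apply: contra h => /andP[h1 h2].
  by apply/andP; split; move: e0 h1 h2; lra.
apply: ae_imp (hilb_outside bump_dom.1 intgT_bump f0) => x + bx.
have acx : a + c < x by move: bx c0 bE; lra.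
rewrite acx orbT => /(_ isT) ->; set t := x - a.
have t0 : 2 * c <= t by rewrite /t; move: bx bE; lra.
have tp : 0 < t by move: t0 c0; lra.
have [ia Ea] := Rintegral_shift a (intgT_norm (phi_cut_intgT xi th c e0)).
have mk : measurable_fun setT (fun y => bump y / (x - y)).
  apply: measurable_funM; first exact: intgT_measurable intgT_bump.
  apply: (measurableT_comp (@measurable_invr R)); exact: measurable_reflect.
have le1 y : `|bump y / (x - y)| <= 2 / t * `|bump y|.
  have [h|h] := boolP (a <= y <= a + c); last by rewrite f0// mul0r normr0 mulr0.
  rewrite normrM mulrC ler_wpM2r// normfV ger0_norm; last by move: h acx => /andP[]; lra.
  rewrite -[2]invrK -invfM lef_pV2 ?posrE; last 2 first.
  - by move: h acx => /andP[]; lra.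
  - by rewrite mulr_gt0// invr_gt0.
  by rewrite /t; move: h t0 => /andP[] + +; rewrite /t; lra.
have i2 := intgTZ (2 / t) ia.
have ik : intgT (fun y => bump y / (x - y)) by exact: intgT_le mk le1 i2.
set I := \int[mu]_y _.
have IB : `|I| <= 2 / t * (2 * expR (ln c / 2)).
  apply: (le_trans (le_normr_Rintegral measurableT ik)).
  apply: (@le_trans _ _ (\int[mu]_y (2 / t * `|g (y - a)|))).
    apply: le_Rintegral => //; first exact: intgT_norm.
  rewrite RintegralZl// Ea ler_wpM2l ?divr_ge0 ?(ltW tp)//.
  exact: phi_cut_abs.
have : I ^+ 2 <= (2 / t * (2 * expR (ln c / 2))) ^+ 2.
  by rewrite -[leLHS]sqr_norm lerXn2r ?nnegrE// (le_trans _ IB).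
move=> /le_trans; apply; rewrite !exprMn expR_half_ln// /pk.
have -> : 2 ^+ 2 * t^-1 ^+ 2 * (2 ^+ 2 * c) = 16 * c / t ^+ 2 by field; rewrite gt_eqF.
rewrite mulrA ler_pdivrMr ?exprn_gt0// mulrAC ler_pdivlMr; last first.
  by rewrite ltr_pwDr ?exprn_gt0 ?sqr_ge0// ltW.
have : c ^+ 2 <= t ^+ 2 by rewrite lerXn2r ?nnegrE ?(ltW c0) ?(ltW tp)//; move: t0 c0; lra.
by move: (t ^+ 2) (c ^+ 2) c0 => T C cp CT; nra.
Qed.

Lemma hilb_bump' :
  {ae mu, forall x, a < x -> hilb bump' x = carleman xi th e c (x - a)}.
Proof.
have f0 y : ~~ (a - c <= y <= a) -> bump' y = 0.
  move=> h; apply: phi_cut0; apply: contra h => /andP[h1 h2].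
  by apply/andP; split; move: e0 h1 h2; lra.
apply: ae_imp (hilb_outside L2R_bump' intgT_bump' f0) => x + xa.
rewrite xa orbT => /(_ isT) ->; have t0 : 0 < x - a by rewrite subr_gt0.
have [ik Ek] := phi_cut_carleman xi th c e0 t0.
have [_ E2] := Rintegral_reflect a ik.
rewrite -Ek -E2; apply: eq_Rintegral => y _; congr (_ / _); lra.
Qed.

(* The norm of [bump] grows with [- ln e], so this bound makes it an approximate
   null vector of [m ^ 2 + S ^ 2]. By isometry and skewness, [<S S f, w>] only
   involves [H f] to the left of [a] and to the right of [b]. The latter is
   harmless; the former is [- gam xi f'] up to bounded terms, with [f'] the
   reflection, and for the same reason [H f'] is [gam xi f] inside ]a, b[. *)
Lemma bump_defect (m : R) : gam xi = pi * Num.sqrt (1 - m ^+ 2) -> m ^+ 2 <= 1 ->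
  hn (m ^+ 2 *: bump + Sop a b (Sop a b bump)) <= 3 * Num.sqrt (32 * (pi + pi)) / pi.
Proof.
move=> gm m1; set K := Num.sqrt _; set gamma := gam xi.
have Df := bump_dom; have Lf := Df.1; have Lt := L2R_bump'.
have LF := L2R_hilb Df; have [LFt _] := hilbP Lt intgT_bump'.
pose Fl x : R := if x <= a then hilb bump x else 0.
pose Fr x : R := if b <= x then hilb bump x else 0.
(* [u1] and [u3] are the errors in the two approximate identities, [hilb bump = - gamma bump'] on
   the left of [a] and [hilb bump' = gamma bump] inside. *)
pose u1 : R -> R := Fl + gamma *: bump'.
pose u3 : R -> R := cut a b (hilb bump') - gamma *: bump.
have pk2 x : 0 <= pk c x + pk e x.
  by apply: addr_ge0; apply: pk_ge0.
have K0 : 0 <= 32 * (pi + pi) :> R by rewrite mulr_ge0// addr_ge0// pi_ge0.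
have bound (u : R -> R) : measurable_fun setT u ->
    {ae mu, forall x, u x ^+ 2 <= 32 * (pk c (x - a) + pk e (x - a))} ->
    L2R u /\ hn u <= K.
  move=> mu' uB; have [Lu uK] := L2R_ae_bound mu' c0 e0 (ler0n _ 32) uB.
  by split => //; rewrite /hnorm /K ler_sqrt.
have mF := LF.1; have mb' := Lt.1; have mb := Lf.1.
have LFl : L2R Fl.
  apply: (L2R_le _ _ LF); first by apply: measurable_fun_ifT => //; exact: measurable_fun_ler.
  by move=> x; rewrite /Fl; case: ifP => // _; rewrite normr0.
have [LFr KFr] : L2R Fr /\ hn Fr <= K.
  apply: bound; first by apply: measurable_fun_ifT => //; exact: measurable_fun_ler.
  apply: ae_imp hilb_bump_right => x Fx; rewrite /Fr; case: (leP b x) => [bx|xb]; last first.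
    rewrite expr0n; exact: mulr_ge0.
  apply: (le_trans (Fx bx)); have := pk_ge0 (x - a) e0.
  by move: (pk c _) (pk e _) => P Q; lra.
have [Lu1 Ku1] : L2R u1 /\ hn u1 <= K.
  apply: bound; first by apply: measurable_funD; [exact: LFl.1|exact: measurable_funM].
  apply: (ae_imp2 _ hilb_bump_left (ae_neq a)) => x Fx xa.
  rewrite -[u1 x]/((if x <= a then hilb bump x else 0) + gamma * bump' x).
  rewrite (le_eqVlt x a) (negbTE xa) orFb; case: (ltP x a) => [{}xa|ax]; last first.
    rewrite bump'_eq0// mulr0 addr0 expr0n; exact: mulr_ge0.
  rewrite (Fx xa); have t0 : 0 < a - x by rewrite subr_gt0.
  have := carleman_error xi th e0 ec t0.
  have -> : pk c (a - x) = pk c (x - a) by rewrite -pk_sym opprB.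
  have -> : pk e (a - x) = pk e (x - a) by rewrite -pk_sym opprB.
  rewrite /gamma /bump'; have := pk2 (x - a).
  by move: (pk c _ + _) (carleman _ _ _ _ _) (gam xi) (g _) => P A G U; nra.
have [Lu3 Ku3] : L2R u3 /\ hn u3 <= K.
  apply: bound.
    apply: measurable_funB; last exact: measurable_funM.
    by apply: measurable_cut; exact: LFt.1.
  apply: ae_imp hilb_bump' => x Fx.
  rewrite -[u3 x]/((if a < x < b then hilb bump' x else 0) - gamma * bump x).
  have [/andP[ax xb]|h] := boolP (a < x < b); last first.
    rewrite (Df.2 x h) mulr0 subr0 expr0n; exact: mulr_ge0.
  rewrite (Fx ax); have t0 : 0 < x - a by rewrite subr_gt0.
  have := carleman_error xi th e0 ec t0.
  rewrite /gamma /bump; have := pk2 (x - a).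
  by move: (pk c _ + _) (carleman _ _ _ _ _) (gam xi) (g _) => P A G U; lra.
set w := _ + _.
have DS := Sop_dom Df; have DSS := Sop_dom DS.
have Dw : L2ab a b w := ph_add (prehilbert_ab a b) (ph_scale (prehilbert_ab a b) _ Df) DSS.
have Lw := Dw.1; have iw := L2ab_intgT Dw; have Lh := L2R_hilb Dw.
have Lcut := (L2ab_cut a b LF).1.
have ipF : ipL (hilb bump) (hilb w) = pi ^+ 2 * ipL bump w.
  exact (hilb_isometry Lf intgT_bump Lw iw).
have splitF : hilb bump = cut a b (hilb bump) + (Fl + Fr).
  apply/funext => x.
  rewrite -[RHS]/((if a < x < b then hilb bump x else 0) +
    ((if x <= a then hilb bump x else 0) + (if b <= x then hilb bump x else 0))).
  case: (ltP a x) => /= ax.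
    by case: (ltP x b) => xb; rewrite ?addr0 ?add0r.
  have -> : b <= x = false by apply/negbTE; rewrite -ltNge (le_lt_trans ax ab).
  by rewrite addr0 add0r.
(* Isometry on the line trades the part of [hilb bump] inside ]a, b[, the one that [Sop] keeps, for
   the parts on either side. *)
have E1 : ipL (cut a b (hilb bump)) (hilb w) + (ipL Fl (hilb w) + ipL Fr (hilb w)) =
    pi ^+ 2 * ipL bump w.
  rewrite -ipF; apply/esym; apply: etrans (congr1 (fun v => ipL v (hilb w)) splitF) _.
  apply: etrans (ph_addl H Lcut (L2R_add LFl LFr) Lh) _.
  congr (_ + _); exact (ph_addl H LFl LFr Lh).
have E2 : pi ^+ 2 * ipL (Sop a b (Sop a b bump)) w = - ipL (cut a b (hilb bump)) (hilb w).
  rewrite (Sop_skew DS Dw) (Sop_ip Df (Sop_dom Dw)).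
  have -> : ipL (hilb bump) (Sop a b w) = pi^-1 * ipL (cut a b (hilb bump)) (hilb w).
    rewrite -(ipL_cutC a b); exact (ip_scaler H pi^-1 Lh Lcut).
  have p0 : pi != 0 :> R by rewrite gt_eqF// pi_gt0.
  by move: (ipL _ (hilb w)) => v; move: (pi : R) p0 => P p0; field.
have E3 : ipL Fl (hilb w) = ipL u1 (hilb w) + gamma * ipL (hilb bump') w.
  have -> : ipL u1 (hilb w) = ipL Fl (hilb w) + gamma * ipL bump' (hilb w).
    apply: etrans (ph_addl H LFl (L2R_scale gamma Lt) Lh) _.
    congr (_ + _); exact (ph_scalel H gamma Lt Lh).
  rewrite (hilb_skew Lt intgT_bump' Lw iw).
  by move: (ipL _ _) (ipL _ _) => u v; ring.
have E4 : ipL (hilb bump') w = ipL u3 w + gamma * ipL bump w.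
  have -> : ipL u3 w = ipL (cut a b (hilb bump')) w - gamma * ipL bump w.
    apply: etrans (ip_subl H (L2ab_cut a b LFt).1 (L2R_scale gamma Lf) Lw) _.
    congr (_ - _); exact (ph_scalel H gamma Lf Lw).
  by rewrite (ipL_cut _ Dw) subrK.
have E5 : ipL w w = m ^+ 2 * ipL bump w + ipL (Sop a b (Sop a b bump)) w.
  apply: etrans (ph_addl H (L2R_scale _ Lf) DSS.1 Lw) _.
  congr (_ + _); exact (ph_scalel H _ Lf Lw).
have B1 := cauchy_schwarz H Lu1 Lh; have B2 := cauchy_schwarz H LFr Lh.
have B3 := cauchy_schwarz H Lu3 Lw.
have hK := hilb_norm Lw iw; have sw := sqr_hnorm H w.
have nw0 := hnorm_ge0 (@ipL R) w.
move: B1 B2 B3 E1 E2 E3 E4 E5 sw nw0 hK Ku1 KFr Ku3.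
have g2 : gamma ^+ 2 = pi ^+ 2 * (1 - m ^+ 2).
  by rewrite /gamma gm exprMn sqr_sqrtr// subr_ge0.
have gp : 0 <= gamma <= pi.
  rewrite /gamma gm mulr_ge0 ?pi_ge0 ?sqrtr_ge0//= ler_piMr ?pi_ge0//.
  by rewrite -[leRHS]sqrtr1 ler_sqrt// lerBlDr lerDl sqr_ge0.
have pp : 0 < pi :> R := pi_gt0 R.
have KK0 : 0 <= K by exact: sqrtr_ge0.
move: (hn w) (hn u1) (hn u3) (hn Fr) (hn (hilb w)) (ipL u1 _) (ipL Fr _) (ipL u3 _)
  (ipL (cut _ _ _) _) (ipL Fl _) (ipL bump w) (ipL (Sop a b _) w) (ipL (hilb bump') w)
  (ipL w w) KK0 pp gp g2.
generalize K, gamma, (pi : R); clear => K G P n n1 n3 nr nh A1 A2 A3 C L X Y Z W K0 P0 /andP[G0 GP] G2.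
rewrite !ler_norml => /andP[_ B1] /andP[_ B2] /andP[_ B3] E1 E2 E3 E4 E5 nW n0 nhE k1 kr k3; subst nh.
(* The main terms cancel because [G ^+ 2 = P ^+ 2 * (1 - m ^+ 2)]. Each of the three errors left is
   at most [K * P * n], which accounts for the factor 3. *)
have E : P ^+ 2 * n ^+ 2 = A1 + A2 + G * A3.
  rewrite nW E5 mulrDr E2.
  have -> : C = P ^+ 2 * X - (L + A2) by move: E1; lra.
  rewrite E3 E4; have -> : m ^+ 2 = 1 - G ^+ 2 / P ^+ 2.
    by rewrite G2; field; rewrite gt_eqF.
  by field; rewrite gt_eqF.
have B : P ^+ 2 * n ^+ 2 <= 3 * K * P * n.
  have b1 : A1 <= K * (P * n) by apply: (le_trans B1); rewrite ler_wpM2r// mulr_ge0 ?(ltW P0).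
  have b2 : A2 <= K * (P * n) by apply: (le_trans B2); rewrite ler_wpM2r// mulr_ge0 ?(ltW P0).
  have b3 : G * A3 <= P * (K * n).
    have h : A3 <= K * n by apply: (le_trans B3); rewrite ler_wpM2r.
    apply: (@le_trans _ _ (G * (K * n))); first by rewrite ler_wpM2l.
    by rewrite ler_wpM2r// mulr_ge0.
  by rewrite E; lra.
rewrite ler_pdivlMr//; have [->|nn] := eqVneq n 0; first by rewrite mul0r mulr_ge0.
have np : 0 < n by rewrite lt_neqAle eq_sym nn.
have Pn : 0 < P * n by rewrite mulr_gt0.
by rewrite -(ler_pM2r Pn); move: B; lra.
Qed.

End carleman_eigenvector.

(** * Perturbation of lam, and the points of [-1, 1] *)

Section complex_scaling.
Context (R : realType) (V : lmodType R) (D : V -> Prop) (ip : V -> V -> R).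
Hypothesis H : prehilbert D ip.
Local Notation hn := (hnorm ip).
Local Notation dom2 := (dom2 D).
Local Notation hn2 := (hnorm (ip2 ip)).

(** Multiplication by the complex number [s + i t]. *)
Definition cscale (s t : R) (u : V * V) : V * V :=
  (s *: u.1 - t *: u.2, t *: u.1 + s *: u.2).

Lemma dom_cscale s t u : dom2 u -> dom2 (cscale s t u).
Proof.
move=> [Du1 Du2]; split; [apply: (ph_sub H)|apply: (ph_add H)]; exact: (ph_scale H).
Qed.

Lemma hnorm2_cscale s t u : dom2 u ->
  hn2 (cscale s t u) = Num.sqrt (s ^+ 2 + t ^+ 2) * hn2 u.
Proof.
move=> Du; have [Du1 Du2] := Du; have H2 := prehilbert2 H.
have st0 : 0 <= s ^+ 2 + t ^+ 2 by rewrite addr_ge0// sqr_ge0.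
rewrite /hnorm -sqrtrM//; congr Num.sqrt.
have [D1 D2 D3 D4] := And4 (ph_scale H s Du1) (ph_scale H t Du2) (ph_scale H t Du1) (ph_scale H s Du2).
rewrite /ip2/= (ip_sub_sqr H D1 D2) (ip_add_sqr H D3 D4).
rewrite !(ph_scalel H)// !(ip_scaler H)//; ring.
Qed.

Variable S : V -> V.
Hypothesis DS : forall u, D u -> D (S u).

Lemma lamop_cscale s t m u : lamop S s t u = lamop S m 0 u + cscale (s - m) t u.
Proof.
have key (x A B C : V) : x + B + C = A + C + (x - A + B).
  by rewrite addrACA (addrC A) subrK -addrA (addrC B).
rewrite /lamop /cscale -[RHS]/(_ + _, _ + _) !scalerBl !scale0r subr0 add0r.
congr pair; first exact: key.
by rewrite [_ *: _ + (_ - _)]addrC (addrC (t *: _)); exact: key.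
Qed.

(** This carries approximate eigenvectors from interior points of [-1, 1] to its end points, and
    from the point nearest to [lam] to [lam] itself. *)
Lemma lamop_perturb s t m u : dom2 u ->
  hn2 (lamop S s t u) <= hn2 (lamop S m 0 u) + Num.sqrt ((s - m) ^+ 2 + t ^+ 2) * hn2 u /\
  hn2 (lamop S m 0 u) <= hn2 (lamop S s t u) + Num.sqrt ((s - m) ^+ 2 + t ^+ 2) * hn2 u.
Proof.
move=> Du; have H2 := prehilbert2 H; have E := lamop_cscale s t m u.
have D1 := dom_lamop H DS m 0 Du; have D2 := dom_cscale (s - m) t Du.
have D3 := dom_lamop H DS s t Du.
rewrite -hnorm2_cscale//; split; first by rewrite E; exact: hnorm_triangle H2 _ _ _ _.
have -> : lamop S m 0 u = lamop S s t u + - cscale (s - m) t u by rewrite E addrK.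
rewrite -(hnorm_opp H2 D2); exact (hnorm_triangle H2 D3 (ph_opp H2 D2)).
Qed.

End complex_scaling.

Section spectrum.
Context {R : realType}.
Local Notation H := (@prehilbertL R).
Local Notation hn := (hnorm (@ipL R)).
Local Notation hn2 := (hnorm (ip2 (@ipL R))).
Variables (a b : R).
Hypothesis ab : a < b.

Lemma Sop_not_bounded_below_lt1 m d : m ^+ 2 < 1 -> 0 < d ->
  ~ forall u, dom2 (L2ab a b) u -> d * hn2 u <= hn2 (lamop (Sop a b) m 0 u).
Proof.
move=> m1 d0 bel; have Hab := prehilbert_ab a b.
have sq0 : 0 < 1 - m ^+ 2 by rewrite subr_gt0.
have [xi gxi] : exists xi, gam xi = pi * Num.sqrt (1 - m ^+ 2).
  apply: gam_surjective; rewrite sqrtr_gt0 sq0/=.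
  by rewrite -[leRHS]sqrtr1 ler_sqrt// lerBlDr lerDl sqr_ge0.
pose K : R := 3 * Num.sqrt (32 * (pi + pi)) / pi / d ^+ 2.
pose c := (b - a) / 2; have c0 : 0 < c by rewrite divr_gt0// subr_gt0.
have bnd th e : 0 < e -> e < c -> ipL (phi_cut xi th e c) (phi_cut xi th e c) <= K ^+ 2.
  move=> e0 ec; have Df := bump_dom xi th e0 ec.
  rewrite -(bump_norm a b xi th e0) -(sqr_hnorm H).
  have h := bump_defect th ab e0 ec gxi (ltW m1).
  have h2 := lamop_square_lower_bound Hab (@Sop_dom R a b) (@Sop_skew R a b) (ltW d0) bel Df.
  have h3 := le_trans h2 h.
  have nn := hnorm_ge0 (@ipL R) (bump a b xi th e).
  have : hn (bump a b xi th e) <= K by rewrite /K ler_pdivlMr ?exprn_gt0// mulrC.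
  by move: (hn _) nn K => x x0 K' xK; rewrite lerXn2r// nnegrE (le_trans x0 xK).
(* The two squared norms then add up to [2 * K ^+ 2 + 1], although each is at most [K ^+ 2]. *)
pose e := expR (ln c - (2 * K ^+ 2 + 1)).
have e0 : 0 < e by exact: expR_gt0.
have ec : e < c.
  have lc : expR (ln c) = c by rewrite lnK ?posrE.
  by rewrite -[ltRHS]lc ltr_expR; have := sqr_ge0 K; lra.
have := phi_cut_norms xi e0 ec; rewrite /e expRK -/e.
have := bnd 0 e e0 ec; have := bnd (pi / 2) e e0 ec; lra.
Qed.

Lemma Sop_not_bounded_below m d : -1 <= m <= 1 -> 0 < d ->
  ~ forall u, dom2 (L2ab a b) u -> d * hn2 u <= hn2 (lamop (Sop a b) m 0 u).
Proof.
move=> m1 d0 bel; have Hab := prehilbert_ab a b.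
(* [m * (1 - x)] is interior and at distance at most [d / 2] from [m], so that half of the lower
   bound survives. *)
pose x := Num.min (d / 2) 2^-1; have x0 : 0 < x by rewrite lt_min divr_gt0//= invr_gt0.
have xd : x <= d / 2 by rewrite ge_min lexx.
have xh : x <= 2^-1 by rewrite ge_min lexx orbT.
have m2 : m ^+ 2 <= 1 by rewrite expr2; move: m1 => /andP[]; nra.
apply: (@Sop_not_bounded_below_lt1 (m * (1 - x)) (d / 2)).
- rewrite exprMn (@le_lt_trans _ _ ((1 - x) ^+ 2))//.
    by rewrite -[leRHS]mul1r ler_wpM2r ?sqr_ge0.
  by rewrite expr2; nra.
- by rewrite divr_gt0.
move=> u Du.
have [h _] := lamop_perturb Hab (@Sop_dom R a b) m 0 (m * (1 - x)) Du.
have hb := bel u Du; have nn := hnorm_ge0 (ip2 (@ipL R)) u.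
have E : Num.sqrt ((m - m * (1 - x)) ^+ 2 + 0 ^+ 2) <= d / 2.
  rewrite expr0n addr0 sqrtr_sqr; have -> : m - m * (1 - x) = m * x by ring.
  rewrite normrM (gtr0_norm x0) (le_trans _ xd)// ler_piMl ?(ltW x0)//.
  by rewrite ler_norml.
move: (Num.sqrt _) (hn2 _) (hn2 _) (hn2 _) E h hb nn => q X Y Z; nra.
Qed.

End spectrum.

(** * The discretized operator *)

Section period_integral.
Context {R : realType}.
Implicit Types (f g : R -> R) (x y : R).

(* [f] has an antiderivative whose increment over [0, 2 pi] is [x]. *)
Definition period_int f x : Prop := exists2 F : R -> R,
  forall t, is_derive t (1 : R) F (f t) & F (2 * pi) - F 0 = x.

Lemma period_int_add f g x y : period_int f x -> period_int g y ->
  period_int (fun t => f t + g t) (x + y).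
Proof.
move=> [F dF <-] [G dG <-]; exists (F + G); last by rewrite addrACA -opprD.
by move=> t; exact: is_deriveD.
Qed.

Lemma period_int_scale c f x : period_int f x -> period_int (fun t => c * f t) (c * x).
Proof.
move=> [F dF <-]; exists (c *: F); last by rewrite mulrBr.
by move=> t; exact: is_deriveZ.
Qed.

Lemma period_int_sum n (f : 'I_n -> R -> R) (x : 'I_n -> R) :
  (forall i, period_int (f i) (x i)) ->
  period_int (fun t => \sum_i f i t) (\sum_i x i).
Proof.
elim: n f x => [|n IHn] f x fx.
  rewrite big_ord0; under eq_fun do rewrite big_ord0.
  by exists (cst 0); rewrite ?subr0// => t; exact: is_derive_cst.
rewrite big_ord_recl; under eq_fun do rewrite big_ord_recl.
by apply: period_int_add => //; apply: IHn.
Qed.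

Lemma period_int_ge0 f x : period_int f x ->
  (forall t, 0 <= t <= 2 * pi -> 0 <= f t) -> 0 <= x.
Proof.
move=> [F dF <-] f0; have p0 : 0 <= 2 * pi :> R by rewrite mulr_ge0// pi_ge0.
have [|c cin ->] := MVT_segment p0 (fun x _ => dF x).
  by apply: derivable_within_continuous => t _; exact: ex_derive.
by rewrite subr0 mulr_ge0// f0.
Qed.

Lemma cos_sin_periodic (k : int) :
  (cos (k%:~R * (2 * pi)) = 1 :> R) * (sin (k%:~R * (2 * pi)) = 0 :> R).
Proof.
have nat n : (cos (n%:R * (2 * pi)) = 1 :> R) * (sin (n%:R * (2 * pi)) = 0 :> R).
  elim: n => [|n [IHc IHs]]; first by rewrite mul0r cos0 sin0.
  by rewrite -natr1 mulrDl mul1r cosD sinD IHc IHs mulr_natl cos2pi sin2pi !mul0r !mulr1 mul1r subr0 addr0.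
case: k => n; first exact: nat.
by rewrite NegzE mulrNz mulNr cosN sinN !nat oppr0.
Qed.

(* The symbol of the Toeplitz matrix with entries [1 / (i pi (m - n))]. *)
Definition weight t : R := 1 - t / pi.

Let dlin (k : int) t : is_derive t (1 : R) (fun t => k%:~R * t) k%:~R.
Proof. by apply: is_derive_eq; rewrite /GRing.scale/= mulr1. Qed.

Let dsin (k : int) t : is_derive t (1 : R) (fun t => sin (k%:~R * t)) (k%:~R * cos (k%:~R * t)).
Proof.
have h := dlin k t.
by apply: is_derive_eq; rewrite /GRing.scale/=; ring.
Qed.

Let dcos (k : int) t : is_derive t (1 : R) (fun t => cos (k%:~R * t)) (- (k%:~R * sin (k%:~R * t))).
Proof.
have h := dlin k t.
by apply: is_derive_eq; rewrite /GRing.scale/=; ring.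
Qed.

Lemma period_int_ext f g x : (forall t, f t = g t) -> period_int f x -> period_int g x.
Proof. by move=> fg; have -> : f = g by apply/funext. Qed.

Lemma period_int_cos (k : int) :
  period_int (fun t => cos (k%:~R * t)) (if k == 0 then 2 * pi else 0).
Proof.
case: eqVneq => [->|k0].
  exists id; last by rewrite subr0.
  by move=> t; apply: is_derive_eq; rewrite mul0r cos0.
have k0' : k%:~R != 0 :> R by rewrite intr_eq0.
exists (fun t => k%:~R^-1 * sin (k%:~R * t)); last first.
  by rewrite cos_sin_periodic !mulr0 sin0 mulr0 subr0.
move=> t; have h := dsin k t; apply: is_derive_eq.
by rewrite /GRing.scale/= mulKf.
Qed.

Lemma period_int_sin (k : int) : period_int (fun t => sin (k%:~R * t)) 0.
Proof.
have [->|k0] := eqVneq k 0.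
  exists (cst 0); last by rewrite subr0.
  by move=> t; apply: is_derive_eq; rewrite mul0r sin0.
have k0' : k%:~R != 0 :> R by rewrite intr_eq0.
exists (fun t => - k%:~R^-1 * cos (k%:~R * t)); last first.
  by rewrite !cos_sin_periodic mulr0 cos0 subrr.
move=> t; have h := dcos k t; apply: is_derive_eq.
by rewrite /GRing.scale/= mulrNN mulKf.
Qed.

Let dweight t : is_derive t (1 : R) weight (- pi^-1).
Proof.
rewrite /weight; move: (pi : R) => P.
by apply: is_derive_eq; rewrite /GRing.scale/=; ring.
Qed.

Let pi0 : pi != 0 :> R. Proof. by rewrite gt_eqF// pi_gt0. Qed.

Lemma period_int_weight_cos (k : int) :
  period_int (fun t => weight t * cos (k%:~R * t)) 0.
Proof.
have [->|k0] := eqVneq k 0.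
  exists (fun t => t - t ^+ 2 / (2 * pi)).
    move=> t; apply: is_derive_eq; rewrite mul0r cos0 mulr1 /weight /GRing.scale/=.
    by move: (pi : R) pi0 => P P0; field.
  by move: (pi : R) pi0 => P P0; field.
have k0' : k%:~R != 0 :> R by rewrite intr_eq0.
exists (fun t => weight t * sin (k%:~R * t) / k%:~R - cos (k%:~R * t) / (pi * k%:~R ^+ 2)); last first.
  by rewrite !cos_sin_periodic !mulr0 sin0 cos0 !mulr0 !mul0r subrr.
move=> t; have h := dcos k t; have h2 := dsin k t; have h3 := dweight t.
apply: is_derive_eq; rewrite /GRing.scale/=.
move: (weight t) (sin _) (cos _) => w s c.
by move: (pi : R) pi0 (k%:~R : R) k0' => P P0 K K0; field; rewrite K0.
Qed.

Lemma period_int_weight_sin (k : int) :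
  period_int (fun t => weight t * sin (k%:~R * t)) (if k == 0 then 0 else 2 / k%:~R).
Proof.
case: eqVneq => [->|k0].
  exists (cst 0); last by rewrite subr0.
  by move=> t; apply: is_derive_eq; rewrite mul0r sin0 mulr0.
have k0' : k%:~R != 0 :> R by rewrite intr_eq0.
exists (fun t => - (weight t * cos (k%:~R * t)) / k%:~R - sin (k%:~R * t) / (pi * k%:~R ^+ 2)); last first.
  rewrite !cos_sin_periodic !mulr0 sin0 cos0 /weight.
  by move: (pi : R) pi0 (k%:~R : R) k0' => P P0 K K0; field; rewrite K0.
move=> t; have h := dcos k t; have h2 := dsin k t; have h3 := dweight t.
apply: is_derive_eq; rewrite /GRing.scale/=.
move: (weight t) (sin _) (cos _) => w s c.
by move: (pi : R) pi0 (k%:~R : R) k0' => P P0 K K0; field; rewrite K0.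
Qed.

End period_integral.

(** * The Toeplitz form and its numerical range *)

Section discrete_operator.
Context {R : realType} {n : nat}.
Variable m : 'I_n -> int.
Hypothesis inj_m : injective m.
Local Notation V := 'cV[R]_n.

Definition ipc (u w : V) : R := \sum_i u i 0 * w i 0.

Lemma prehilbert_col : prehilbert (fun _ : V => True) ipc.
Proof.
split=> //.
- by move=> u w; apply: eq_bigr => i _; rewrite mulrC.
- by move=> u v w _ _ _; rewrite -big_split; apply: eq_bigr => i _; rewrite mxE mulrDl.
- by move=> a u w _ _; rewrite /ipc mulr_sumr; apply: eq_bigr => i _; rewrite mxE mulrA.
- by move=> u; apply: sumr_ge0 => i _; rewrite -expr2 sqr_ge0.
Qed.

(** [T^N] is - i times this real skew matrix; the origin and the step of the grid cancel. *)
Definition Smx : 'M[R]_n :=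
  \matrix_(i, j) if i == j then 0 else (pi * (m i - m j)%:~R)^-1.

Definition Scol (u : V) : V := Smx *m u.

Lemma Smx_skew i j : Smx i j = - Smx j i.
Proof.
rewrite !mxE eq_sym; case: eqVneq => _; first by rewrite oppr0.
by rewrite -opprB intrN mulrN invrN.
Qed.

Lemma Scol_skew (u w : V) : True -> True -> ipc (Scol u) w = - ipc u (Scol w).
Proof.
move=> _ _; rewrite /ipc.
under eq_bigr do rewrite mxE mulr_suml.
rewrite exchange_big/= -sumrN; apply: eq_bigr => i _.
rewrite mxE mulr_sumr -sumrN; apply: eq_bigr => j _.
by rewrite Smx_skew; ring.
Qed.

(* [trigX u + i trigY u] is the Fourier polynomial with frequencies [m j] and
   coefficients [u.1 j + i u.2 j]. *)
Definition trigX (u : V * V) t : R :=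
  \sum_j (u.1 j 0 * cos ((m j)%:~R * t) - u.2 j 0 * sin ((m j)%:~R * t)).
Definition trigY (u : V * V) t : R :=
  \sum_j (u.1 j 0 * sin ((m j)%:~R * t) + u.2 j 0 * cos ((m j)%:~R * t)).

Lemma trig_prod u w t : trigX u t * trigX w t + trigY u t * trigY w t =
  \sum_j \sum_k
    ((u.1 j 0 * w.1 k 0 + u.2 j 0 * w.2 k 0) * cos ((m j - m k)%:~R * t) +
    (u.1 j 0 * w.2 k 0 - u.2 j 0 * w.1 k 0) * sin ((m j - m k)%:~R * t)).
Proof.
rewrite !big_distrlr -big_split; apply: eq_bigr => j _.
rewrite -big_split; apply: eq_bigr => k _ /=.
have -> : (m j - m k)%:~R * t = (m j)%:~R * t - (m k)%:~R * t by rewrite intrB mulrBl.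
by rewrite cosB sinB; ring.
Qed.

(** Parseval's identity: distinct frequencies make the exponentials orthogonal. *)
Lemma period_int_trig u w :
  period_int (fun t => trigX u t * trigX w t + trigY u t * trigY w t)
    (2 * pi * ip2 ipc u w).
Proof.
have -> : 2 * pi * ip2 ipc u w = \sum_j \sum_k
    ((u.1 j 0 * w.1 k 0 + u.2 j 0 * w.2 k 0) * (if m j - m k == 0 then 2 * pi else 0) +
     (u.1 j 0 * w.2 k 0 - u.2 j 0 * w.1 k 0) * 0).
  rewrite /ip2 /ipc -big_split mulr_sumr; apply: eq_bigr => j _ /=.
  rewrite (bigD1 j)//= big1; last first.
    by move=> k kj; rewrite subr_eq0 (inj_eq inj_m) eq_sym (negbTE kj) !mulr0 addr0.
  by rewrite subrr eqxx; move: (pi : R) => P; ring.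
apply: period_int_ext; first by move=> t; rewrite trig_prod.
apply: period_int_sum => j; apply: period_int_sum => k.
by apply: period_int_add; apply: period_int_scale;
  [exact: period_int_cos|exact: period_int_sin].
Qed.

(** Multiplication by [T^N], that is by [- i S]. *)
Definition Acol (u : V * V) : V * V := (Scol u.2, - Scol u.1).

Lemma period_int_weight_trig u w :
  period_int (fun t => weight t * (trigX u t * trigX w t + trigY u t * trigY w t))
    (2 * pi * ip2 ipc (Acol u) w).
Proof.
have -> : 2 * pi * ip2 ipc (Acol u) w = \sum_j \sum_k
    ((u.1 j 0 * w.1 k 0 + u.2 j 0 * w.2 k 0) * 0 +
     (u.1 j 0 * w.2 k 0 - u.2 j 0 * w.1 k 0) *
     (if m j - m k == 0 then 0 else 2 / (m j - m k)%:~R)).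
  rewrite exchange_big /ip2 /ipc -big_split mulr_sumr; apply: eq_bigr => k _ /=.
  rewrite !mxE !mulr_suml -sumrN mulr_suml -big_split mulr_sumr; apply: eq_bigr => j _ /=.
  rewrite !mxE subr_eq0 (inj_eq inj_m) eq_sym; case: eqVneq => [_|kj].
    by rewrite !mul0r oppr0 mul0r !mulr0 !addr0 mulr0.
  have m0 : (m j - m k)%:~R != 0 :> R by rewrite intr_eq0 subr_eq0 (inj_eq inj_m).
  have p0 : pi != 0 :> R by rewrite gt_eqF// pi_gt0.
  rewrite -opprB intrN; move: (_%:~R) m0 (pi : R) p0 => d d0 P P0.
  by field; rewrite d0 P0.
refine (@period_int_ext _ (fun t => \sum_j \sum_k
    ((u.1 j 0 * w.1 k 0 + u.2 j 0 * w.2 k 0) * (weight t * cos ((m j - m k)%:~R * t)) +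
    (u.1 j 0 * w.2 k 0 - u.2 j 0 * w.1 k 0) * (weight t * sin ((m j - m k)%:~R * t)))) _ _ _ _).
  move=> t; rewrite trig_prod mulr_sumr; apply: eq_bigr => j _.
  by rewrite mulr_sumr; apply: eq_bigr => k _; ring.
apply: period_int_sum => j; apply: period_int_sum => k.
by apply: period_int_add; apply: period_int_scale;
  [exact: period_int_weight_cos|exact: period_int_weight_sin].
Qed.

Lemma weight_le1 (t : R) : 0 <= t <= 2 * pi -> -1 <= weight t <= 1.
Proof.
move=> /andP[t0 t2]; have p0 : 0 < pi :> R := pi_gt0 R.
have h : 0 <= t / pi <= 2 by rewrite divr_ge0 ?(ltW p0)//= ler_pdivrMr.
by rewrite /weight; move: (t / pi) h => x; lra.
Qed.

(** The form of [T^N] at [(q, p)] is twice [ipc (Scol p) q]. The symbol lies in [-1, 1] over a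
    period, so the forms of [I + T^N] and [I - T^N] have nonnegative integrands. *)
Lemma Scol_numerical_range (p q : V) : True -> True ->
  2 * `|ipc (Scol p) q| <= ipc p p + ipc q q.
Proof.
move=> _ _; have p0 : 0 < pi :> R := pi_gt0 R.
have E : ip2 ipc (Acol (q, p)) (q, p) = 2 * ipc (Scol p) q.
  rewrite /ip2/= (ip_oppl prehilbert_col)// (@Scol_skew q p)// (ph_sym prehilbert_col q).
  rewrite opprK; ring.
have key s : s = 1 \/ s = -1 -> 0 <= ip2 ipc (q, p) (q, p) + s * (2 * ipc (Scol p) q).
  move=> s1; rewrite -(pmulr_rge0 _ (mulr_gt0 (ltr0n _ 2) p0)) mulrDr mulrCA -E.
  apply: period_int_ge0 (period_int_add (period_int_trig _ _)
    (period_int_scale s (period_int_weight_trig _ _))) _ => t /weight_le1 wt.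
  have [] := (sqr_ge0 (trigX (q, p) t), sqr_ge0 (trigY (q, p) t)).
  rewrite !expr2; move: (trigX _ _ * _) (trigY _ _ * _) (weight t) wt => X Y W Wt X0 Y0.
  have -> : X + Y + s * (W * (X + Y)) = (1 + s * W) * (X + Y) by ring.
  by apply: mulr_ge0; [case: s1 => ->; lra|exact: addr_ge0].
have h1 := key 1 (or_introl erefl); have h2 := key (-1) (or_intror erefl).
rewrite -[2](@ger0_norm R)// -normrM ler_norml.
by move: h1 h2; rewrite /ip2/=; move: (ipc _ q) (ipc q q) => x y; lra.
Qed.

End discrete_operator.

(** * Approximate eigenvectors of the discretized operator *)

Section cosine_bounds.
Context {R : realType}.

Lemma sin_ge_mul (x : R) : 0 <= x <= 1 -> cos 1 * x <= sin x.
Proof.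
move=> /andP[x0 x1]; have p2 : 1 <= pi / 2 :> R := pihalf_ge1 R.
have [|c] := @MVT_segment R sin cos 0 x x0 (fun y _ => is_derive_sin y).
  apply: continuous_subspaceT; exact: continuous_sin.
rewrite in_itv/= sin0 !subr0 => /andP[c0 cx] ->.
rewrite ler_wpM2r// leNgt; apply/negP => h.
have := ltr_cos (x := 1) (y := c); rewrite h !in_itv/=.
have -> : 0 <= c <= pi by apply/andP; split; move: p2 c0 cx x1; lra.
have -> : 0 <= (1 : R) <= pi by apply/andP; split; move: p2; lra.
by move=> /(_ isT isT)/esym; rewrite ltNge (le_trans cx x1).
Qed.

Lemma sin_le_mono (x y : R) : 0 <= x <= y -> x + y <= pi -> sin x <= sin y.
Proof.
move=> /andP[x0 xy] xyp; have x2 : x <= pi / 2 by lra.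
have key z : x <= z <= pi / 2 -> sin x <= sin z.
  rewrite le_eqVlt => /andP[/predU1P[->//|xz] z2]; rewrite ltW// ltr_sin//.
    by rewrite in_itv/=; apply/andP; split; move: x0 x2; lra.
  by rewrite in_itv/=; apply/andP; split; move: x0 xz z2; lra.
have [y2|y2] := leP y (pi / 2); first by apply: key; rewrite xy.
have -> : sin y = sin (pi - y) by rewrite sinB sinpi cospi; ring.
apply: key; apply/andP; split; lra.
Qed.

(** [1 - cos t] is [2 sin ^ 2 (t / 2)], whose only zero with [|t| <= T] is a double one at 0; it
    therefore dominates a multiple of [t ^ 2]. *)
Lemma sqr_le_one_sub_cos (T : R) : T < 2 * pi ->
  exists2 c : R, 0 < c & forall t : R, `|t| <= T -> t ^+ 2 <= c * (1 - cos t).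
Proof.
move=> T2; have pp : 0 < pi :> R := pi_gt0 R; have p2 : 1 <= pi / 2 :> R := pihalf_ge1 R.
(* Up to [d] the sine has a linear lower bound; from [d] to [T / 2] it is at least [sin d], since
   [d] is no farther from 0 than these points are from [pi]. *)
pose d := Num.min 1 (pi - T / 2).
have d0 : 0 < d by rewrite lt_min ltr01/=; move: T2; lra.
have d1 : d <= 1 by rewrite ge_min lexx.
have dT : d <= pi - T / 2 by rewrite ge_min lexx orbT.
have k0 : 0 < cos 1 :> R := cos1_gt0 R.
pose k : R := cos 1 * d / pi.
have kp : 0 < k by rewrite divr_gt0// mulr_gt0.
have sk x : 0 <= x <= T / 2 -> k * x <= sin x.
  move=> /andP[x0 xT]; have [xd|dx] := leP x d.
    apply: (le_trans _ (sin_ge_mul _)); last by rewrite x0 (le_trans xd).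
    rewrite ler_wpM2r// /k -mulrA ler_piMr ?(ltW k0)// ler_pdivrMr// mul1r.
    by move: d1 p2 pp; lra.
  apply: (@le_trans _ _ (sin d)); last first.
    by apply: sin_le_mono; [rewrite (ltW d0) ltW|move: dT xT; lra].
  apply: (le_trans _ (sin_ge_mul _)); last by rewrite (ltW d0).
  rewrite /k mulrAC ler_pdivrMr// ler_wpM2l//; first by rewrite mulr_ge0 ?(ltW k0) ?(ltW d0).
  by move: xT dT d0; lra.
exists (2 / k ^+ 2); first by rewrite divr_gt0// exprn_gt0.
move=> t tT; have h : 0 <= `|t| / 2 <= T / 2.
  by rewrite divr_ge0//= ler_pM2r// invr_gt0.
have := sk _ h; rewrite -(cos_norm t) -(sqr_norm t).
have -> : cos `|t| = 1 - 2 * sin (`|t| / 2) ^+ 2.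
  have := cos_mulr2n (`|t| / 2); have -> : `|t| / 2 *+ 2 = `|t| by rewrite mulr2n; lra.
  by move=> ->; rewrite cos2sin2 mulr2n; ring.
have : 0 <= k * (`|t| / 2) by rewrite mulr_ge0 ?(ltW kp)//; case/andP: h.
move: (sin (`|t| / 2)) => s; move: (`|t| : R) => u u0 us.
have us2 : (k * (u / 2)) ^+ 2 <= s ^+ 2 by rewrite lerXn2r ?nnegrE// (le_trans u0 us).
rewrite mulrAC ler_pdivlMr ?exprn_gt0//; move: us2.
have -> : (k * (u / 2)) ^+ 2 = u ^+ 2 * k ^+ 2 / 4 by field.
by move: (u ^+ 2 * k ^+ 2) (s ^+ 2) => A B; lra.
Qed.

End cosine_bounds.

Section approximate_eigenvector.
Context {R : realType}.

(** A geometric sum: multiplied by [e ^ (i t) - 1] it telescopes to a difference of two unit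
    numbers, and [|e ^ (i t) - 1| ^ 2 = 2 (1 - cos t)]. *)
Lemma block_trig_le (M : int) n (t : R) :
  (1 - cos t) * ((\sum_(k < n) cos ((M + k%:Z)%:~R * t)) ^+ 2 +
                 (\sum_(k < n) sin ((M + k%:Z)%:~R * t)) ^+ 2) <= 2.
Proof.
set X := \sum_(k < n) cos _; set Y := \sum_(k < n) sin _.
pose A : R := (M + n%:Z)%:~R * t; pose B : R := M%:~R * t.
have nxt (k : nat) : (M + k.+1%:Z)%:~R * t = (M + k%:Z)%:~R * t + t :> R.
  rewrite -addn1 PoszD addrA (intrD _ (M + k%:Z)) mulrDl; congr (_ + _).
  exact: mul1r.
have tele (f : R -> R) : \sum_(k < n) (f ((M + k.+1%:Z)%:~R * t) - f ((M + k%:Z)%:~R * t)) =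
    f A - f B.
  have -> : f B = f ((M + 0%:Z)%:~R * t) by rewrite addr0.
  rewrite -(big_mkord xpredT (fun k => f ((M + k.+1%:Z)%:~R * t) - f ((M + k%:Z)%:~R * t))).
  by rewrite (telescope_sumr (fun k => f ((M + k%:Z)%:~R * t))).
have E1 : (cos t - 1) * X - sin t * Y = cos A - cos B.
  rewrite -tele !mulr_sumr -sumrB; apply: eq_bigr => k _.
  by rewrite nxt cosD; ring.
have E2 : sin t * X + (cos t - 1) * Y = sin A - sin B.
  rewrite -tele !mulr_sumr -big_split; apply: eq_bigr => k _ /=.
  by rewrite nxt sinD; ring.
have c2 := cos2Dsin2 t; have cA := cos2Dsin2 A; have cB := cos2Dsin2 B.
have cAB := cos_geN1 (A - B); rewrite cosB in cAB.
move: (cos A) (sin A) (cos B) (sin B) (cos t) (sin t) E1 E2 c2 cA cB cAB.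
move=> a a' b b' c s E1 E2 c2 cA cB cAB.
have : ((c - 1) * X - s * Y) ^+ 2 + (s * X + (c - 1) * Y) ^+ 2 =
    (c ^+ 2 + s ^+ 2 + 1 - 2 * c) * (X ^+ 2 + Y ^+ 2) by ring.
rewrite E1 E2 c2.
have -> : (a - b) ^+ 2 + (a' - b') ^+ 2 =
  a ^+ 2 + a' ^+ 2 + (b ^+ 2 + b' ^+ 2) - 2 * (a * b + a' * b') by ring.
rewrite cA cB; move: (X ^+ 2 + Y ^+ 2) (a * b + a' * b') cAB => Z W; nra.
Qed.

(* For [u j = e ^ (- i (m j) psi)] the Fourier polynomial is a Dirichlet kernel
   centred at [psi], so its product with [weight t - weight psi] is bounded
   independently of [n]. *)
Lemma approximate_eigenvector (psi : R) : 0 < psi < 2 * pi ->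
  exists K : R, forall n (m : 'I_n -> int) (M : int), injective m ->
  perm_eq (codom m) [seq M + k%:Z | k <- iota 0 n] ->
  exists u : 'cV[R]_n * 'cV[R]_n, hnorm (ip2 ipc) u ^+ 2 = n%:R /\
    hnorm (ip2 ipc) (lamop (Scol m) (weight psi) 0 u) ^+ 2 <= K.
Proof.
move=> /andP[psi0 psi2]; have pp : 0 < pi :> R := pi_gt0 R.
have T2 : Num.max psi (2 * pi - psi) < 2 * pi by rewrite gt_max psi2/= ltrBlDr ltrDl.
have [c c0 cP] := sqr_le_one_sub_cos T2.
(* The 2 comes from [block_trig_le], [c] from comparing [t ^ 2] with [1 - cos t], and [pi ^+ 2] from
   the slope of the weight. *)
exists (2 * c / pi ^+ 2) => n m M injm mM.
have reidx (f : int -> R) : \sum_j f (m j) = \sum_(k < n) f (M + k%:Z).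
  rewrite -(big_mkord xpredT (fun k => f (M + k%:Z))) /index_iota subn0.
  rewrite -(big_map (fun k : nat => M + k%:Z) xpredT f) -(perm_big _ mM).
  by rewrite big_map big_enum.
have H2 := prehilbert2 (@prehilbert_col R n).
pose u : 'cV[R]_n * 'cV[R]_n :=
  (\col_j cos ((m j)%:~R * psi), \col_j - sin ((m j)%:~R * psi)).
exists u; split.
  rewrite (sqr_hnorm H2) /ip2 /ipc -big_split/= -[RHS]mulr1 mulr_natl.
  rewrite -[in RHS](card_ord n) -sumr_const; apply: eq_bigr => i _.
  by rewrite !mxE mulrNN -!expr2 cos2Dsin2.
pose w := Acol m u - weight psi *: u.
have wE : lamop (Scol m) (weight psi) 0 u = - w.
  rewrite /w /Acol /lamop opprB !scale0r subr0 add0r.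
  by rewrite -[RHS]/(_ - _, _ - _) opprK.
rewrite wE (hnorm_opp H2)// (sqr_hnorm H2).
have tX t : trigX m u t = \sum_(k < n) cos ((M + k%:Z)%:~R * (t - psi)).
  rewrite -(reidx (fun k => cos (k%:~R * (t - psi)))); apply: eq_bigr => j _.
  by rewrite !mxE mulrBr cosB; ring.
have tY t : trigY m u t = \sum_(k < n) sin ((M + k%:Z)%:~R * (t - psi)).
  rewrite -(reidx (fun k => sin (k%:~R * (t - psi)))); apply: eq_bigr => j _.
  by rewrite !mxE mulrBr sinB; ring.
set K := 2 * c / pi ^+ 2.
have pt (t : R) : 0 <= t <= 2 * pi ->
    (weight t - weight psi) ^+ 2 * (trigX m u t ^+ 2 + trigY m u t ^+ 2) <= K.
  move=> /andP[t0 t2]; have bt := block_trig_le M n (t - psi).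
  rewrite tX tY; have h : (t - psi) ^+ 2 <= c * (1 - cos (t - psi)).
    apply: cP; rewrite le_max; have [tp|tp] := leP t psi.
      by apply/orP; left; rewrite distrC ger0_norm ?subr_ge0//; lra.
    by apply/orP; right; rewrite gtr0_norm ?subr_gt0//; lra.
  have -> : (weight t - weight psi) ^+ 2 = (t - psi) ^+ 2 / pi ^+ 2.
    by rewrite /weight; move: (pi : R) (lt0r_neq0 pp) => P P0; field.
  rewrite mulrAC /K ler_pM2r ?invr_gt0 ?exprn_gt0//.
  set Z := _ ^+ 2 + _ ^+ 2 in bt *.
  have Z0 : 0 <= Z by rewrite addr_ge0// sqr_ge0.
  apply: (@le_trans _ _ (c * (1 - cos (t - psi)) * Z)); first by rewrite ler_wpM2r.
  by rewrite -mulrA mulrC ler_wpM2r ?(ltW c0).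
have P1 := period_int_trig injm w w.
have P2 := period_int_trig injm u w.
have P3 := period_int_weight_trig injm u w.
have P4 : period_int (fun _ : R => K / 2) (K / 2 * (2 * pi)).
  apply: (@period_int_ext _ (fun t => K / 2 * cos (0%:~R * t))).
    by move=> t; rewrite mul0r cos0 mulr1.
  exact: (period_int_scale _ (period_int_cos 0)).
have D0 := period_int_add (period_int_add P4 (period_int_scale 2^-1 P1))
  (period_int_add (period_int_scale (weight psi) P2) (period_int_scale (-1) P3)).
have wwE : ip2 ipc w w = ip2 ipc (Acol m u) w - weight psi * ip2 ipc u w.
  by rewrite {1}/w (ip_subl H2)// (ph_scalel H2).
(* [|w| ^ 2] is the mean of [weight t - weight psi] against the product of the polynomials of [u]
   and [w]; by [2 P Q <= P ^ 2 + Q ^ 2] and Parseval it is at most [K / 2 + |w| ^ 2 / 2]. *)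
have D1 : 0 <= K / 2 * (2 * pi) + 2^-1 * (2 * pi * ip2 ipc w w) +
    (weight psi * (2 * pi * ip2 ipc u w) + -1 * (2 * pi * ip2 ipc (Acol m u) w)).
  apply: period_int_ge0 D0 _ => t /pt; set X := trigX m u t; set Y := trigY m u t.
  move: (trigX m w t) (trigY m w t) (weight t) (weight psi) => X' Y' b b'; clear.
  have := sqr_ge0 (X' - (b - b') * X); have := sqr_ge0 (Y' - (b - b') * Y).
  have -> : (b - b') ^+ 2 * (X ^+ 2 + Y ^+ 2) =
    ((b - b') * X) ^+ 2 + ((b - b') * Y) ^+ 2 by ring.
  have -> : K / 2 + 2^-1 * (X' * X' + Y' * Y') + (b' * (X * X' + Y * Y') +
    -1 * (b * (X * X' + Y * Y'))) = K / 2 + 2^-1 * (X' ^+ 2 + Y' ^+ 2) -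
    ((b - b') * X * X' + (b - b') * Y * Y') by field.
  rewrite !sqrrB; move: ((b - b') * X) ((b - b') * Y) => P Q.
  by move: (P ^+ 2) (Q ^+ 2) (X' ^+ 2) (Y' ^+ 2) => *; lra.
have p2 : 0 < 2 * pi :> R by rewrite mulr_gt0.
have fin (P x y z k b : R) : 0 < P -> x = y - b * z ->
    0 <= k / 2 * P + 2^-1 * (P * x) + (b * (P * z) + -1 * (P * y)) -> x <= k.
  move=> P0 xE; have -> : k / 2 * P + 2^-1 * (P * x) + (b * (P * z) + -1 * (P * y)) =
    P * ((k - x) / 2) by rewrite xE; field.
  by rewrite (pmulr_rge0 _ P0); lra.
exact: fin p2 wwE D1.
Qed.

End approximate_eigenvector.

(** * Grid points in the interval *)

Section grid_block.
Context {R : realType}.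
Variables (a b : R) (org : nat -> R) (N : nat).
Hypotheses (ab : a < b) (N0 : (0 < N)%N).
Local Notation w := (omega a b org N).

Lemma idx_inj : injective (@idx w).
Proof. by move=> i j /val_inj/enum_val_inj. Qed.

Lemma mem_codom_idx z : (z \in codom (@idx w)) = (a < grid org N z < b).
Proof.
rewrite -mem_omega//; apply/codomP/idP => [[i ->]|zw]; first exact: valP.
exists (enum_rank [`zw]%fset); by rewrite /idx enum_rankK.
Qed.

(** The indices fill the integers strictly between two reals, hence the floor plus one below and the
    excluded ceiling above. The enumeration of a finite set has no prescribed order, so they form a
    block only up to a permutation. *)
Lemma omega_block : exists M : int,
  perm_eq (codom (@idx w)) [seq M + k%:Z | k <- iota 0 #|{: w}|] /\
  N%:R * (b - a) - 1 <= #|{: w}|%:R :> R.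
Proof.
have N0' : 0 < N%:R :> R by rewrite ltr0n.
pose x := (a - org N) * N%:R; pose y := (b - org N) * N%:R.
have xy : x < y by rewrite ltr_pM2r// ltrD2r.
pose M := Num.floor x + 1; pose L := absz (Num.ceil y - M).
have My : M <= Num.ceil y.
  rewrite -ltzD1 -[ltRHS]/(Num.ceil y + 1) ltrD2r floor_lt_int.
  by rewrite (lt_le_trans xy)// ceil_ge.
have LE : L%:Z = Num.ceil y - M by rewrite gez0_abs// subr_ge0.
have memw z : (z \in codom (@idx w)) = (M <= z < Num.ceil y).
  rewrite mem_codom_idx /grid /M lezD1 floor_lt_int ceil_gt_int.
  by rewrite /x /y -ltr_pdivlMr// -[z%:~R < _ * _]ltr_pdivrMr// ltrBlDl ltrBrDl.
have P : perm_eq (codom (@idx w)) [seq M + k%:Z | k <- iota 0 L].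
  apply: uniq_perm.
  - by rewrite map_inj_uniq ?enum_uniq//; exact: idx_inj.
  - by rewrite map_inj_uniq ?iota_uniq// => i j /addrI [].
  move=> z; rewrite memw; apply/idP/mapP => [/andP[Mz zy]|[k + ->]].
    exists (absz (z - M)); last by rewrite gez0_abs ?subr_ge0// [RHS]addrC subrK.
    by rewrite mem_iota add0n /= -ltz_nat LE gez0_abs ?subr_ge0// ltrD2r.
  rewrite mem_iota add0n /= -ltz_nat LE => kL.
  by rewrite lerDl/= -ltrBrDl.
have sL : #|{: w}| = L.
  by have := perm_size P; rewrite size_codom card_ord size_map size_iota.
exists M; split; first by rewrite [X in iota 0 X]sL.
rewrite sL.
have -> : L%:R = (L%:Z)%:~R :> R by [].
rewrite LE intrB intrD /=.
have := floor_le x; have := ceil_ge y.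
have -> : N%:R * (b - a) = y - x by rewrite /x /y; ring.
rewrite -[1%:~R]/(1 : R); lra.
Qed.

End grid_block.

(** * Complex matrices as operators on pairs of real vectors *)

Section matrix_glue.
Context {R : realType}.

Lemma cReD (x y : R[i]) : complex.Re (x + y) = complex.Re x + complex.Re y.
Proof. by case: x; case: y. Qed.

Lemma cImD (x y : R[i]) : complex.Im (x + y) = complex.Im x + complex.Im y.
Proof. by case: x; case: y. Qed.

Lemma cReN (x : R[i]) : complex.Re (- x) = - complex.Re x.
Proof. by case: x. Qed.

Lemma cImN (x : R[i]) : complex.Im (- x) = - complex.Im x.
Proof. by case: x. Qed.

Lemma cReM (x y : R[i]) : complex.Re (x * y) =
  complex.Re x * complex.Re y - complex.Im x * complex.Im y.
Proof. by case: x; case: y. Qed.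

Lemma cImM (x y : R[i]) : complex.Im (x * y) =
  complex.Re x * complex.Im y + complex.Im x * complex.Re y.
Proof. by case: x; case: y. Qed.

Lemma cRe_sum I (r : seq I) (P : pred I) (F : I -> R[i]) :
  complex.Re (\sum_(i <- r | P i) F i) = \sum_(i <- r | P i) complex.Re (F i).
Proof. by rewrite (big_morph _ cReD (erefl : complex.Re 0 = 0)). Qed.

Lemma cIm_sum I (r : seq I) (P : pred I) (F : I -> R[i]) :
  complex.Im (\sum_(i <- r | P i) F i) = \sum_(i <- r | P i) complex.Im (F i).
Proof. by rewrite (big_morph _ cImD (erefl : complex.Im 0 = 0)). Qed.

Lemma sqr_cnorm (z : R[i]) : cnorm z ^+ 2 = complex.Re z ^+ 2 + complex.Im z ^+ 2.
Proof. by case: z => x y; rewrite /cnorm /= sqr_sqrtr// addr_ge0// sqr_ge0. Qed.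

Definition reim n (v : 'cV[R[i]]_n) : 'cV[R]_n * 'cV[R]_n :=
  (\col_i complex.Re (v i 0), \col_i complex.Im (v i 0)).

Definition of_reim n (u : 'cV[R]_n * 'cV[R]_n) : 'cV[R[i]]_n :=
  \col_i (u.1 i 0 +i* u.2 i 0)%C.

Lemma of_reimK n : cancel (@of_reim n) (@reim n).
Proof. by move=> [p q]; congr pair; apply/colP => i; rewrite !mxE. Qed.

Lemma reimK n : cancel (@reim n) (@of_reim n).
Proof. by move=> v; apply/colP => i; rewrite !mxE/=; case: (v i 0). Qed.

Lemma l2normE n (v : 'cV[R[i]]_n) : l2norm v = hnorm (ip2 ipc) (reim v).
Proof.
rewrite /l2norm /hnorm; congr Num.sqrt.
rewrite /ip2 /ipc -big_split; apply: eq_bigr => i _ /=.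
by rewrite sqr_cnorm !mxE !expr2.
Qed.

Variables (a b : R) (org : nat -> R) (N : nat).
Hypothesis N0 : (0 < N)%N.
Local Notation w := (omega a b org N).

Lemma TN_entry i j : TN a b org N i j = (0 +i* - Smx (@idx w) i j)%C.
Proof.
rewrite !mxE; case: eqVneq => [_|ij]; first by rewrite oppr0.
have N0' : N%:R != 0 :> R by rewrite pnatr_eq0 -lt0n.
have p0 : pi != 0 :> R by rewrite gt_eqF// pi_gt0.
have d0 : (idx i - idx j)%:~R != 0 :> R.
  by rewrite intr_eq0 subr_eq0 (inj_eq (@idx_inj _ _ _ _ _)).
have -> : grid org N (idx i) - grid org N (idx j) = (idx i - idx j)%:~R / N%:R.
  by rewrite /grid intrB mulrBl; ring.
have ci : ('i%C)^-1 = - 'i%C :> R[i] by rewrite complexiE invCi.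
rewrite -(rmorph_nat (real_complex R)) !invfM ci -!fmorphV -mulrA -!rmorphM.
move: (idx i - idx j)%:~R d0 N%:R N0' (pi : R) p0 => d d0 M M0 P P0.
rewrite -mulrA -rmorphM /=.
have -> : P^-1 / M * (d / M)^-1 = P^-1 / d by field; rewrite ?d0 ?M0 ?P0.
by apply/eqP; rewrite eq_complex cReM cImM cReN cImN /=; apply/andP; split; apply/eqP; ring.
Qed.

Lemma reim_mul lam (v : 'cV[R[i]]_#|{: w}|) :
  reim ((lam%:M - TN a b org N) *m v) =
  lamop (Scol (@idx w)) (complex.Re lam) (complex.Im lam) (reim v).
Proof.
rewrite mulmxBl mul_scalar_mx; congr pair; apply/colP => i; rewrite !mxE.
  rewrite cReD cReN cReM cRe_sum -sumrN; congr (_ + _).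
  rewrite -sumrN; apply: eq_bigr => j _.
  by rewrite TN_entry cReM !mxE/=; ring.
rewrite cImD cImN cImM cIm_sum [_ + complex.Im lam * _]addrC; congr (_ + _).
rewrite -sumrN; apply: eq_bigr => j _.
by rewrite TN_entry cImM !mxE/=; ring.
Qed.

Local Notation hn2 := (hnorm (ip2 ipc)).

Lemma hn2_eq0 n (u : 'cV[R]_n * 'cV[R]_n) : hn2 u = 0 -> u = 0.
Proof.
move=> u0; have := sqr_hnorm (prehilbert2 (@prehilbert_col R n)) u.
rewrite u0 expr0n /ip2 => /esym/eqP.
have ge0 (p : 'cV[R]_n) : 0 <= ipc p p by exact: ph_ge0 prehilbert_col p.
have eq0 (p : 'cV[R]_n) : ipc p p = 0 -> p = 0.
  move=> /eqP; rewrite psumr_eq0 => [|i _]; last by rewrite -expr2 sqr_ge0.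
  move=> /allP pP; apply/colP => i; rewrite mxE; apply/eqP.
  by have := pP i (mem_index_enum i); rewrite mulf_eq0 orbb.
rewrite paddr_eq0// => /andP[/eqP/eq0 u1 /eqP/eq0 u2].
by case: u u1 u2 {u0} => p q /= -> ->.
Qed.

Section lower_bound.
Variables (lam : R[i]) (d : R).
Hypotheses (d0 : 0 < d)
  (dP : forall x, -1 <= x <= 1 ->
    d ^+ 2 <= (complex.Re lam - x) ^+ 2 + complex.Im lam ^+ 2).
Local Notation M := (lam%:M - TN a b org N).

Lemma matrix_lower_bound (v : 'cV[R[i]]_#|{: w}|) : d * l2norm v <= l2norm (M *m v).
Proof.
rewrite !l2normE reim_mul; apply: (lamop_lower_bound prehilbert_col) => //.
- exact (@Scol_skew R _ (@idx w)).
- exact (Scol_numerical_range (@idx_inj R a b org N)).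
- exact: ltW.
Qed.

(** The lower bound makes the kernel trivial; the transposes appear because [kermx] is a left
    kernel. *)
Lemma matrix_unit : M \in unitmx.
Proof.
rewrite -unitmx_tr -row_free_unit -kermx_eq0; apply/eqP/row_matrixP => i.
rewrite row0; set r := row i _.
have r0 : r *m M^T = 0 by apply/sub_kermxP; exact: row_sub.
have Mr : M *m r^T = 0 by rewrite -[LHS]trmxK trmx_mul trmxK r0 trmx0.
have := matrix_lower_bound r^T; rewrite Mr.
have -> : l2norm (0 : 'cV[R[i]]_#|{: w}|) = 0.
  by rewrite /l2norm big1 ?sqrtr0// => j _; rewrite mxE sqr_cnorm/= expr0n addr0.
rewrite pmulr_rle0// => h; apply: trmx_inj; rewrite trmx0 -[LHS]reimK.
have -> : reim r^T = 0.
  by apply: hn2_eq0; apply/eqP; rewrite -l2normE eq_le h sqrtr_ge0.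
by apply/colP => j; rewrite !mxE.
Qed.

Lemma matrix_opnorm_le : (mx_opnorm (invmx M) <= (d^-1)%:E)%E.
Proof.
apply: ge_ereal_sup => _ [v /= v1 <-]; rewrite lee_fin.
have := matrix_lower_bound (invmx M *m v); rewrite mulmxA mulmxV ?matrix_unit// mul1mx.
by move=> h; rewrite -[leRHS]mul1r ler_pdivlMr// mulrC (le_trans h).
Qed.

End lower_bound.

Lemma opnorm_lower_bound (lam : R[i]) (C : R) :
  (lam%:M - TN a b org N) \in unitmx ->
  (mx_opnorm (invmx (lam%:M - TN a b org N)) <= C%:E)%E ->
  forall u, hn2 u <= C * hn2 (lamop (Scol (@idx w)) (complex.Re lam) (complex.Im lam) u).
Proof.
move=> uM nM u; set M := _ - _ in uM nM *.
have := reim_mul lam (of_reim u); rewrite of_reimK -/M => <-.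
set f := M *m _; have uE : of_reim u = invmx M *m f by rewrite mulKmx.
have [f0|f0] := eqVneq (l2norm f) 0.
  have : f = 0 by rewrite -[LHS]reimK (hn2_eq0 (u := reim f)) -?l2normE//; apply/colP => j; rewrite !mxE.
  move=> f00; have : of_reim u = 0 by rewrite uE f00 mulmx0.
  move=> /(congr1 (@reim _)); rewrite of_reimK -l2normE f0 mulr0 => ->.
  have -> : reim (0 : 'cV[R[i]]_#|{: w}|) = 0 by congr pair; apply/colP => j; rewrite !mxE.
  by rewrite /hnorm /ip2 /ipc !big1 ?addr0 ?sqrtr0// => j _; rewrite mxE mulr0.
have fp : 0 < l2norm f by rewrite lt_neqAle eq_sym f0 sqrtr_ge0.
have H2 := prehilbert2 (@prehilbert_col R #|{: w}|).
have l2Z (x : R) (v : 'cV[R[i]]_#|{: w}|) : 0 <= x ->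
    l2norm ((x%:C)%C *: v) = x * l2norm v.
  move=> x0; rewrite !l2normE -[x in RHS](ger0_norm x0) -(hnorm_scale H2)//.
  congr (hnorm _ _); congr pair; apply/colP => j; rewrite !mxE.
    by rewrite cReM/= mul0r subr0.
  by rewrite cImM/= mul0r addr0.
have fi : 0 <= (l2norm f)^-1 by rewrite invr_ge0 ltW.
pose g : 'cV[R[i]]_#|{: w}| := ((l2norm f)^-1%:C)%C *: f.
have g1 : l2norm g <= 1 by rewrite l2Z// mulVf.
have : ((l2norm (invmx M *m g))%:E <= C%:E)%E.
  by apply: le_trans nM; apply: ereal_sup_ubound; exists g.
rewrite lee_fin -scalemxAr -uE l2Z// mulrC ler_pdivrMr// l2normE of_reimK.
by rewrite -l2normE.
Qed.

End matrix_glue.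

(** * Distance to [-1, 1], and stability *)

Section distance_to_interval.
Context {R : realType}.
Implicit Types (lam : R[i]).

Definition clamp (s : R) : R := Num.max (-1) (Num.min s 1).

Lemma clamp_itv s : -1 <= clamp s <= 1.
Proof. by rewrite /clamp le_max lexx/= ge_max ge_min lexx orbT andbT; lra. Qed.

Definition interval_dist lam : R :=
  Num.sqrt ((complex.Re lam - clamp (complex.Re lam)) ^+ 2 + complex.Im lam ^+ 2).

Lemma clampP s x : -1 <= x <= 1 -> (s - clamp s) ^+ 2 <= (s - x) ^+ 2.
Proof.
move=> /andP[x0 x1]; rewrite /clamp.
have [s1|s1] := leP s 1.
  have [s2|s2] := leP (-1) s; first by rewrite subrr expr0n sqr_ge0.
  have h1 : 0 <= (x + 1) * (- 1 - s) by rewrite mulr_ge0//; lra.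
  by have h2 := sqr_ge0 (x + 1); rewrite !expr2 in h2 *; nra.
have -> : Num.max (-1) 1 = 1 :> R by apply/max_idPr; lra.
have h1 : 0 <= (1 - x) * (s - 1) by rewrite mulr_ge0//; lra.
by have h2 := sqr_ge0 (1 - x); rewrite !expr2 in h2 *; nra.
Qed.

Lemma interval_dist_le lam x : -1 <= x <= 1 ->
  interval_dist lam ^+ 2 <= (complex.Re lam - x) ^+ 2 + complex.Im lam ^+ 2.
Proof.
move=> x1; rewrite sqr_sqrtr ?addr_ge0 ?sqr_ge0//.
by rewrite lerD2r clampP.
Qed.

Lemma interval_dist_gt0 lam : ~ cinterval lam -> 0 < interval_dist lam.
Proof.
move=> h; rewrite lt_neqAle sqrtr_ge0 andbT eq_sym; apply/eqP => d0; apply: h.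
have := congr1 (fun x => x ^+ 2) d0; rewrite sqr_sqrtr ?addr_ge0 ?sqr_ge0// expr0n/=.
move=> /eqP; rewrite paddr_eq0 ?sqr_ge0// !sqrf_eq0 subr_eq0 => /andP[/eqP sE /eqP t0].
exists (complex.Re lam); first by rewrite /= in_itv/= sE clamp_itv.
by case: lam sE t0 {d0} => s t /= _ ->.
Qed.

Lemma interval_perturb (x e : R) : -1 <= x <= 1 -> 0 < e ->
  exists2 y, -1 < y < 1 & `|x - y| <= e.
Proof.
move=> x1 e0; pose z := Num.min e 2^-1.
have z0 : 0 < z by rewrite lt_min e0/= invr_gt0.
have ze : z <= e by rewrite ge_min lexx.
have zh : z <= 2^-1 by rewrite ge_min lexx orbT.
exists (x * (1 - z)); first by move: x1 => /andP[? ?]; apply/andP; split; nra.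
have -> : x - x * (1 - z) = x * z by ring.
by rewrite normrM (gtr0_norm z0) (le_trans _ ze)// ler_piMl ?(ltW z0)// ler_norml.
Qed.

End distance_to_interval.

Section stability.
Context {R : realType}.
Variables (a b : R) (org : nat -> R).
Hypothesis ab : a < b.
Local Notation hn2 := (hnorm (ip2 ipc)).

Lemma stable_of_not_cinterval (lam : R[i]) : ~ cinterval lam -> stable a b org lam.
Proof.
move=> /interval_dist_gt0 d0; have dP := @interval_dist_le _ lam.
exists (interval_dist lam)^-1 => N N0 _; split; first exact (matrix_unit a b org N0 d0 dP).
exact (matrix_opnorm_le a b org N0 d0 dP).
Qed.

Lemma not_cinterval_of_stable (lam : R[i]) : stable a b org lam -> ~ cinterval lam.
Proof.
move=> [C0 stb] [x]; rewrite /= in_itv/= => x1 lamE.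
pose C := Num.max C0 1; have C1 : 1 <= C by rewrite le_max lexx orbT.
have Cp : 0 < C by exact: lt_le_trans C1.
(* The symbol attains interior values at interior angles, hence [mu]. Replacing [x] by it costs at
   most half of the norm of [u] in the stability estimate, and the left-hand side absorbs this. *)
have [mu /andP[mu0 mu1] xmu] : exists2 y, -1 < y < 1 & `|x - y| <= (2 * C)^-1.
  by apply: interval_perturb => //; rewrite invr_gt0 mulr_gt0.
have pp : 0 < pi :> R := pi_gt0 R.
have psi2 : 0 < pi * (1 - mu) < 2 * pi.
  by rewrite mulr_gt0//= ?subr_gt0// mulrC ltr_pM2r//; move: mu0; lra.
have muE : weight (pi * (1 - mu)) = mu.
  by rewrite /weight mulrAC divff ?gt_eqF// mul1r; ring.
have [K KP] := approximate_eigenvector psi2; rewrite muE in KP.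
(* Stability will bound the number of grid points by [(2 * C) ^+ 2] times [|K|]. One unit is lost in
   counting these points, the other leaves a margin for the contradiction. *)
pose B : R := (2 * C) ^+ 2 * `|K| + 2.
pose N := (Num.truncn (B / (b - a))).+1.
have NB : B < N%:R * (b - a) by rewrite -ltr_pdivrMr ?subr_gt0// truncnS_gt.
have [M [MP nP]] := omega_block org ab (ltn0Sn _ : (0 < N)%N).
have nB : (2 * C) ^+ 2 * `|K| + 1 < #|{: omega a b org N}|%:R.
  by apply: lt_le_trans nP; move: NB; rewrite /B; lra.
have w0 : omega a b org N != fset0.
  apply/eqP => w0; move: nB; rewrite w0 -cardfE cardfs0 => nB.
  by have := mulr_ge0 (sqr_ge0 (2 * C)) (normr_ge0 K); lra.
have [uM nM] := stb N (ltn0Sn _) w0.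
have [u [un uK]] := KP _ _ M (@idx_inj _ a b org N) MP.
have := opnorm_lower_bound (ltn0Sn _ : (0 < N)%N) uM nM u.
rewrite -lamE /= => hC0.
set S := Scol (@idx (omega a b org N)) in uK hC0.
have [_ h] := @lamop_perturb _ _ _ _ prehilbert_col S (fun _ _ => I) mu 0 x u (conj I I).
have E : Num.sqrt ((mu - x) ^+ 2 + 0 ^+ 2) <= (2 * C)^-1.
  by rewrite expr0n addr0 sqrtr_sqr distrC.
have u0 := hnorm_ge0 (ip2 ipc) u; have v0 := hnorm_ge0 (ip2 ipc) (lamop S x 0 u).
have C0C : C0 <= C by rewrite le_max lexx.
move: un uK hC0 h E u0 v0 nB; move: (hn2 u) (hn2 (lamop S mu 0 u)) (hn2 (lamop S x 0 u)).
move: (Num.sqrt _) (#|_|%:R : R) => q k p r v un uK hC0 h E u0 v0.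
have h1 : p <= C * v by apply: (le_trans hC0); rewrite ler_wpM2r.
have h2 : C * v <= C * (r + (2 * C)^-1 * p).
  by rewrite ler_pM2l// (le_trans h)// lerD2l ler_wpM2r.
have h3 : C * (r + (2 * C)^-1 * p) = C * r + p / 2 by field; rewrite gt_eqF.
have h4 : p <= 2 * C * r by move: h1 h2; rewrite h3; lra.
have h5 : p ^+ 2 <= (2 * C * r) ^+ 2 by rewrite lerXn2r ?nnegrE// (le_trans u0 h4).
rewrite un exprMn in h5.
have h6 : (2 * C) ^+ 2 * r ^+ 2 <= (2 * C) ^+ 2 * `|K|.
  by rewrite ler_wpM2l ?sqr_ge0// (le_trans uK)// ler_norm.
by move: (le_trans h5 h6); lra.
Qed.

End stability.

(** * Solvability of the singular integral equation *)

Section complex_L2.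
Context {R : realType}.
Local Notation mu := (@lebesgue_measure R).
Local Notation HL := (@prehilbertL R).
Local Notation hn2 := (hnorm (ip2 (@ipL R))).
Variables (a b : R).
Local Notation Omega := (Omega a b).
Local Notation D2 := (dom2 (L2ab a b)).
Implicit Types (u v f : R -> R[i]) (z : (R -> R) * (R -> R)).

(** Cutting selects the representative that vanishes off ]a, b[, as [L2ab] demands. *)
Definition parts u : (R -> R) * (R -> R) :=
  (cut a b (fun x => complex.Re (u x)), cut a b (fun x => complex.Im (u x))).

Definition of_parts z : R -> R[i] := fun x => (z.1 x +i* z.2 x)%C.

Lemma of_partsK z : D2 z -> parts (of_parts z) = z.
Proof.
case: z => p q [[_ p0] [_ q0]]; congr pair; apply/funext => x;
  by rewrite /cut; case: ifPn => // /[dup] /p0 px /q0 qx.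
Qed.

Lemma OmegaE x : Omega x = (a < x < b) :> Prop.
Proof. by rewrite /Defs.Omega /= in_itv. Qed.

Lemma L2normE u : L2norm a b u =
  ((\int[mu]_x ((parts u).1 x ^+ 2 + (parts u).2 x ^+ 2)%:E) `^ 2^-1)%E.
Proof.
rewrite /L2norm unlock; congr (poweR _ _); apply: eq_integral => x _ /=.
rewrite patchE /cut; have [xab|xab] := boolP (a < x < b).
  rewrite mem_set ?OmegaE//= -sqr_cnorm powR_mulrn// ger0_norm//.
  by rewrite /cnorm; case: (u x) => p q; exact: sqrtr_ge0.
rewrite memNset; last by rewrite OmegaE; exact/negP.
by rewrite normr0 powR0// expr0n addr0.
Qed.

Lemma L2norm_parts u : D2 (parts u) -> L2norm a b u = (hn2 (parts u))%:E.
Proof.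
move=> [[Lp _] [Lq _]]; rewrite L2normE.
have i1 := Lp.2; have i2 := Lq.2.
have -> : (\int[mu]_x ((parts u).1 x ^+ 2 + (parts u).2 x ^+ 2)%:E)%E =
    (ip2 (@ipL R) (parts u) (parts u))%:E.
  rewrite /ip2 EFinD -(sqr_EFin Lp) -(sqr_EFin Lq) -integralD//.
by rewrite poweR_EFin powR12_sqrt// (ph_ge0 (prehilbert2 HL)).
Qed.

Lemma L2_parts u : L2 a b u -> D2 (parts u).
Proof.
move=> [mR mI]; rewrite L2normE => fin.
have mp : measurable_fun setT (parts u).1.
  by rewrite /= cutE; apply/(measurable_restrictT _ (measurable_itv _)).
have mq : measurable_fun setT (parts u).2.
  by rewrite /= cutE; apply/(measurable_restrictT _ (measurable_itv _)).
set I := (\int[mu]_x _)%E in fin.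
have I0 : (0 <= I)%E by apply: integral_ge0 => x _; rewrite lee_fin addr_ge0// sqr_ge0.
have IB : exists B, I = B%:E.
  move: I I0 fin => [B| |]//; first by exists B.
  by rewrite poweRyr ?invr_eq0// ltxx.
have [B BE] := IB.
have fin_part (p : R -> R) : measurable_fun setT p ->
    (forall x, p x ^+ 2 <= (parts u).1 x ^+ 2 + (parts u).2 x ^+ 2) -> L2R p.
  move=> mmp pB; apply: (proj1 (@L2R_of_le R p B mmp _)).
  rewrite -BE; apply: ge0_le_integral => //.
  - by move=> x _; rewrite lee_fin sqr_ge0.
  - by apply/measurable_EFinP; exact: measurable_funX.
  - by apply/measurable_EFinP; apply: measurable_funD; exact: measurable_funX.
  - by move=> x _; rewrite lee_fin.
have z0 (g : R -> R) x : ~~ (a < x < b) -> cut a b g x = 0 by rewrite /cut => /negbTE ->.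
split; (split; last exact: z0); apply: fin_part => // x.
  by rewrite lerDl sqr_ge0.
by rewrite lerDr sqr_ge0.
Qed.

Lemma L2_of_parts z : D2 z -> L2 a b (of_parts z).
Proof.
move=> Dz; have [[[mp _] _] [[mq _] _]] := Dz; split.
- exact: measurable_funTS mp.
- exact: measurable_funTS mq.
by rewrite L2norm_parts of_partsK// ltry.
Qed.

Lemma hnormL_eq0 (f : R -> R) : L2R f ->
  hnorm (@ipL R) f = 0 <-> {ae mu, forall x, f x = 0}.
Proof.
move=> Lf; have E := sqr_EFin Lf.
have mf2 : measurable_fun setT (fun x => (f x ^+ 2)%:E).
  by apply/measurable_EFinP; apply: measurable_funX; exact: Lf.1.
have := ae_eq_integral_abs mu measurableT mf2.
have -> : (\int[mu]_x `|(f x ^+ 2)%:E|)%E = (ipL f f)%:E.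
  by rewrite -E; apply: eq_integral => x _; rewrite gee0_abs// lee_fin sqr_ge0.
move=> [h1 h2]; split.
  move=> f0; have : ((ipL f f)%:E = 0)%E by rewrite -(sqr_hnorm HL) f0 expr0n.
  move/h1; apply: ae_imp => x /(_ I)/= /eqP; rewrite eqe sqrf_eq0.
  by move/eqP.
move=> f0; rewrite /hnorm.
have [] : (ipL f f)%:E = 0%E; last by move->; rewrite sqrtr0.
by apply: h2; apply: ae_imp f0 => x fx _ /=; rewrite fx expr0n.
Qed.

Lemma hnorm2_eq0 z : D2 z ->
  hn2 z = 0 <-> ae_on a b (fun x => z.1 x = 0 /\ z.2 x = 0).
Proof.
move=> [[Lp p0] [Lq q0]]; have [e1 e2] := (hnormL_eq0 Lp, hnormL_eq0 Lq).
have E := hnorm2_sqr HL z; split => [z0|h].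
  move: E; rewrite z0 expr0n => /esym/eqP; rewrite paddr_eq0 ?sqr_ge0//.
  rewrite !sqrf_eq0 => /andP[/eqP/e1 h1 /eqP/e2 h2].
  by apply: ae_imp2 h1 h2 => x.
have h1 : {ae mu, forall x, z.1 x = 0}.
  apply: ae_imp h => x; rewrite OmegaE; have [xab /(_ isT)[]//|xab _] := boolP (a < x < b).
  exact: p0.
have h2 : {ae mu, forall x, z.2 x = 0}.
  apply: ae_imp h => x; rewrite OmegaE; have [xab /(_ isT)[]//|xab _] := boolP (a < x < b).
  exact: q0.
move: E; rewrite (e1.2 h1) (e2.2 h2) expr0n addr0 => /eqP.
by rewrite sqrf_eq0 => /eqP.
Qed.

Lemma ae_on_eqP u v : L2 a b u -> L2 a b v ->
  ae_on a b (fun x => u x = v x) <-> hn2 (parts u - parts v) = 0.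
Proof.
move=> /L2_parts Du /L2_parts Dv.
have Duv := ph_sub (prehilbert2 (prehilbert_ab a b)) Du Dv.
have E x : Omega x -> (parts u - parts v).1 x = complex.Re (u x) - complex.Re (v x) /\
    (parts u - parts v).2 x = complex.Im (u x) - complex.Im (v x).
  rewrite OmegaE => xab.
  by split; rewrite -[LHS]/(cut _ _ _ x - cut _ _ _ x) /cut xab.
split => [h|/hnorm2_eq0 -/(_ Duv) h].
  apply/(hnorm2_eq0 Duv); apply: ae_imp h => x ux xO; have [-> ->] := E x xO.
  by rewrite ux// !subrr.
apply: ae_imp h => x ux xO; have := ux xO; have [-> ->] := E x xO.
move=> [/eqP + /eqP]; rewrite !subr_eq0 => /eqP + /eqP.
by case: (u x) => p q; case: (v x) => p' q' /= -> ->.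
Qed.

End complex_L2.

Section singular_equation.
Context {R : realType}.
Local Notation mu := (@lebesgue_measure R).
Local Notation hn2 := (hnorm (ip2 (@ipL R))).
Variables (a b : R).
Hypothesis ab : a < b.
Local Notation D2 := (dom2 (L2ab a b)).
Local Notation S := (Sop a b).
Local Notation Hab := (prehilbert_ab a b).
Local Notation H2 := (prehilbert2 Hab).
Implicit Types (u v f : R -> R[i]) (z : (R -> R) * (R -> R)) (lam : R[i]).

Lemma truncated_integral_parts u x e :
  complex.Re (truncated_integral a b u x e) = trunc_hilbert (parts a b u).1 e x /\
  complex.Im (truncated_integral a b u x e) = trunc_hilbert (parts a b u).2 e x.
Proof.
have inv y : ((x - y)%:C)%C^-1 = ((x - y)^-1%:C)%C by rewrite fmorphV.
have key (g : R -> R) (h : R -> R) : (forall y, h y = g y / (x - y)) ->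
    \int[mu]_(y in Defs.Omega a b `&` [set y | e < `|x - y|]) h y =
    trunc_hilbert (cut a b g) e x.
  move=> hE; rewrite /trunc_hilbert Rintegral_mkcond [RHS]Rintegral_mkcond.
  apply: eq_Rintegral => y _; rewrite !patchE in_setI /cut hE.
  have -> : (y \in Defs.Omega a b) = (a < y < b).
    by apply/idP/idP; rewrite inE OmegaE.
  by case: (a < y < b); case: (_ \in _); rewrite //= mul0r.
split; apply: key => y.
  by rewrite inv (cReM (u y)) /= mulr0 subr0.
by rewrite inv (cImM (u y)) /= mulr0 add0r.
Qed.

(** Principal values of a square integrable [u] exist almost everywhere by [hilb_trunc], and limits
    are unique; [fht] is thus the graph of an operator, up to null sets. *)
Lemma fhtP u v : L2 a b u -> fht a b u v <->
  ae_on a b (fun x => v x = (S (parts a b u).2 x +i* - S (parts a b u).1 x)%C).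
Proof.
move=> /L2_parts[Dp Dq]; set p := (parts a b u).1 in Dp *; set q := (parts a b u).2 in Dq *.
have tp := hilb_trunc Dp.1 (L2ab_intgT Dp); have tq := hilb_trunc Dq.1 (L2ab_intgT Dq).
have pv x l : is_pv a b u x l <->
    (trunc_hilbert p e x @[e --> 0^'+] --> complex.Re l) /\
    (trunc_hilbert q e x @[e --> 0^'+] --> complex.Im l).
  rewrite /is_pv.
  have -> : (fun e => complex.Re (truncated_integral a b u x e)) = trunc_hilbert p ^~ x.
    by apply/funext => e; have [] := truncated_integral_parts u x e.
  have -> : (fun e => complex.Im (truncated_integral a b u x e)) = trunc_hilbert q ^~ x.
    by apply/funext => e; have [] := truncated_integral_parts u x e.
  by [].
have val x l : a < x < b ->
    ('i%C * (pi : R)%:C%C)^-1 * l = (pi^-1 * complex.Im l +i* - (pi^-1 * complex.Re l))%C.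
  move=> xab; have ci : ('i%C)^-1 = - 'i%C :> R[i] by rewrite complexiE invCi.
  rewrite invfM ci -fmorphV; apply/eqP; rewrite eq_complex cReM cImM cReM cImM cReN cImN /=.
  by apply/andP; split; apply/eqP; ring.
have SE (g : R -> R) x : a < x < b -> S g x = pi^-1 * hilb g x.
  by move=> xab; rewrite /Sop /cut xab.
have tpq : {ae mu, forall x, (trunc_hilbert p e x @[e --> 0^'+] --> hilb p x) /\
    (trunc_hilbert q e x @[e --> 0^'+] --> hilb q x)} by exact: ae_imp2 tp tq.
split; apply: ae_imp2 tpq => x [hp hq] hx; rewrite OmegaE => xab.
  have [|l /pv[lp lq] ->] := hx; first by rewrite OmegaE.
  rewrite (val x)// !SE//.
  have -> : complex.Re l = hilb p x by exact: cvg_unique lp hp.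
  by have -> : complex.Im l = hilb q x by exact: cvg_unique lq hq.
exists (hilb p x +i* hilb q x)%C; first by apply/pv.
by rewrite hx ?OmegaE// (val x)// !SE.
Qed.

Lemma sing_int_eqP lam u f : L2 a b u -> L2 a b f -> sing_int_eq a b lam u f <->
  hn2 (lamop S (complex.Re lam) (complex.Im lam) (parts a b u) - parts a b f) = 0.
Proof.
move=> Lu Lf; have Du := L2_parts Lu; have Df := L2_parts Lf.
have Dl := dom_lamop Hab (@Sop_dom R a b) (complex.Re lam) (complex.Im lam) Du.
have E := hnorm2_eq0 (ph_sub H2 Dl Df).
set P := ae_on a b _ in E.
have Px x : a < x < b ->
    (lamop S (complex.Re lam) (complex.Im lam) (parts a b u) - parts a b f).1 x =
      complex.Re (lam * u x) - S (parts a b u).2 x - complex.Re (f x) /\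
    (lamop S (complex.Re lam) (complex.Im lam) (parts a b u) - parts a b f).2 x =
      complex.Im (lam * u x) + S (parts a b u).1 x - complex.Im (f x).
  move=> xab; have cE (g : R -> R) : cut a b g x = g x by rewrite /cut xab.
  split; rewrite ?cReM ?cImM.
    rewrite -[LHS]/(complex.Re lam * cut a b _ x - complex.Im lam * cut a b _ x
       - S (parts a b u).2 x - cut a b _ x).
    by rewrite !cE.
  rewrite -[LHS]/(complex.Im lam * cut a b _ x + complex.Re lam * cut a b _ x
     + S (parts a b u).1 x - cut a b _ x).
  by rewrite !cE; congr (_ + _ - _); rewrite addrC.
split.
  move=> [v /(fhtP _ Lu) hv hf]; apply/E; apply: ae_imp2 hv hf => x hv hf xO.
  move: (xO); rewrite OmegaE => /Px[-> ->]; rewrite -hf// hv//.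
  by rewrite !cReD !cImD !cReN !cImN/= opprK !subrr.
move=> /E h; exists (fun x => (S (parts a b u).2 x +i* - S (parts a b u).1 x)%C).
  by apply/(fhtP _ Lu); exact: aeW.
apply: ae_imp h => x h xO; have := h xO; move: (xO); rewrite OmegaE => /Px[-> ->].
move=> [/eqP + /eqP]; rewrite !subr_eq0 => /eqP h1 /eqP h2.
apply/eqP; rewrite eq_complex cReD cImD cReN cImN -h1 -h2 /= opprK.
by rewrite !eqxx.
Qed.

End singular_equation.

(** * Solvability and the exact norm of the resolvent *)

Section resolvent.
Context {R : realType}.
Local Notation hn2 := (hnorm (ip2 (@ipL R))).
Variables (a b : R) (lam : R[i]).
Hypothesis ab : a < b.
Local Notation D2 := (dom2 (L2ab a b)).
Local Notation Hab := (prehilbert_ab a b).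
Local Notation H2 := (prehilbert2 Hab).
Local Notation d := (interval_dist lam).
Let T := lamop (Sop a b) (complex.Re lam) (complex.Im lam).
Let T' := lamop (Sop a b) (complex.Re lam) (- complex.Im lam).

Let DT z : D2 z -> D2 (T z).
Proof. exact: (dom_lamop Hab (@Sop_dom R a b)). Qed.

Let DT' z : D2 z -> D2 (T' z).
Proof. exact: (dom_lamop Hab (@Sop_dom R a b)). Qed.

Let adj z z' : D2 z -> D2 z' -> ip2 (@ipL R) (T z) z' = ip2 (@ipL R) z (T' z').
Proof. exact: (lamop_adjoint Hab (@Sop_dom R a b) (@Sop_skew R a b)). Qed.

Lemma resolvent_lower_bound z : ~ cinterval lam -> D2 z -> d * hn2 z <= hn2 (T z).
Proof.
move=> nl; apply: (lamop_lower_bound Hab (@Sop_dom R a b) (@Sop_skew R a b)).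
- exact (skew_numerical_range Hab (@Sop_dom R a b) (@Sop_bounded R a b)).
- exact: sqrtr_ge0.
- exact (@interval_dist_le _ lam).
Qed.

Lemma uniquely_solvable_of_not_cinterval : ~ cinterval lam -> uniquely_solvable a b lam.
Proof.
move=> nl f Lf; have d0 := interval_dist_gt0 nl.
have Df := L2_parts Lf.
have [z Dz zf] := lamop_surjective Hab (@Sop_dom R a b) (@Sop_skew R a b)
  (@Sop_bounded R a b) (@hcomplete_ab R a b) d0 (@interval_dist_le _ lam) Df.
have Lu := L2_of_parts Dz; have uE := of_partsK Dz.
exists (of_parts z); split; first exact Lu.
  by apply/(sing_int_eqP lam Lu Lf); rewrite uE.
move=> u' Lu' /(sing_int_eqP lam Lu' Lf) u'f; apply/(ae_on_eqP Lu' Lu); rewrite uE.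
have Du' := L2_parts Lu'; have Dd := ph_sub H2 Du' Dz.
have E := adjoint_sub H2 DT DT' adj Du' Dz.
have E1 := null_eq_hnorm H2 (DT Dd) (ph_sub H2 (DT Du') (DT Dz)) E.
have E2 : hn2 (T (parts a b u') - T z) <= 0.
  apply: (le_trans (hnorm_sub_triangle H2 (DT Du') (DT Dz) Df)).
  rewrite (hnorm_subC H2 Df (DT Dz)).
  by rewrite -[X in _ + X]/(hnorm _ (_ - _)) zf u'f addr0.
have := resolvent_lower_bound nl Dd; rewrite E1 => h.
have h2 := le_trans h E2; apply/eqP; rewrite eq_le hnorm_ge0 andbT.
by rewrite -(pmulr_rle0 _ d0).
Qed.

Lemma not_cinterval_of_uniquely_solvable : uniquely_solvable a b lam -> ~ cinterval lam.
Proof.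
move=> us [x]; rewrite /= in_itv/= => x1 lamE.
have t0 : complex.Im lam = 0 by rewrite -lamE.
have s0 : complex.Re lam = x by rewrite -lamE.
have TE : T' = T by rewrite /T' /T t0 oppr0.
have symT z z' : D2 z -> D2 z' -> ip2 (@ipL R) (T z) z' = ip2 (@ipL R) z (T z').
  by move=> Dz Dz'; have := adj Dz Dz'; rewrite TE.
have surj z : D2 z -> exists2 z', D2 z' & hn2 (T z' - z) = 0.
  move=> Dz; have Lf := L2_of_parts Dz.
  have [u [Lu uf _]] := us _ Lf; exists (parts a b u); first exact: L2_parts.
  by move/(sing_int_eqP lam Lu Lf): uf; rewrite (of_partsK Dz).
(* Membership of 0 comes from the zero multiple of some function in the space. *)
have D0 : L2ab a b (0 : R -> R).
  have Lc : L2R (phi_cut 0 0 1 1 : R -> R) by exact: L2R_phi_cut.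
  have := ph_scale Hab 0 (L2ab_cut a b Lc); by rewrite scale0r.
have [e e0 eP] := symmetric_surjective_bounded_below H2 (hcomplete2 Hab (@hcomplete_ab R a b))
  DT symT (ex_intro _ (0, 0) (conj D0 D0)) surj.
apply: (Sop_not_bounded_below ab x1 e0) => z Dz.
by have := eP z Dz; rewrite /T s0 t0.
Qed.

Lemma resolvent_norm_le : ~ cinterval lam -> (resolvent_norm a b lam <= (d^-1)%:E)%E.
Proof.
move=> nl; have d0 := interval_dist_gt0 nl.
apply: ge_ereal_sup => _ [u [Lu [f [Lf f1 /(sing_int_eqP lam Lu Lf) uf]]] <-].
have Du := L2_parts Lu; have Df := L2_parts Lf.
move: f1; rewrite (L2norm_parts Df) (L2norm_parts Du) !lee_fin => f1.
have h := resolvent_lower_bound nl Du.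
have E : hn2 (T (parts a b u)) = hn2 (parts a b f) := null_eq_hnorm H2 (DT Du) Df uf.
by rewrite E in h; rewrite -[leRHS]mul1r ler_pdivlMr// mulrC (le_trans h).
Qed.

(** An approximate eigenvector [z] at the point of [-1, 1] nearest to [lam] satisfies
    [|(lam - A) z| <= (d + e) |z|]; scaled to norm [(d + e)^-1], it is the solution for a right-hand
    side of norm at most 1. *)
Lemma resolvent_norm_ge_eps e : ~ cinterval lam -> 0 < e ->
  (((d + e)^-1)%:E <= resolvent_norm a b lam)%E.
Proof.
move=> nl e0; have d0 := interval_dist_gt0 nl; have de := addr_gt0 d0 e0.
have [z Dz ze] : exists2 z, D2 z & hn2 (lamop (Sop a b) (clamp (complex.Re lam)) 0 z) < e * hn2 z.
  apply: contrapT => nex.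
  apply: (Sop_not_bounded_below ab (clamp_itv (complex.Re lam)) e0) => z Dz.
  by rewrite leNgt; apply/negP => lt; apply: nex; exists z.
have z0 : 0 < hn2 z by have := le_lt_trans (hnorm_ge0 _ _) ze; rewrite pmulr_rgt0.
have [h _] := lamop_perturb Hab (@Sop_dom R a b) (complex.Re lam) (complex.Im lam)
  (clamp (complex.Re lam)) Dz.
have Tz : hn2 (T z) <= (d + e) * hn2 z.
  apply: (le_trans h); rewrite -/d mulrDl addrC lerD2l; exact: ltW.
pose c := ((d + e) * hn2 z)^-1; have c0 : 0 < c by rewrite invr_gt0 mulr_gt0.
have Dcz := ph_scale H2 c Dz.
have Tcz : hn2 (T (c *: z)) = c * hn2 (T z).
  rewrite (null_eq_hnorm H2 (DT Dcz) (ph_scale H2 c (DT Dz)) (adjoint_scale H2 DT DT' adj c Dz)).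
  by rewrite (hnorm_scale H2 c (DT Dz)) gtr0_norm.
have Lu := L2_of_parts Dcz; have Lf := L2_of_parts (DT Dcz).
have -> : (d + e)^-1 = hn2 (c *: z).
  rewrite (hnorm_scale H2 c Dz) gtr0_norm// /c invfM -mulrA mulVf ?mulr1// gt_eqF//.
rewrite -[in leLHS](of_partsK Dcz) -(L2norm_parts (L2_parts Lu)).
apply: ereal_sup_ubound; exists (of_parts (c *: z)) => //; split => //.
exists (of_parts (T (c *: z))); split => //.
  rewrite (L2norm_parts (L2_parts Lf)) (of_partsK (DT Dcz)) lee_fin Tcz.
  by rewrite /c mulrC ler_pdivrMr ?mulr_gt0// mul1r.
apply/(sing_int_eqP lam Lu Lf); rewrite (of_partsK Dcz) (of_partsK (DT Dcz)) subrr.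
by rewrite -(scale0r z) (hnorm_scale H2 0 Dz) normr0 mul0r.
Qed.

Lemma resolvent_norm_ge : ~ cinterval lam -> ((d^-1)%:E <= resolvent_norm a b lam)%E.
Proof.
move=> nl; have d0 := interval_dist_gt0 nl.
have le := resolvent_norm_le nl; have ge := resolvent_norm_ge_eps nl ltr01.
move: (resolvent_norm a b lam) le ge (@resolvent_norm_ge_eps ^~ nl) => [r| |]//= _ _ h.
rewrite lee_fin leNgt; apply/negP => rd.
have r0 : 0 < r.
  by have := h 1 ltr01; rewrite lee_fin; apply: lt_le_trans; rewrite invr_gt0 addr_gt0.
have dr : d < r^-1 by rewrite -[d]invrK ltf_pV2// posrE invr_gt0.
(* [d + e] is the midpoint of [d] and [r^-1], so that [(d + e)^-1] still exceeds [r]. *)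
pose e := (r^-1 - d) / 2; have e0 : 0 < e by rewrite divr_gt0// subr_gt0.
have := h e e0; rewrite lee_fin -[r]invrK lef_pV2 ?posrE ?invr_gt0 ?addr_gt0//.
by rewrite /e; lra.
Qed.

End resolvent.

Theorem theorem3p4 (R : realType) (a b : R) (hab : a < b) (org : nat -> R)
    (lam : R[i]) :
  [/\ uniquely_solvable a b lam <-> stable a b org lam,
      stable a b org lam <-> ~ cinterval lam &
      ~ cinterval lam ->
        (resolvent_norm a b lam < +oo)%E /\
        forall N : nat, (0 < N)%N -> omega a b org N != fset0 ->
          (mx_opnorm (invmx (lam%:M - TN a b org N)) <=
           resolvent_norm a b lam)%E].
Proof.
split; first split.
- move=> /(not_cinterval_of_uniquely_solvable hab); exact: stable_of_not_cinterval.
- move=> /(not_cinterval_of_stable hab).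
  exact: uniquely_solvable_of_not_cinterval.
- split; [exact: not_cinterval_of_stable|exact: stable_of_not_cinterval].
move=> nl; have d0 := interval_dist_gt0 nl; split.
  exact: le_lt_trans (resolvent_norm_le a b nl) (ltry _).
move=> N N0 _; apply: le_trans (resolvent_norm_ge hab nl).
exact (matrix_opnorm_le a b org N0 d0 (@interval_dist_le _ lam)).
Qed.
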